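(* Let $K\subset\mathbb{C}$ be a $J$-like non-laminar compact set with no isolated points. Let $V$ be an (open) neighborhood of $K$ such that every connected component of $V$ intersects $K$. Then the set $$\mathcal{I}_V=\{f:V\to\mathbb{C} \mid f(K)=K,\ f \text{ conformal and injective}\}$$ is finite.
   Context: A domain is an open connected subset of the plane. A map $f:V\to\mathbb{C}$ on an open set $V$ is conformal if on each component of $V$ it is locally injective and either holomorphic or anti-holomorphic (the type may vary with the component). Symmetry: for a compact $K\subset\mathbb{C}$ and a domain $D$ with $D\cap K\neq\emptyset$, a holomorphic map $H:D\to\mathbb{C}$ is a (local holomorphic) symmetry of $K$ on $D$ if for $x\in D$: $x\in D\cap K \Leftrightarrow H(x)\in H(D)\cap K$. A point $b\in D$ is an attracting fixed point of $H$ if $H(b)=b$ and $0<|H'(b)|<1$. $K$ is $J$-like if the set of points of $K$ that are attracting fixed points of local holomorphic symmetries of $K$ (each defined on some domain containing the point) is dense in $K$. $K$ is laminar relative to a domain $U$ (with $U\cap K\ne\emptyset$) if every open subset of $U$ intersecting $K$ contains a simply connected domain $\Omega$ for which there are a non-empty compact set $L\subset i\mathbb{R}$ and a univalent (holomorphic injective) map $\psi$ defined in a neighborhood of $\overline\Omega$ with $\psi(\overline{\Omega}\cap K)=[0,1]\times L=\{x+y:x\in[0,1],y\in L\}$. $K$ is non-laminar if there is no domain $U$ (with $U\cap K\neq\emptyset$) relative to which $K$ is laminar. *)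

(* Defs.v *)
From HB Require Import structures.
From mathcomp Require Import all_boot all_order all_algebra.
From mathcomp Require Import complex.
From mathcomp Require Import all_classical all_reals all_analysis.

Set Implicit Arguments.
Unset Strict Implicit.
Unset Printing Implicit Defensive.

Import Order.TTheory GRing.Theory Num.Theory numFieldNormedType.Exports.

Local Open Scope ring_scope.
Local Open Scope classical_set_scope.
Local Open Scope complex_scope.

(* The complex plane is R[i], with the topology of its modulus, seen as a
   normed space over itself: derivability in direction 1 is complex
   differentiability. *)
#[non_forgetful_inheritance]
HB.instance Definition _ (R : rcfType) := NormedModule.copy R[i] R[i]^o.

Section Definitions.
Context {R : realType}.
Implicit Types (f H psi : R[i] -> R[i]) (A D K L U V Omega : set R[i]).

Definition domain D := open D /\ connected D.

(* A map on an open set D is represented by a total function; the predicates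
   on it below depend only on its values on D. *)
Definition holomorphic D f := forall z, D z -> derivable f z 1.

Definition antiholomorphic D f := holomorphic D (fun z => conjc (f z)).

Definition locally_injective A f :=
  forall z, A z -> exists2 N, nbhs z N & set_inj (A `&` N) f.

Definition conformal V f := forall z, V z ->
  let C := connected_component V z in
  locally_injective C f /\ (holomorphic C f \/ antiholomorphic C f).

(* Every loop gamma in Omega is homotopic to a constant, with fixed base point,
   within Omega; h (s, _) is the loop at time s. *)
Definition simply_connected Omega :=
  forall gamma : R -> R[i],
    {within `[0, 1]%classic, continuous gamma} ->
    gamma @` `[0, 1]%classic `<=` Omega ->
    gamma 0 = gamma 1 ->
  exists h : R * R -> R[i],
    [/\ {within `[0, 1]%classic `*` `[0, 1]%classic, continuous h},
        h @` (`[0, 1]%classic `*` `[0, 1]%classic) `<=` Omega,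
        forall t : R, 0 <= t <= 1 -> h (0, t) = gamma t,
        forall t : R, 0 <= t <= 1 -> h (1, t) = gamma 0 &
        forall s : R, 0 <= s <= 1 -> h (s, 0) = gamma 0 /\ h (s, 1) = gamma 0].

Definition local_symmetry K D H :=
  [/\ domain D, D `&` K !=set0, holomorphic D H &
      forall x, D x -> ((D `&` K) x <-> (H @` D `&` K) (H x))].

Definition attracting_fixed_point D H b :=
  [/\ D b, H b = b & 0 < `|H^`()%classic b| < 1].

Definition J_like K :=
  K `<=` closure [set b | K b /\
    exists D H, local_symmetry K D H /\ attracting_fixed_point D H b].

Definition laminar_relative K U :=
  forall O : set R[i], open O -> O `<=` U -> O `&` K !=set0 ->
  exists Omega,
    [/\ domain Omega, simply_connected Omega, Omega `<=` O &
    exists (L N : set R[i]) psi,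
      [/\ L !=set0, compact L & L `<=` [set y | complex.Re y = 0]] /\
      [/\ open N, closure Omega `<=` N, holomorphic N psi, set_inj N psi &
          psi @` (closure Omega `&` K) =
            [set x%:C + y | x in `[0, 1]%classic & y in L]]].

Definition non_laminar K :=
  ~ exists U, [/\ domain U, U `&` K !=set0 & laminar_relative K U].

(* The elements are maps with domain V, i.e., two functions that agree on V
   give the same element. *)
Definition conformal_injective_maps K V : set (V -> R[i]) :=
  [set sigL V f | f in
    [set f | [/\ f @` K = K, conformal V f & set_inj V f]]].

End Definitions.

Arguments conformal_injective_maps {R} K V.

(* Main.v *)
(* The Koebe distortion theorem makes the maps of the theorem uniformly bounded
   and uniformly open near K: since K is uniformly perfect, such a map cannot
   shrink a disc centred on K too much. If there were infinitely many of them,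
   pigeonholing their values on a fine net would give two maps f <> g, of the
   same orientation, that are arbitrarily close near some point of K; then
   h = g^-1 f is a symmetry of K close to, but different from, the identity near
   an attracting fixed point b of a symmetry H. In a coordinate w linearizing H
   (Koenigs), conjugating h by powers of H magnifies its displacement, which
   becomes close to delta c w^p with |c| = 1 and delta small. Letting delta tend
   to 0, K is invariant under the flow of the vector field c w^p, whose time
   coordinate near a point of K distinct from b is a chart showing that K is
   laminar: a contradiction. *)
Require Import Defs.
From mathcomp Require Import all_boot all_order all_algebra.
From mathcomp Require Import complex ring lra.
From mathcomp Require Import all_classical all_reals all_analysis.

Set Implicit Arguments.
Unset Strict Implicit.
Unset Printing Implicit Defensive.

Import Order.TTheory GRing.Theory Num.Theory numFieldNormedType.Exports.

Local Open Scope ring_scope.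
Local Open Scope classical_set_scope.
Local Open Scope complex_scope.

(** * Complex differentiability *)

(** Two maps with close values need not have [g^-1 f] close to the identity: that takes a lower
    bound, common to the whole family, on how far the maps spread points. This is why the Koebe
    theorem is used as a comparison of [f y - p] with [f y' - p] for an omitted value [p]: in this
    form it does not mention the derivative, survives complex conjugation, and also yields the
    openness of injective maps. A small displacement is not enough for a flow either: it takes about
    1 / delta steps to travel for a given time, so each step must follow the field up to a relative
    error [eta] that tends to 0. Conjugation by high powers of the multiplier achieves this, since
    the leading term of the displacement then dominates. The exponent p is chosen once for all
    [eta]; the direction c, found separately for each [eta], is made independent of it by
    compactness of the unit circle. The function theory rests on integrals along squares: radii such
    as [r / 3] and [r / 6] come from squares contained in discs, and no constant is sharp. *)

Section Modulus.
Context {R : realType}.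
Implicit Types (z w : R[i]) (f g : R[i] -> R[i]).

(** The norm of [R[i]] is itself [R[i]]-valued; an [R]-valued modulus puts the estimates within
    reach of [lra] and [nra]. *)
Definition md z : R := Normc.normc z.

Arguments md : simpl never.

Lemma normE z : `|z| = (md z)%:C.
Proof. by case: z. Qed.

Lemma md0 : md 0 = 0. Proof. exact: Normc.normc0. Qed.
Lemma md1 : md 1 = 1. Proof. exact: Normc.normc1. Qed.

Lemma md_ge0 z : 0 <= md z.
Proof. by case: z => a b; exact: sqrtr_ge0. Qed.

Lemma md_eq0 z : (md z == 0) = (z == 0).
Proof. by apply/eqP/eqP => [/Normc.eq0_normc//|->]; rewrite md0. Qed.

Lemma md_gt0 z : (0 < md z) = (z != 0).
Proof. by rewrite lt0r md_ge0 andbT md_eq0. Qed.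

Lemma mdM z w : md (z * w) = md z * md w.
Proof. exact: Normc.normcM. Qed.

Lemma mdV z : md z^-1 = (md z)^-1.
Proof. exact: Normc.normcV. Qed.

Lemma mdX z n : md (z ^+ n) = md z ^+ n.
Proof. by elim: n => [|n IH]; rewrite ?expr0 ?md1// !exprS mdM IH. Qed.

Lemma mdN z : md (- z) = md z.
Proof. exact: normcN. Qed.

Lemma mdD z w : md (z + w) <= md z + md w.
Proof. exact: le_normcD. Qed.

Lemma mdB z w : md (z - w) <= md z + md w.
Proof. by rewrite -[md w]mdN; exact: mdD. Qed.

Lemma mdC z w : md (z - w) = md (w - z).
Proof. by rewrite -mdN opprB. Qed.

Lemma md_tri w z u : md (z - u) <= md (z - w) + md (w - u).
Proof. by rewrite (le_trans _ (mdD _ _))// addrA subrK. Qed.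

Lemma md_triB z w : md z - md w <= md (z - w).
Proof. by rewrite lerBlDr (le_trans _ (mdD _ _))// subrK. Qed.

Lemma md_real (x : R) : md x%:C = `|x|.
Proof. by rewrite /md /= expr0n addr0 sqrtr_sqr. Qed.

Lemma md_i : md 'i = 1.
Proof. by rewrite /md /= expr0n add0r expr1n sqrtr1. Qed.

Lemma md_nat n : md n%:R = n%:R.
Proof. by rewrite -[n%:R](rmorph_nat (real_complex R)) md_real normr_nat. Qed.

Lemma Re_le_md z : `|complex.Re z| <= md z.
Proof.
by case: z => a b /=; rewrite -sqrtr_sqr ler_wsqrtr// lerDl sqr_ge0.
Qed.

Lemma Im_le_md z : `|complex.Im z| <= md z.
Proof.
by case: z => a b /=; rewrite -sqrtr_sqr ler_wsqrtr// lerDr sqr_ge0.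
Qed.

Lemma complexRI z : z = (complex.Re z)%:C + 'i * (complex.Im z)%:C.
Proof. by case: z => a b /=; simpc. Qed.

Lemma md_le_ReIm z : md z <= `|complex.Re z| + `|complex.Im z|.
Proof.
rewrite {1}(complexRI z) (le_trans (mdD _ _))// mdM md_i mul1r.
by rewrite !md_real.
Qed.

Lemma ReB z w : complex.Re (z - w) = complex.Re z - complex.Re w.
Proof. by case: z w => [? ?] [? ?]. Qed.
Lemma ImB z w : complex.Im (z - w) = complex.Im z - complex.Im w.
Proof. by case: z w => [? ?] [? ?]. Qed.
Lemma ReD z w : complex.Re (z + w) = complex.Re z + complex.Re w.
Proof. by case: z w => [? ?] [? ?]. Qed.
Lemma ImD z w : complex.Im (z + w) = complex.Im z + complex.Im w.
Proof. by case: z w => [? ?] [? ?]. Qed.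

Definition ccont f z := forall e : R, 0 < e ->
  exists2 d : R, 0 < d & forall w, md (w - z) < d -> md (f w - f z) < e.

Lemma ccont_cst c z : ccont (fun=> c) z.
Proof. by move=> e e0; exists 1 => // w _; rewrite subrr md0. Qed.

Lemma ccont_id z : ccont id z.
Proof. by move=> e e0; exists e. Qed.

Lemma ccontD f g z : ccont f z -> ccont g z -> ccont (fun w => f w + g w) z.
Proof.
move=> cf cg e e0; have e2 : 0 < e / 2 by lra.
have [d1 d10 h1] := cf _ e2; have [d2 d20 h2] := cg _ e2.
exists (Num.min d1 d2) => [|w]; first by rewrite lt_min d10.
rewrite lt_min => /andP[/h1 a /h2 b].
have := mdD (f w - f z) (g w - g z).
have -> : f w - f z + (g w - g z) = f w + g w - (f z + g z) by ring.
lra.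
Qed.

Lemma ccontN f z : ccont f z -> ccont (fun w => - f w) z.
Proof.
move=> cf e /cf[d d0 h]; exists d => // w /h.
by rewrite -opprD mdN.
Qed.

Lemma ccontB f g z : ccont f z -> ccont g z -> ccont (fun w => f w - g w) z.
Proof. by move=> cf cg; apply: ccontD => //; exact: ccontN. Qed.

Lemma ccontM f g z : ccont f z -> ccont g z -> ccont (fun w => f w * g w) z.
Proof.
move=> cf cg e e0.
pose A := md (f z) + md (g z) + 1.
have fz := md_ge0 (f z); have gz := md_ge0 (g z).
have A0 : 0 < A by rewrite /A; lra.
pose t := Num.min 1 (e / (2 * A)).
have t0 : 0 < t by rewrite lt_min ltr01 divr_gt0// mulr_gt0.
have [d1 d10 h1] := cf _ t0; have [d2 d20 h2] := cg _ t0.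
exists (Num.min d1 d2) => [|w]; first by rewrite lt_min d10.
rewrite lt_min => /andP[/h1 a /h2 b].
have -> : f w * g w - f z * g z =
  (f w - f z) * (g w - g z) + ((f w - f z) * g z + f z * (g w - g z)) by ring.
rewrite (le_lt_trans (mdD _ _))// (le_lt_trans (lerD (lexx _) (mdD _ _)))//.
rewrite !mdM.
have t1 : t <= 1 by rewrite ge_min lexx.
have tA : t * A <= e / 2.
  rewrite -ler_pdivlMr// (_ : e / 2 / A = e / (2 * A)).
    by rewrite ge_min lexx orbT.
  by field; rewrite gt_eqF.
move: a b; set x := md (f w - f z); set y := md (g w - g z) => a b.
have x0 : 0 <= x by exact: md_ge0.
have y0 : 0 <= y by exact: md_ge0.
have : x * y <= t * 1 by rewrite ler_pM// ltW// (lt_le_trans b).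
have : x * md (g z) <= t * md (g z) by rewrite ler_wpM2r// ltW.
have : md (f z) * y <= md (f z) * t by rewrite ler_wpM2l// ltW.
rewrite /A in tA; nra.
Qed.

Lemma ccont_comp f g z : ccont f z -> ccont g (f z) -> ccont (fun w => g (f w)) z.
Proof.
by move=> cf cg e /cg[d /cf[d' d'0 h] k]; exists d' => // w /h /k.
Qed.

Lemma ccontV f z : ccont f z -> f z != 0 -> ccont (fun w => (f w)^-1) z.
Proof.
move=> cf fz0 e e0.
have m0 : 0 < md (f z) by rewrite md_gt0.
pose t := Num.min (md (f z) / 2) (e * md (f z) ^+ 2 / 2).
have t0 : 0 < t by rewrite lt_min !divr_gt0// mulr_gt0// exprn_gt0.
have [d d0 h] := cf _ t0; exists d => // w /h hw.
have t1 : t <= md (f z) / 2 by rewrite ge_min lexx.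
have t2 : t <= e * md (f z) ^+ 2 / 2 by rewrite ge_min lexx orbT.
have fw : md (f z) / 2 < md (f w).
  have := md_triB (f z) (f w); rewrite mdC in hw; lra.
have fw0 : f w != 0 by rewrite -md_gt0; lra.
have -> : (f w)^-1 - (f z)^-1 = - (f w - f z) * (f w)^-1 * (f z)^-1.
  by field; rewrite fw0 fz0.
rewrite !mdM mdN !mdV ltr_pdivrMr// ltr_pdivrMr; last lra.
apply: (lt_le_trans hw); apply: (le_trans t2).
rewrite -!mulrA ler_pM2l//; nra.
Qed.

Lemma ccontX f z n : ccont f z -> ccont (fun w => f w ^+ n) z.
Proof.
move=> cf; elim: n => [|n IH]; first exact: ccont_cst.
by under eq_fun do rewrite exprS; apply: ccontM.
Qed.

Lemma eq_ccont f g z r : 0 < r -> (forall w, md (w - z) < r -> f w = g w) ->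
  ccont f z -> ccont g z.
Proof.
move=> r0 fg cf e /cf[d d0 h]; exists (Num.min d r) => [|w].
  by rewrite lt_min d0.
rewrite lt_min => /andP[/h hw wr]; rewrite -fg// -fg//.
by rewrite subrr md0.
Qed.

(* Caratheodory's formulation, which reduces the rules of differentiation to
   the rules for continuous functions. *)
Definition cdiff f z (d : R[i]) := exists q,
  [/\ forall w, f w = f z + (w - z) * q w, ccont q z & q z = d].

Lemma cdiffP f z d : cdiff f z d <-> forall e : R, 0 < e ->
  exists2 t : R, 0 < t & forall w, md (w - z) < t ->
    md (f w - f z - d * (w - z)) <= e * md (w - z).
Proof.
split=> [[q [qE cq qz]] e /cq[t t0 h]|h].
  exists t => // w wt; rewrite (qE w) -qz.
  have -> : f z + (w - z) * q w - f z - q z * (w - z) = (q w - q z) * (w - z).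
    by ring.
  by rewrite mdM ler_wpM2r ?md_ge0// ltW// h.
exists (fun w => if w == z then d else (f w - f z) / (w - z)); split => [w||].
- have [->|wz] := eqVneq w z; first by rewrite subrr mul0r addr0.
  by field; rewrite subr_eq0.
- move=> e e0; have e2 : 0 < e / 2 by lra.
  have [t t0 ht] := h _ e2; exists t => // w wt; rewrite eqxx.
  have [_|wz] := eqVneq w z; first by rewrite subrr md0.
  have w0 : 0 < md (w - z) by rewrite md_gt0 subr_eq0.
  have := ht _ wt.
  have -> : f w - f z - d * (w - z) = ((f w - f z) / (w - z) - d) * (w - z).
    by field; rewrite subr_eq0.
  rewrite mdM ler_pM2r// => /le_lt_trans; apply; lra.
- by rewrite eqxx.
Qed.

Lemma cdiff_ccont f z d : cdiff f z d -> ccont f z.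
Proof.
move=> [q [qE cq _]]; rewrite (_ : f = fun w => f z + (w - z) * q w); last first.
  by apply/funext.
apply: ccontD; first exact: ccont_cst.
by apply: ccontM => //; apply: ccontB; [exact: ccont_id|exact: ccont_cst].
Qed.

Lemma cdiff_unique f z d d' : cdiff f z d -> cdiff f z d' -> d = d'.
Proof.
move=> /cdiffP h /cdiffP h'; apply/eqP; apply: contraT => dd'.
have m0 : 0 < md (d - d') by rewrite md_gt0 subr_eq0.
have e0 : 0 < md (d - d') / 3 by lra.
have [t t0 ht] := h _ e0; have [t' t'0 ht'] := h' _ e0.
pose s := Num.min t t' / 2.
have mt : 0 < Num.min t t' by rewrite lt_min t0.
have s0 : 0 < s by rewrite /s; lra.
have st : s < t.
  rewrite /s; have : Num.min t t' <= t by rewrite ge_min lexx.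
  lra.
have st' : s < t'.
  rewrite /s; have : Num.min t t' <= t' by rewrite ge_min lexx orbT.
  lra.
have E : md (z + s%:C - z) = s by rewrite addrAC subrr add0r md_real gtr0_norm.
have := ht (z + s%:C); have := ht' (z + s%:C); rewrite E => /(_ st') a /(_ st) b.
have := mdB (f (z + s%:C) - f z - d' * (z + s%:C - z))
  (f (z + s%:C) - f z - d * (z + s%:C - z)).
have -> : f (z + s%:C) - f z - d' * (z + s%:C - z) -
  (f (z + s%:C) - f z - d * (z + s%:C - z)) = (d - d') * s%:C by ring.
rewrite mdM md_real (gtr0_norm s0); nra.
Qed.

Lemma cdiff_cst c z : cdiff (fun=> c) z 0.
Proof.
by exists (fun=> 0); split=> [w||//]; [rewrite mulr0 addr0|exact: ccont_cst].
Qed.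

Lemma cdiff_id z : cdiff id z 1.
Proof.
by exists (fun=> 1); split=> [w||//]; [rewrite /=; ring|exact: ccont_cst].
Qed.

Lemma cdiffD f g z d d' : cdiff f z d -> cdiff g z d' ->
  cdiff (fun w => f w + g w) z (d + d').
Proof.
move=> [q [qE cq <-]] [p [pE cp <-]]; exists (fun w => q w + p w).
split=> [w||//]; last exact: ccontD.
by rewrite qE pE; ring.
Qed.

Lemma cdiffN f z d : cdiff f z d -> cdiff (fun w => - f w) z (- d).
Proof.
move=> [q [qE cq <-]]; exists (fun w => - q w).
split=> [w||//]; last exact: ccontN.
by rewrite qE; ring.
Qed.

Lemma cdiffB f g z d d' : cdiff f z d -> cdiff g z d' ->
  cdiff (fun w => f w - g w) z (d - d').
Proof. by move=> cf cg; apply: cdiffD => //; exact: cdiffN. Qed.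

Lemma cdiffM f g z d d' : cdiff f z d -> cdiff g z d' ->
  cdiff (fun w => f w * g w) z (d * g z + f z * d').
Proof.
move=> cf cg; have Cg := cdiff_ccont cg.
case: cf cg => [q [qE cq <-]] [p [pE cp <-]].
exists (fun w => q w * g w + f z * p w); split=> [w||//].
  by rewrite (qE w) (pE w); ring.
by apply: ccontD; apply: ccontM => //; exact: ccont_cst.
Qed.

Lemma cdiffZ c f z d : cdiff f z d -> cdiff (fun w => c * f w) z (c * d).
Proof.
by move=> cf; have := cdiffM (cdiff_cst c z) cf; rewrite mul0r add0r.
Qed.

Lemma cdiff_comp f g z d d' : cdiff f z d -> cdiff g (f z) d' ->
  cdiff (fun w => g (f w)) z (d' * d).
Proof.
move=> cf cg; have Cf := cdiff_ccont cf.
case: cf cg => [q [qE cq <-]] [p [pE cp <-]].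
exists (fun w => p (f w) * q w); split=> [w||//].
  by rewrite (pE (f w)) {1}(qE w); ring.
by apply: ccontM => //; exact: (ccont_comp Cf).
Qed.

Lemma eq_cdiff f g z d r : 0 < r -> (forall w, md (w - z) < r -> f w = g w) ->
  cdiff f z d -> cdiff g z d.
Proof.
move=> r0 fg /cdiffP cf; apply/cdiffP => e /cf[t t0 h].
exists (Num.min t r) => [|w]; first by rewrite lt_min t0.
rewrite lt_min => /andP[/h hw wr]; rewrite -fg// -fg//.
by rewrite subrr md0.
Qed.

Lemma cdiff_inv z : z != 0 -> cdiff (fun w => w^-1) z (- z^-2).
Proof.
move=> z0; have m0 : 0 < md z by rewrite md_gt0.
apply: (@eq_cdiff (fun w => z^-1 + (w - z) * (- w^-1 * z^-1)) _ _ _ _ m0).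
  move=> w wz; have w0 : w != 0.
    by apply: contraTneq wz => ->; rewrite sub0r mdN ltxx.
  by field; rewrite w0 z0.
exists (fun w => - w^-1 * z^-1); split=> [w||].
- by rewrite subrr mul0r addr0.
- apply: ccontM; last exact: ccont_cst.
  by apply: ccontN; apply: ccontV => //; exact: ccont_id.
- by rewrite mulNr -expr2 exprVn.
Qed.

Lemma cdiffV f z d : cdiff f z d -> f z != 0 ->
  cdiff (fun w => (f w)^-1) z (- d / f z ^+ 2).
Proof.
move=> cf fz0; have := cdiff_comp cf (cdiff_inv fz0).
by rewrite mulNr mulrC -mulNr.
Qed.

Lemma cdiffX f z d n : cdiff f z d ->
  cdiff (fun w => f w ^+ n) z (n%:R * f z ^+ n.-1 * d).
Proof.
move=> cf; elim: n => [|n IH]; first by rewrite !mul0r; exact: cdiff_cst.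
under eq_fun do rewrite exprS.
have := cdiffM cf IH; congr cdiff.
case: n {IH} => [|n] /=; first by ring.
by rewrite -[n.+2%:R]natr1 !exprS; ring.
Qed.

End Modulus.

Arguments md {R} z : simpl never.

(** * Cauchy's theorem and Taylor expansions *)

Section Primitive.
Context {R : realType}.
Implicit Types (F G : R -> R) (g h : R -> R[i]).

Lemma is_deriveP F (x d : R) : is_derive x 1 F d <-> forall e : R, 0 < e ->
  exists2 t : R, 0 < t & forall y, `|y - x| < t ->
    `|F y - F x - d * (y - x)| <= e * `|y - x|.
Proof.
split=> [[dF <-] e e0|h].
  move: dF => /cvgrPdist_le/(_ _ e0).
  rewrite /dnbhs /= near_withinE => /nbhs_ballP[t /= t0 ht].
  exists t => // y yt; have [->|yx] := eqVneq y x.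
    by rewrite !subrr mulr0 subr0 normr0 mulr0.
  have yx0 : y - x != 0 by rewrite subr_eq0.
  have := ht (y - x); rewrite /ball /= sub0r normrN => /(_ yt yx0).
  rewrite -[_ *: 1]/((y - x) * 1) mulr1 subrK -[_ *: (_ - _)]/(_ * _).
  have -> : F y - F x - 'D_1 F x * (y - x) =
     - ('D_1 F x - (y - x)^-1 * (F y - F x)) * (y - x) by field.
  by rewrite normrM normrN => ?; rewrite ler_wpM2r.
have c : (fun h : R => h^-1 *: ((F \o shift x) (h *: 1) - F x)) @ 0^' --> d.
  apply/cvgrPdist_le => e e0; have [t t0 ht] := h _ e0.
  rewrite /dnbhs /= near_withinE; apply/nbhs_ballP; exists t => // k.
  rewrite /ball /= sub0r normrN => kt k0.
  have := ht (k + x); rewrite addrK => /(_ kt).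
  rewrite -[k *: 1]/(k * 1) mulr1 -[_ *: (_ - _)]/(_ * _).
  have -> : F (k + x) - F x - d * k = - (d - k^-1 * (F (k + x) - F x)) * k.
    by field.
  by rewrite normrM normrN ler_pM2r// normr_gt0.
split; first by apply/cvg_ex; exists d.
exact: cvg_lim.
Qed.

Lemma real_primitive_ray F (a : R) : continuous F ->
  exists G, forall x, a < x -> is_derive x 1 G (F x).
Proof.
move=> cF; exists (fun x => \int[lebesgue_measure]_(t in `[a, x]) F t) => x ax.
have xx1 : x < x + 1 by rewrite ltrDl.
have [] := @continuous_FTC1 R F (BLeft a) x (x + 1) xx1 _ _ (cF x).
- apply: continuous_compact_integrable; first exact: segment_compact.
  exact: continuous_subspaceT.
- by rewrite lte_fin.
by move=> dG GE; split; [exact: dG|rewrite -derive1E; exact: GE].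
Qed.

(** Integrals from a base point [a] give a primitive only to the right of [a]. Primitives for two
    base points differ by a constant on their common ray, so normalizing each of them to vanish at 0
    makes them agree. *)
Lemma real_primitive F : continuous F ->
  exists G, forall x : R, is_derive x 1 G (F x).
Proof.
move=> cF; have /choice[P hP] := fun a => real_primitive_ray a cF.
have same a b x y : a < x -> b < x -> a < y -> b < y ->
    P a y - P a x = P b y - P b x.
  wlog xy : x y / x < y.
    move=> W ax bx ay b_y; have [xy|yx|->] := ltgtP x y; last by rewrite !subrr.
    - exact: (W x y).
    - by apply: oppr_inj; rewrite !opprB; exact: (W y x).
  move=> ax bx ay b_y.
  have dD (z : R) : z \in `]x, y[%R -> is_derive z 1 (P a \- P b) ((fun=> 0 : R) z).
    rewrite in_itv/= => /andP[xz _]; rewrite -(subrr (F z)).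
    by apply: is_deriveB; apply: hP; rewrite (lt_trans _ xz).
  have [|c _] := MVT xy dD.
    apply: derivable_within_continuous => z; rewrite in_itv/= => /andP[xz _].
    by apply: derivableB; [have [] := hP a z (lt_le_trans ax xz)|
      have [] := hP b z (lt_le_trans bx xz)].
  by rewrite mul0r /=; lra.
(* A base point to the left of both 0 and [x]. *)
pose N (x : R) : R := - (`|x| + 1).
exists (fun x => P (N x) x - P (N x) 0) => x.
have N0 y : N y < 0 by rewrite /N oppr_lt0 ltr_wpDl.
have Ny y : N y < y.
  by rewrite /N ltrNl (le_lt_trans (ler_norm _))// normrN ltrDl.
(* One base point that serves every [y] within distance 1 of [x]. *)
pose m := N x - 1; have mNx : m < N x by rewrite /m; lra.
have /is_deriveP D := hP m x (lt_trans mNx (Ny x)).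
apply/is_deriveP => e /D[t t0 ht].
exists (Num.min t 1) => [|y]; first by rewrite lt_min t0 ltr01.
rewrite lt_min => /andP[yt y1]; move: (ht _ yt).
suff K z : m < z -> P (N z) z - P (N z) 0 = P m z - P m 0.
  rewrite !K; last 2 first.
  - by rewrite (lt_trans mNx).
  - have := Ny x; rewrite /m /N; move: y1; rewrite ltr_norml; lra.
  by rewrite opprB addrA subrK.
by move=> mz; apply: same => //; rewrite (lt_trans mNx).
Qed.

Definition rcont g (t : R) := forall e : R, 0 < e ->
  exists2 d : R, 0 < d & forall s, `|s - t| < d -> md (g s - g t) < e.

Lemma rcontD g h t : rcont g t -> rcont h t -> rcont (fun s => g s + h s) t.
Proof.
move=> cg ch e e0; have e2 : 0 < e / 2 by lra.
have [d d0 k] := cg _ e2; have [d' d'0 k'] := ch _ e2.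
exists (Num.min d d') => [|s]; first by rewrite lt_min d0.
rewrite lt_min => /andP[/k x /k' y].
have := mdD (g s - g t) (h s - h t).
rewrite addrACA -opprD; lra.
Qed.

Lemma rcontZ c g t : rcont g t -> rcont (fun s => c * g s) t.
Proof.
move=> cg e e0; have c0 : 0 < md c + 1 by have := md_ge0 c; lra.
have [d d0 k] := cg _ (divr_gt0 e0 c0); exists d => // s /k.
rewrite ltr_pdivlMr// -mulrBr mdM mulrC; apply: le_lt_trans.
by rewrite ler_wpM2r ?md_ge0// lerDl.
Qed.

Definition rdiff g (t : R) (d : R[i]) := forall e : R, 0 < e ->
  exists2 r : R, 0 < r & forall s, `|s - t| < r ->
    md (g s - g t - d * (s - t)%:C) <= e * `|s - t|.

Lemma complex_primitive g : (forall t, rcont g t) ->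
  exists G : R -> R[i], forall t, rdiff G t (g t).
Proof.
move=> cg.
have [G1 h1] : exists G, forall x : R, is_derive x 1 G (complex.Re (g x)).
  apply: real_primitive => x; apply/cvgrPdist_lt => e /(cg x)[d d0 h].
  apply/nbhs_ballP; exists d => // y; rewrite /ball /= distrC => /h.
  by apply: le_lt_trans; rewrite distrC -ReB; exact: Re_le_md.
have [G2 h2] : exists G, forall x : R, is_derive x 1 G (complex.Im (g x)).
  apply: real_primitive => x; apply/cvgrPdist_lt => e /(cg x)[d d0 h].
  apply/nbhs_ballP; exists d => // y; rewrite /ball /= distrC => /h.
  by apply: le_lt_trans; rewrite distrC -ImB; exact: Im_le_md.
exists (fun t => G1 t +i* G2 t) => t e e0; have e2 : 0 < e / 2 by lra.
have /is_deriveP/(_ _ e2)[r1 r10 k1] := h1 t.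
have /is_deriveP/(_ _ e2)[r2 r20 k2] := h2 t.
exists (Num.min r1 r2) => [|s]; first by rewrite lt_min r10.
rewrite lt_min => /andP[/k1 a /k2 b].
apply: (le_trans (md_le_ReIm _)).
case: (g t) a b => x y /=; simpc; rewrite /= => a b.
lra.
Qed.

Lemma rdiff_mean_bound g dg (a b M : R) : a <= b ->
  (forall t, a <= t <= b -> rdiff g t (dg t) /\ md (dg t) <= M) ->
  md (g b - g a) <= M * (b - a).
Proof.
rewrite le_eqVlt => /orP[/eqP-> _|ab h]; first by rewrite !subrr md0 mulr0.
pose D := g b - g a; have [D0|D0] := eqVneq D 0.
  rewrite -/D D0 md0 mulr_ge0//; last by rewrite subr_ge0 ltW.
  by rewrite (le_trans (md_ge0 (dg a)))//; apply: (h a _).2; rewrite lexx ltW.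
have m0 : 0 < md D by rewrite md_gt0.
(* Multiplication by [u] rotates the increment [D] onto the positive real axis, so that the real
   mean value theorem for the real part of [u * g] bounds the whole modulus. *)
pose u := (md D)%:C / D.
have u1 : md u = 1 by rewrite mdM mdV md_real gtr0_norm// divff// gt_eqF.
pose F t := complex.Re (u * g t).
have dF t : a <= t <= b -> is_derive t 1 F (complex.Re (u * dg t)).
  move=> /h[hd _]; apply/is_deriveP => e /hd[r r0 hr]; exists r => // s /hr.
  apply: le_trans; rewrite -[X in _ <= X]mul1r -u1 -mdM.
  apply: le_trans (Re_le_md _); rewrite /F -!ReB.
  rewrite (_ : u * (_ - _) = u * g s - u * g t - (u * dg t) * (s - t)%:C).
    by rewrite [in leRHS]ReB; case: (u * dg t) => x y /=; simpc.
  by ring.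
have [|c|c cab] := @MVT R F (fun t => complex.Re (u * dg t)) a b ab.
- by move=> t; rewrite in_itv/= => /andP[ta tb]; apply: dF; rewrite !ltW.
- apply: derivable_within_continuous => t; rewrite in_itv/= => tab.
  by have [] := dF t tab.
- rewrite /F -ReB -mulrBr -/D /u divfK// => /= ->.
  rewrite ler_wpM2r ?subr_ge0 ?(ltW ab)//.
  have [_ hc] : rdiff g c (dg c) /\ md (dg c) <= M.
    by apply: h; move: cab; rewrite in_itv/= => /andP[? ?]; rewrite !ltW.
  rewrite (le_trans (ler_norm _))// (le_trans (Re_le_md _))//.
  by rewrite mdM u1 mul1r.
Qed.

Lemma rdiff_zero g (a b : R) : (forall t, rdiff g t 0) -> g a = g b.
Proof.
move=> h; wlog ab : a b / a <= b.
  by move=> W; have [/W//|/ltW/W//] := leP a b.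
have := @rdiff_mean_bound g (fun=> 0) a b 0 ab; rewrite mul0r => K.
have /K : forall t, a <= t <= b -> rdiff g t 0 /\ md (0 : R[i]) <= 0.
  by move=> t _; rewrite md0.
move=> m; apply/eqP; rewrite eq_sym -subr_eq0 -md_eq0.
by rewrite eq_le m md_ge0.
Qed.

Lemma rdiffD g h t d d' : rdiff g t d -> rdiff h t d' ->
  rdiff (fun s => g s + h s) t (d + d').
Proof.
move=> hg hh e e0; have e2 : 0 < e / 2 by lra.
have [r1 r10 k1] := hg _ e2; have [r2 r20 k2] := hh _ e2.
exists (Num.min r1 r2) => [|s]; first by rewrite lt_min r10.
rewrite lt_min => /andP[/k1 a /k2 b].
have -> : g s + h s - (g t + h t) - (d + d') * (s - t)%:C =
  (g s - g t - d * (s - t)%:C) + (h s - h t - d' * (s - t)%:C) by ring.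
by rewrite (le_trans (mdD _ _))//; lra.
Qed.

Lemma rdiffZ c g t d : rdiff g t d -> rdiff (fun s => c * g s) t (c * d).
Proof.
move=> hg e e0; have c0 := md_ge0 c.
have c1 : 0 < md c + 1 by lra.
have [r r0 k] := hg _ (divr_gt0 e0 c1); exists r => // s /k a.
have -> : c * g s - c * g t - c * d * (s - t)%:C =
  c * (g s - g t - d * (s - t)%:C) by ring.
rewrite mdM; have s0 := normr_ge0 (s - t).
apply: (@le_trans _ _ (md c * (e / (md c + 1) * `|s - t|))).
  by rewrite ler_wpM2l.
rewrite mulrA ler_wpM2r// mulrCA ler_piMr ?ltW//.
by rewrite ltr_pdivrMr// mul1r ltrDl.
Qed.

(* Meaningful only if [g] has a primitive, for instance if [g] is continuous. *)
Definition cint g (a b : R) : R[i] :=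
  let G := xget g [set G : R -> R[i] | forall t, rdiff G t (g t)] in G b - G a.

Lemma cintE g (G : R -> R[i]) a b : (forall t, rdiff G t (g t)) -> cint g a b = G b - G a.
Proof.
move=> hG; rewrite /cint; set H := xget _ _.
have hH : forall t, rdiff H t (g t).
  by apply: (@xgetPex _ g [set G : R -> R[i] | forall t, rdiff G t (g t)]); exists G.
pose D s := H s + -1 * G s.
have /(_ a b)E : forall a b, D a = D b.
  move=> x y; apply: rdiff_zero => t.
  by have := rdiffD (hH t) (rdiffZ (-1) (hG t)); rewrite mulN1r subrr.
apply/eqP; rewrite -subr_eq0; apply/eqP.
have -> : H b - H a - (G b - G a) = D b - D a by rewrite /D; ring.
by rewrite E subrr.
Qed.

Lemma cint_split g b a c : cint g a c = cint g a b + cint g b c.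
Proof. by rewrite /cint /=; set G := xget _ _; ring. Qed.

Lemma cintD g h a b : (forall t, rcont g t) -> (forall t, rcont h t) ->
  cint (fun t => g t + h t) a b = cint g a b + cint h a b.
Proof.
move=> /complex_primitive[G hG] /complex_primitive[H hH].
rewrite (cintE _ _ hG) (cintE _ _ hH).
rewrite (@cintE _ (fun t => G t + H t)); first by ring.
by move=> t; apply: rdiffD.
Qed.

Lemma cintZ c g a b : (forall t, rcont g t) ->
  cint (fun t => c * g t) a b = c * cint g a b.
Proof.
move=> /complex_primitive[G hG].
rewrite (cintE _ _ hG) (@cintE _ (fun t => c * G t)); first by ring.
by move=> t; apply: rdiffZ.
Qed.

Lemma cint_bound g a b M : a <= b -> (forall t, rcont g t) ->
  (forall t, a <= t <= b -> md (g t) <= M) -> md (cint g a b) <= M * (b - a).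
Proof.
move=> ab /complex_primitive[G hG] h; rewrite (cintE _ _ hG).
by apply: (@rdiff_mean_bound _ g) => // t /h.
Qed.

End Primitive.

(** * Goursat's lemma for rectangles *)

Section Goursat.
Context {R : realType}.
Implicit Types (f F g : R[i] -> R[i]) (x y a b r M : R) (z w : R[i]).

Lemma geometric_small (q c e : R) : 0 <= q < 1 -> 0 < e ->
  exists n0, forall n, (n0 <= n)%N -> c * q ^+ n < e.
Proof.
move=> /andP[q0 q1] e0.
have k0 : 0 < e / (`|c| + 1) by rewrite divr_gt0// ltr_wpDl.
have /cvgrPdist_lt/(_ _ k0)[n0 _ h] : q ^+ n @[n --> \oo] --> (0 : R).
  by apply: cvg_expr; rewrite ger0_norm.
exists n0 => n /h /=; rewrite sub0r normrN ger0_norm ?exprn_ge0//.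
rewrite ltr_pdivlMr ?ltr_wpDl// => k.
apply: le_lt_trans k; rewrite mulrC ler_wpM2l ?exprn_ge0//.
by rewrite (le_trans (ler_norm _))// lerDl.
Qed.

Lemma nested_point (u c : nat -> R) :
  (forall n, u n <= u n.+1 /\ u n.+1 + c n.+1 <= u n + c n) ->
  (forall n, 0 <= c n) -> exists X, forall n, u n <= X <= u n + c n.
Proof.
move=> h c0; have up m n : (m <= n)%N -> u m <= u n.
  elim: n => [|n IH]; first by rewrite leqn0 => /eqP->.
  rewrite leq_eqVlt => /orP[/eqP->//|]; rewrite ltnS => /IH /le_trans; apply.
  exact: (h n).1.
have dn m n : (m <= n)%N -> u n + c n <= u m + c m.
  elim: n => [|n IH]; first by rewrite leqn0 => /eqP->.
  rewrite leq_eqVlt => /orP[/eqP->//|]; rewrite ltnS => /IH; apply: le_trans.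
  exact: (h n).2.
have ub n : ubound (range u) (u n + c n).
  move=> _ [m _ <-]; have [mn|/ltnW nm] := leqP m n.
    by rewrite (le_trans (up _ _ mn))// lerDl.
  by rewrite (le_trans _ (dn _ _ nm))// lerDl.
exists (sup (range u)) => n; apply/andP; split.
  by apply: sup_upper_bound; [split; [exists (u 0); exists 0%N|exists (u 0 + c 0)]|exists n].
by apply: ge_sup; [exists (u 0); exists 0%N|].
Qed.

(** The integral of [F z dz] along the boundary of a rectangle, counterclockwise: the factor ['i] is
    [dz / dy] on the vertical sides. *)
Definition rint F x1 x2 y1 y2 : R[i] :=
  (cint (fun x => F (x +i* y1)) x1 x2 - cint (fun x => F (x +i* y2)) x1 x2) +
  'i * (cint (fun y => F (x2 +i* y)) y1 y2 - cint (fun y => F (x1 +i* y)) y1 y2).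

Definition inrect x1 x2 y1 y2 z :=
  x1 <= complex.Re z <= x2 /\ y1 <= complex.Im z <= y2.

(** Whole lines rather than sides: [cint] goes through a primitive on all of [R], so an integrand
    has to be continuous along the entire line that carries a side. *)
Definition onlines x1 x2 y1 y2 z :=
  [\/ complex.Re z = x1, complex.Re z = x2, complex.Im z = y1 |
      complex.Im z = y2].

Definition econt F x1 x2 y1 y2 := forall z, onlines x1 x2 y1 y2 z -> ccont F z.

Lemma subc_h (x x' y : R) : x' +i* y - (x +i* y) = (x' - x)%:C.
Proof. by apply/eqP; rewrite eq_complex /= subrr !eqxx. Qed.

Lemma subc_v (x y y' : R) : x +i* y' - (x +i* y) = 'i * (y' - y)%:C.
Proof.
by apply/eqP; rewrite eq_complex /=; apply/andP; split; apply/eqP; ring.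
Qed.

Lemma md_h (x x' y : R) : md (x' +i* y - (x +i* y)) = `|x' - x|.
Proof. by rewrite subc_h md_real. Qed.

Lemma md_v (x y y' : R) : md (x +i* y' - (x +i* y)) = `|y' - y|.
Proof. by rewrite subc_v mdM md_i mul1r md_real. Qed.

Lemma rcont_h F x y : ccont F (x +i* y) -> rcont (fun x => F (x +i* y)) x.
Proof.
by move=> cF e /cF[d d0 h]; exists d => // s sx; apply: h; rewrite md_h.
Qed.

Lemma rcont_v F x y : ccont F (x +i* y) -> rcont (fun y => F (x +i* y)) y.
Proof.
by move=> cF e /cF[d d0 h]; exists d => // s sx; apply: h; rewrite md_v.
Qed.

Lemma econt_rcont F x1 x2 y1 y2 : econt F x1 x2 y1 y2 ->
  [/\ forall t, rcont (fun x => F (x +i* y1)) t,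
      forall t, rcont (fun x => F (x +i* y2)) t,
      forall t, rcont (fun y => F (x2 +i* y)) t &
      forall t, rcont (fun y => F (x1 +i* y)) t].
Proof.
move=> cF; split => t.
- by apply: rcont_h; apply: cF; exact: Or43.
- by apply: rcont_h; apply: cF; exact: Or44.
- by apply: rcont_v; apply: cF; exact: Or42.
- by apply: rcont_v; apply: cF; exact: Or41.
Qed.

Lemma rintD F g x1 x2 y1 y2 : econt F x1 x2 y1 y2 -> econt g x1 x2 y1 y2 ->
  rint (fun z => F z + g z) x1 x2 y1 y2 = rint F x1 x2 y1 y2 + rint g x1 x2 y1 y2.
Proof.
move=> /econt_rcont[h1 h2 h3 h4] /econt_rcont[k1 k2 k3 k4].
by rewrite /rint !cintD//; ring.
Qed.

Lemma rintZ c F x1 x2 y1 y2 : econt F x1 x2 y1 y2 ->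
  rint (fun z => c * F z) x1 x2 y1 y2 = c * rint F x1 x2 y1 y2.
Proof.
by move=> /econt_rcont[h1 h2 h3 h4]; rewrite /rint !cintZ//; ring.
Qed.

Lemma rint_bound F x1 x2 y1 y2 M : x1 <= x2 -> y1 <= y2 ->
  econt F x1 x2 y1 y2 ->
  (forall z, onlines x1 x2 y1 y2 z -> inrect x1 x2 y1 y2 z -> md (F z) <= M) ->
  md (rint F x1 x2 y1 y2) <= 2 * M * ((x2 - x1) + (y2 - y1)).
Proof.
move=> x12 y12 /econt_rcont[h1 h2 h3 h4] h.
rewrite (le_trans (mdD _ _))// mdM md_i mul1r.
have := mdB (cint (fun x => F (x +i* y1)) x1 x2) (cint (fun x => F (x +i* y2)) x1 x2).
have := mdB (cint (fun y => F (x2 +i* y)) y1 y2) (cint (fun y => F (x1 +i* y)) y1 y2).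
have := @cint_bound _ _ x1 x2 M x12 h1; have := @cint_bound _ _ x1 x2 M x12 h2.
have := @cint_bound _ _ y1 y2 M y12 h3; have := @cint_bound _ _ y1 y2 M y12 h4.
move=> k4 k3 k2 k1.
have {k1} : md (cint (fun x => F (x +i* y1)) x1 x2) <= M * (x2 - x1).
  by apply: k1 => t t12; apply: h; [exact: Or43|split => /=; rewrite // lexx y12].
have {k2} : md (cint (fun x => F (x +i* y2)) x1 x2) <= M * (x2 - x1).
  by apply: k2 => t t12; apply: h; [exact: Or44|split => /=; rewrite // lexx y12].
have {k3} : md (cint (fun y => F (x2 +i* y)) y1 y2) <= M * (y2 - y1).
  by apply: k3 => t t12; apply: h; [exact: Or42|split => /=; rewrite // lexx x12].
have {k4} : md (cint (fun y => F (x1 +i* y)) y1 y2) <= M * (y2 - y1).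
  by apply: k4 => t t12; apply: h; [exact: Or41|split => /=; rewrite // lexx x12].
lra.
Qed.

Lemma eq_rint F g x1 x2 y1 y2 : x1 <= x2 -> y1 <= y2 ->
  econt F x1 x2 y1 y2 -> econt g x1 x2 y1 y2 ->
  (forall z, onlines x1 x2 y1 y2 z -> inrect x1 x2 y1 y2 z -> F z = g z) ->
  rint F x1 x2 y1 y2 = rint g x1 x2 y1 y2.
Proof.
move=> x12 y12 cF cg Fg; apply/eqP; rewrite -subr_eq0 -md_eq0 eq_le md_ge0 andbT.
have cg' : econt (fun z => -1 * g z) x1 x2 y1 y2.
  by move=> z zl; apply: ccontM; [exact: ccont_cst|exact: cg].
have := @rint_bound (fun z => F z + -1 * g z) x1 x2 y1 y2 0 x12 y12.
rewrite rintD// rintZ// mulN1r mulr0 mul0r; apply.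
- by move=> z zl; apply: ccontD; [exact: cF|exact: cg'].
- by move=> z zl zr; rewrite Fg// mulN1r subrr md0.
Qed.

Lemma rint_splitx F x1 x x2 y1 y2 :
  rint F x1 x2 y1 y2 = rint F x1 x y1 y2 + rint F x x2 y1 y2.
Proof.
rewrite /rint (@cint_split _ _ x x1 x2) [in X in _ - X](@cint_split _ _ x x1 x2).
by ring.
Qed.

Lemma rint_splity F x1 x2 y1 y y2 :
  rint F x1 x2 y1 y2 = rint F x1 x2 y1 y + rint F x1 x2 y y2.
Proof.
rewrite /rint (@cint_split _ (fun t => F (x2 +i* t)) y y1 y2).
by rewrite (@cint_split _ (fun t => F (x1 +i* t)) y y1 y2); ring.
Qed.

Lemma ii : 'i * 'i = -1 :> R[i].
Proof. by rewrite -expr2 sqr_i. Qed.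

Lemma rint_derivative (P : R[i] -> R[i]) F x1 x2 y1 y2 :
  (forall z, onlines x1 x2 y1 y2 z -> cdiff P z (F z)) ->
  rint F x1 x2 y1 y2 = 0.
Proof.
move=> dP.
have H y : (forall x, cdiff P (x +i* y) (F (x +i* y))) ->
    forall x x', cint (fun x => F (x +i* y)) x x' = P (x' +i* y) - P (x +i* y).
  move=> dPy x x'; apply: (@cintE _ _ (fun x => P (x +i* y))) => t e e0.
  have /cdiffP/(_ _ e0)[d d0 h] := dPy t; exists d => // s.
  by rewrite -(md_h _ _ y) => /h; rewrite subc_h.
have V x : (forall y, cdiff P (x +i* y) (F (x +i* y))) ->
    forall y y', cint (fun y => F (x +i* y)) y y' =
                 - 'i * (P (x +i* y') - P (x +i* y)).
  move=> dPx y y'; rewrite mulrBr.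
  apply: (@cintE _ _ (fun y => - 'i * P (x +i* y))) => t e e0.
  have /cdiffP/(_ _ e0)[d d0 h] := dPx t; exists d => // s.
  rewrite -(md_v x) => /h; congr (_ <= _).
  rewrite -[LHS]mul1r -md_i -mdN -mdM; congr md.
  rewrite subc_v.
  have -> : - 'i * (P (x +i* s) - P (x +i* t) - F (x +i* t) * ('i * (s - t)%:C)) =
    - 'i * P (x +i* s) - - 'i * P (x +i* t) + 'i * 'i * F (x +i* t) * (s - t)%:C.
    by ring.
  by rewrite ii; ring.
have H1 : forall x, cdiff P (x +i* y1) (F (x +i* y1)).
  by move=> x; apply: dP; exact: Or43.
have H2 : forall x, cdiff P (x +i* y2) (F (x +i* y2)).
  by move=> x; apply: dP; exact: Or44.
have V1 : forall y, cdiff P (x1 +i* y) (F (x1 +i* y)).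
  by move=> y; apply: dP; exact: Or41.
have V2 : forall y, cdiff P (x2 +i* y) (F (x2 +i* y)).
  by move=> y; apply: dP; exact: Or42.
rewrite /rint (H _ H1) (H _ H2) (V _ V1) (V _ V2).
set A := P (x1 +i* y1); set B := P (x2 +i* y1); set C := P (x1 +i* y2).
set D := P (x2 +i* y2).
have -> : B - A - (D - C) + 'i * (- 'i * (D - B) - - 'i * (C - A)) =
  (B - A - (D - C)) - 'i * 'i * (D - B - (C - A)) by ring.
by rewrite ii; ring.
Qed.

Lemma rint_affine (c d : R[i]) x1 x2 y1 y2 :
  rint (fun z => c + d * z) x1 x2 y1 y2 = 0.
Proof.
apply: (@rint_derivative (fun z => c * z + d / 2 * (z * z))) => z _.
have -> : c + d * z = c * 1 + d / 2 * (1 * z + z * 1) by field.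
apply: cdiffD; apply: cdiffZ; first exact: cdiff_id.
by apply: cdiffM; exact: cdiff_id.
Qed.

Lemma pick_quarter (z1 z2 z3 z4 : R[i]) (m : R) : m <= md (z1 + z2 + (z3 + z4)) ->
  [\/ m / 4 <= md z1, m / 4 <= md z2, m / 4 <= md z3 | m / 4 <= md z4].
Proof.
move=> h; have := mdD (z1 + z2) (z3 + z4); have := mdD z1 z2; have := mdD z3 z4.
move=> h1 h2 h3.
have [|k1] := leP (m / 4) (md z1); first by move=> ?; exact: Or41.
have [|k2] := leP (m / 4) (md z2); first by move=> ?; exact: Or42.
have [|k3] := leP (m / 4) (md z3); first by move=> ?; exact: Or43.
by apply: Or44; lra.
Qed.

(* [F] itself need not be differentiable on the boundary of the rectangle. *)
Lemma goursat f F x1 x2 y1 y2 : x1 <= x2 -> y1 <= y2 ->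
  (forall z, ccont F z) ->
  (forall z, inrect x1 x2 y1 y2 z -> F z = f z /\ exists d, cdiff f z d) ->
  rint F x1 x2 y1 y2 = 0.
Proof.
move=> x12 y12 cF hf; pose a := x2 - x1; pose b := y2 - y1.
have a0 : 0 <= a by rewrite subr_ge0.
have b0 : 0 <= b by rewrite subr_ge0.
pose wd n : R := a * 2^-1 ^+ n; pose ht n : R := b * 2^-1 ^+ n.
pose J n (p : R * R) := rint F p.1 (p.1 + wd n) p.2 (p.2 + ht n).
have wdS n : wd n = wd n.+1 + wd n.+1 by rewrite /wd exprS; field.
have htS n : ht n = ht n.+1 + ht n.+1 by rewrite /ht exprS; field.
have wd0 n : 0 <= wd n by rewrite mulr_ge0 ?exprn_ge0 ?invr_ge0.
have ht0 n : 0 <= ht n by rewrite mulr_ge0 ?exprn_ge0 ?invr_ge0.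
(* Bisection: given the lower left corner of a rectangle of generation [n], [st] picks that of a
   quarter carrying at least a fourth of the integral. *)
have /choice[st hst] : forall q : nat * (R * R), exists p : R * R,
    [/\ p.1 = q.2.1 \/ p.1 = q.2.1 + wd q.1.+1,
        p.2 = q.2.2 \/ p.2 = q.2.2 + ht q.1.+1 &
        md (J q.1 q.2) / 4 <= md (J q.1.+1 p)].
  move=> [n [x y]] /=.
  have : md (J n (x, y)) <= md (J n (x, y)) by [].
  have E : J n (x, y) = J n.+1 (x, y) + J n.+1 (x, y + ht n.+1) +
      (J n.+1 (x + wd n.+1, y) + J n.+1 (x + wd n.+1, y + ht n.+1)).
    rewrite /J /= (rint_splitx _ _ (x + wd n.+1)).
    rewrite (rint_splity _ x _ _ (y + ht n.+1)).
    rewrite (rint_splity _ (x + wd n.+1) _ _ (y + ht n.+1)).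
    by rewrite (wdS n) (htS n) ![_ + (_ n.+1 + _)]addrA.
  rewrite {2}E => /pick_quarter[] k.
  - by exists (x, y); split => //; left.
  - by exists (x, y + ht n.+1); split => //; [left|right].
  - by exists (x + wd n.+1, y); split => //; [right|left].
  - by exists (x + wd n.+1, y + ht n.+1); split => //; right.
pose s := fix s n := if n is m.+1 then st (m, s m) else (x1, y1).
have sS n : s n.+1 = st (n, s n) by [].
have Js n : md (rint F x1 x2 y1 y2) / 4 ^+ n <= md (J n (s n)).
  elim: n => [|n IH].
    by rewrite expr0 divr1 /J /wd /ht expr0 !mulr1 /= !subrKC.
  have [_ _] := hst (n, s n); rewrite -sS /=; apply: le_trans.
  rewrite exprSr invfM mulrA; lra.
have [X hX] : exists X, forall n, (s n).1 <= X <= (s n).1 + wd n.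
  apply: nested_point => // n; have := wdS n; have := wd0 n.+1.
  by have [+ _ _] := hst (n, s n); rewrite -sS /= => -[] ->; split; lra.
have [Y hY] : exists Y, forall n, (s n).2 <= Y <= (s n).2 + ht n.
  apply: nested_point => // n; have := htS n; have := ht0 n.+1.
  by have [_ + _] := hst (n, s n); rewrite -sS /= => -[] ->; split; lra.
have sub n : [/\ x1 <= (s n).1, (s n).1 + wd n <= x2, y1 <= (s n).2 &
    (s n).2 + ht n <= y2].
  elim: n => [|n [h1 h2 h3 h4]].
    by rewrite /= /wd /ht !expr0 !mulr1 !subrKC !lexx.
  have := wdS n; have := wd0 n.+1; have := htS n; have := ht0 n.+1.
  move=> k1 k2 k3 k4; have [k5 k6 _] := hst (n, s n); rewrite -sS /= in k5 k6.
  by clear -h1 h2 h3 h4 k1 k2 k3 k4 k5 k6; case: k5 => ->; case: k6 => ->; split; lra.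
pose z0 := X +i* Y.
have z0r : inrect x1 x2 y1 y2 z0.
  have [h1 h2 h3 h4] := sub 0%N; have := hX 0%N; have := hY 0%N.
  rewrite /inrect /= in h1 h2 h3 h4 *; lra.
have [Fz0 [d /cdiffP df]] := hf _ z0r.
apply/eqP; rewrite -md_eq0 eq_le md_ge0 andbT; apply/ler_addgt0Pr => e e0.
rewrite add0r.
have ab0 : 0 < 2 * (a + b) * (a + b) + 1 by rewrite ltr_wpDl// !mulr_ge0// addr_ge0.
pose e' := e / (2 * (a + b) * (a + b) + 1).
have e'0 : 0 < e' by rewrite divr_gt0.
have [t t0 ht'] := df _ e'0.
have [|n /(_ n (leqnn n)) small] := @geometric_small 2^-1 (a + b) t _ t0.
  by apply/andP; split; lra.
have szn : wd n + ht n < t by rewrite -mulrDl.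
have [s1 s2 s3 s4] := sub n.
(* Subtracting the tangent affine map, whose integral vanishes, leaves an integrand of size at most
   [e' * (wd n + ht n)]. The bound is thus quadratic in the sides, whose two factors [2^-1 ^+ n]
   cancel the [4 ^+ n] of [Js]. *)
have B : md (J n (s n)) <= 2 * (e' * (wd n + ht n)) * (wd n + ht n).
  pose E z := F z + -1 * (F z0 + d * (z - z0)).
  have cA z : ccont (fun z => F z0 + d * (z - z0)) z.
    apply: ccontD; first exact: ccont_cst.
    apply: ccontM; first exact: ccont_cst.
    by apply: ccontB; [exact: ccont_id|exact: ccont_cst].
  have cA' z : ccont (fun z => -1 * (F z0 + d * (z - z0))) z.
    by apply: ccontM => //; exact: ccont_cst.
  have -> : J n (s n) = rint E (s n).1 ((s n).1 + wd n) (s n).2 ((s n).2 + ht n).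
    rewrite /E rintD; [|by move=> ? _|by move=> ? _].
    rewrite rintZ; last by move=> ? _.
    rewrite (_ : (fun z => F z0 + d * (z - z0)) =
                 (fun z => (F z0 - d * z0) + d * z)); last first.
      by apply/funext => z; ring.
    by rewrite rint_affine mulr0 addr0.
  have -> : wd n + ht n = ((s n).1 + wd n - (s n).1) + ((s n).2 + ht n - (s n).2).
    by ring.
  apply: rint_bound; rewrite ?lerDl//.
    by move=> z _; apply: ccontD.
  move=> z _ [zx zy]; have := hX n; have := hY n => Yn Xn.
  have zr : inrect x1 x2 y1 y2 z by clear -zx zy s1 s2 s3 s4; split; lra.
  have dz : md (z - z0) <= wd n + ht n.
    clear -zx zy Xn Yn; apply: (le_trans (md_le_ReIm _)); rewrite ReB ImB /=.
    by apply: lerD; rewrite ler_norml; apply/andP; split; lra.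
  rewrite /E (hf _ zr).1 mulN1r opprD addrA Fz0.
  apply: (le_trans (ht' _ _)); first exact: le_lt_trans szn.
  have -> : (s n).1 + wd n - (s n).1 + ((s n).2 + ht n - (s n).2) = wd n + ht n.
    by ring.
  by rewrite ler_pM2l.
have := le_trans (Js n) B; rewrite ler_pdivrMr ?exprn_gt0// => K.
apply: (le_trans K).
have -> : 2 * (e' * (wd n + ht n)) * (wd n + ht n) * 4 ^+ n =
   e' * (2 * (a + b) * (a + b)) * ((2^-1 * 2^-1) * 4) ^+ n.
  by rewrite /wd /ht !exprMn; ring.
have -> : 2^-1 * 2^-1 * 4 = 1 :> R by field.
rewrite expr1n mulr1 /e' -mulrA ler_piMr ?(ltW e0)// mulrC ler_pdivrMr//.
by rewrite mul1r lerDl.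
Qed.

(* Outside the shrinking square around [w], Goursat's lemma applies. *)
Lemma goursat_punctured f F x1 x2 y1 y2 w :
  x1 < complex.Re w < x2 -> y1 < complex.Im w < y2 ->
  (forall z, ccont F z) ->
  (forall z, inrect x1 x2 y1 y2 z -> z != w -> F z = f z /\ exists d, cdiff f z d) ->
  rint F x1 x2 y1 y2 = 0.
Proof.
move=> /andP[w1 w2] /andP[w3 w4] cF hf.
apply/eqP; rewrite -md_eq0 eq_le md_ge0 andbT; apply/ler_addgt0Pr => e e0.
rewrite add0r; pose M := md (F w) + 1.
have M0 : 0 < M by have := md_ge0 (F w); rewrite /M; lra.
have [t t0 ht] := cF w _ (ltr01 : (0 : R) < 1).
(* The half-side of a square around [w]: it stays inside the rectangle, [m <= t / 4] keeps [F]
   bounded by [M] on it, and [m <= e / (8 * M)] makes its integral at most [e]. *)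
pose m := Num.min (Num.min (complex.Re w - x1) (x2 - complex.Re w))
           (Num.min (Num.min (complex.Im w - y1) (y2 - complex.Im w))
             (Num.min (t / 4) (e / (8 * M)))).
have m0 : 0 < m by rewrite !lt_min !subr_gt0 w1 w2 w3 w4 !divr_gt0// mulr_gt0.
have : m <= m by [].
rewrite {2}/m !le_min => /and3P[/andP[m1 m2] /andP[m3 m4] /andP[m5 m6]].
pose X := complex.Re w; pose Y := complex.Im w.
have W z : (complex.Re z != X) || (complex.Im z != Y) -> z != w.
  by apply: contraL => /eqP->; rewrite !eqxx.
rewrite (rint_splitx _ _ (X - m)) (rint_splitx _ (X - m) (X + m)).
rewrite (rint_splity _ (X - m) (X + m) _ (Y - m)).
rewrite (rint_splity _ (X - m) (X + m) (Y - m) (Y + m)).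
rewrite -/X -/Y in w1 w2 w3 w4 m1 m2 m3 m4.
have G a1 a2 b1 b2 : a1 <= a2 -> b1 <= b2 -> x1 <= a1 -> a2 <= x2 -> y1 <= b1 ->
    b2 <= y2 -> (a2 < X \/ X < a1 \/ b2 < Y \/ Y < b1) ->
    rint F a1 a2 b1 b2 = 0.
  move=> h1 h2 h3 h4 h5 h6 h7; apply: (@goursat f) => // z [zx zy].
  have [zx1 zx2] := andP zx; have [zy1 zy2] := andP zy; apply: hf.
    by split; apply/andP; split; [exact: le_trans zx1|exact: le_trans h4|
      exact: le_trans zy1|exact: le_trans h6].
  apply: W; apply/orP; case: h7 => [h|[h|[h|h]]].
  - by left; rewrite lt_eqF// (le_lt_trans zx2).
  - by left; rewrite gt_eqF// (lt_le_trans h).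
  - by right; rewrite lt_eqF// (le_lt_trans zy2).
  - by right; rewrite gt_eqF// (lt_le_trans h).
have Xm : X - m < X by rewrite ltrBlDr ltrDl.
have mX : X < X + m by rewrite ltrDl.
have Ym : Y - m < Y by rewrite ltrBlDr ltrDl.
have mY : Y < Y + m by rewrite ltrDl.
have X1 : x1 <= X - m by rewrite lerBrDl -lerBrDr.
have X2 : X + m <= x2 by rewrite -lerBrDl.
have Y1 : y1 <= Y - m by rewrite lerBrDl -lerBrDr.
have Y2 : Y + m <= y2 by rewrite -lerBrDl.
have XX := ltW (lt_trans Xm mX); have YY := ltW (lt_trans Ym mY).
have Y12 : y1 <= y2 := ltW (lt_trans w3 w4).
have -> : rint F x1 (X - m) y1 y2 = 0.
  by apply: G => //; [rewrite (le_trans (ltW Xm))// ltW|left].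
have -> : rint F (X + m) x2 y1 y2 = 0.
  by apply: G => //; [rewrite (le_trans _ (ltW mX))// ltW|right; left].
have -> : rint F (X - m) (X + m) y1 (Y - m) = 0.
  by apply: G => //; [rewrite (le_trans (ltW Ym))// ltW|right; right; left].
have -> : rint F (X - m) (X + m) (Y + m) y2 = 0.
  by apply: G => //; [rewrite (le_trans _ (ltW mY))// ltW|right; right; right].
rewrite !(add0r, addr0).
have := @rint_bound F (X - m) (X + m) (Y - m) (Y + m) M.
have -> : 2 * M * (X + m - (X - m) + (Y + m - (Y - m))) = m * (8 * M) by ring.
move=> K; apply: (le_trans (K _ _ _ _)); [by []|by []|by move=> ? _| |].
  move=> z _ [zx zy].
  have /ht : md (z - w) < t.
    apply: (le_lt_trans (md_le_ReIm _)); rewrite ReB ImB -/X -/Y.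
    have : `|complex.Re z - X| <= m by rewrite ler_distl.
    have : `|complex.Im z - Y| <= m by rewrite ler_distl.
    clear -m5 t0; lra.
  by have := md_triB (F z) (F w); rewrite /M; clear; lra.
by rewrite -ler_pdivlMr// mulr_gt0.
Qed.

End Goursat.

(** * Cauchy's formula on a square and Taylor's theorem with remainder *)

Section Taylor.
Context {R : realType}.
Implicit Types (f F g G : R[i] -> R[i]) (r s t M rho : R) (z w a : R[i]).

Definition clamp rho (t : R) : R := Num.max (- rho) (Num.min rho t).

Lemma clamp_itv rho t : 0 <= rho -> - rho <= clamp rho t <= rho.
Proof.
move=> r0; rewrite le_max lexx ge_max ge_min lexx andbT.
by rewrite (le_trans _ r0)// oppr_le0.
Qed.

Lemma clamp_id rho t : - rho <= t <= rho -> clamp rho t = t.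
Proof. by move=> /andP[? ?]; rewrite /clamp min_r// max_r. Qed.

Lemma clamp_cases rho t : 0 <= rho ->
  [\/ t <= - rho /\ clamp rho t = - rho, clamp rho t = t |
      rho <= t /\ clamp rho t = rho].
Proof.
move=> r0; have rN : - rho <= rho by lra.
have [rt|tr] := leP rho t.
  by apply: Or33; rewrite /clamp min_l// max_r.
have [tr'|rt] := leP t (- rho).
  by apply: Or31; split=> //; rewrite /clamp (min_r (ltW tr)) max_l.
by apply: Or32; rewrite clamp_id// !ltW.
Qed.

Lemma clamp_lip rho s t : 0 <= rho -> `|clamp rho s - clamp rho t| <= `|s - t|.
Proof.
move=> r0; have := clamp_itv s r0; have := clamp_itv t r0.
have := ler_norm (s - t); have := ler_norm (t - s); rewrite [`|t - s|]distrC.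
rewrite ler_norml.
by case: (clamp_cases s r0) => [[? ->]|->|[? ->]];
  case: (clamp_cases t r0) => [[? ->]|->|[? ->]];
  move=> ? ? /andP[? ?] /andP[? ?]; apply/andP; split; lra.
Qed.

(** A retraction of the plane onto the square of half-side [rho]: composing with it extends a
    function that is continuous on the square to the whole plane, as [cint] demands, without
    changing it on the boundary. *)
Definition clampc rho z : R[i] :=
  clamp rho (complex.Re z) +i* clamp rho (complex.Im z).

Lemma ccont_clampc rho z : 0 <= rho -> ccont (clampc rho) z.
Proof.
move=> r0 e e0; exists (e / 2) => [|w wz]; first by lra.
apply: (le_lt_trans (md_le_ReIm _)); rewrite ReB ImB /=.
have := clamp_lip (complex.Re w) (complex.Re z) r0.
have := clamp_lip (complex.Im w) (complex.Im z) r0.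
have := Re_le_md (w - z); have := Im_le_md (w - z); rewrite ReB ImB; lra.
Qed.

Lemma clampc_id rho z : inrect (- rho) rho (- rho) rho z -> clampc rho z = z.
Proof.
by case: z => x y [/= h1 h2]; rewrite /clampc /= !clamp_id.
Qed.

Lemma clampc_in rho z : 0 <= rho -> inrect (- rho) rho (- rho) rho (clampc rho z).
Proof. by move=> r0; split; exact: clamp_itv. Qed.

Lemma inrect_md rho z : inrect (- rho) rho (- rho) rho z -> md z <= 2 * rho.
Proof.
move=> [h1 h2]; apply: (le_trans (md_le_ReIm _)).
have : `|complex.Re z| <= rho by rewrite ler_norml.
have : `|complex.Im z| <= rho by rewrite ler_norml.
lra.
Qed.

Lemma onlines_md rho z : 0 <= rho -> onlines (- rho) rho (- rho) rho z -> rho <= md z.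
Proof.
move=> r0; have := Re_le_md z; have := Im_le_md z => h1 h2.
by case=> E; [apply: le_trans h2|apply: le_trans h2|apply: le_trans h1|
   apply: le_trans h1]; rewrite E ?normrN ger0_norm.
Qed.

Lemma cint_cst (c : R[i]) (a b : R) : cint (fun=> c) a b = c * (b - a)%:C.
Proof.
rewrite (@cintE _ _ (fun t => c * t%:C)) ?rmorphB/= ?mulrBr// => t e e0.
exists 1 => // s _; rewrite rmorphB /= -!mulrBr subrr mulr0 md0.
by rewrite mulr_ge0// ltW.
Qed.

Lemma invcE (x y : R) :
  (x +i* y)^-1 = (x / (x ^+ 2 + y ^+ 2)) +i* (- (y / (x ^+ 2 + y ^+ 2))).
Proof. by []. Qed.

Section Square.
Variables (rho : R).
Hypothesis rho0 : 0 < rho.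

Let sint F := rint F (- rho) rho (- rho) rho.
Let scont F := econt F (- rho) rho (- rho) rho.
Let bd z := onlines (- rho) rho (- rho) rho z.

Let rhoN : - rho <= rho. Proof. by have := rho0; lra. Qed.

Lemma square_bound F M : scont F ->
  (forall z, bd z -> inrect (- rho) rho (- rho) rho z -> md (F z) <= M) ->
  md (sint F) <= 8 * rho * M.
Proof.
move=> cF h.
have -> : 8 * rho * M = 2 * M * ((rho - - rho) + (rho - - rho)) by ring.
exact: (rint_bound rhoN rhoN cF h).
Qed.

Lemma scontV w : md w < rho -> scont (fun z => (z - w)^-1).
Proof.
move=> wr z /(onlines_md (ltW rho0)) zr; apply: ccontV.
  by apply: ccontB; [exact: ccont_id|exact: ccont_cst].
by rewrite subr_eq0; apply: contraTneq zr => ->; rewrite -ltNge.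
Qed.

Lemma scontVX n : scont (fun z => z^-1 ^+ n).
Proof.
move=> z /(onlines_md (ltW rho0)) zr; apply: ccontX; apply: ccontV.
  exact: ccont_id.
by rewrite -md_gt0 (lt_le_trans rho0).
Qed.

Lemma scontM F G : scont F -> scont G -> scont (fun z => F z * G z).
Proof. by move=> cF cG z h; apply: ccontM; [exact: cF|exact: cG]. Qed.

(** The finite geometric expansion of [(z - w)^-1] in powers of [w / z], integrated term by term
    against [G]. *)
Lemma sint_expand G w N : scont G -> md w < rho ->
  sint (fun z => G z * (z - w)^-1) =
  \sum_(n < N) w ^+ n * sint (fun z => G z * z^-1 ^+ n.+1) +
  sint (fun z => w ^+ N * (G z * (z^-1 ^+ N * (z - w)^-1))).
Proof.
move=> cG wr; have cc c : scont (fun=> c) by move=> ? ?; exact: ccont_cst.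
have cV := scontV wr.
elim: N => [|N ->].
  rewrite big_ord0 add0r; apply: (congr1 sint); apply/funext => z.
  by rewrite !expr0 !mul1r.
rewrite big_ord_recr /= -addrA; congr (_ + _).
rewrite -rintZ; last by apply: scontM => //; exact: scontVX.
rewrite -rintD; last 2 first.
- by apply: scontM => //; apply: scontM => //; exact: scontVX.
- apply: scontM => //; apply: scontM => //; apply: scontM => //; exact: scontVX.
apply: (eq_rint rhoN rhoN).
- apply: scontM => //; apply: scontM => //; apply: scontM => //; exact: scontVX.
- move=> z zb; apply: ccontD.
    by apply: (scontM (cc _) (scontM cG _)) zb; exact: scontVX.
  apply: (scontM (cc _) (scontM cG (scontM _ cV))) zb; exact: scontVX.
- move=> z zb _; have zr := onlines_md (ltW rho0) zb.
  have z0 : z != 0 by rewrite -md_gt0 (lt_le_trans rho0).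
  have zw : z - w != 0.
    by rewrite subr_eq0; apply: contraTneq zr => ->; rewrite -ltNge.
  by rewrite !exprS; field; rewrite zw z0.
Qed.

Lemma sint_rest G w N M : scont G -> md w <= rho / 2 -> 0 <= M ->
  (forall z, bd z -> inrect (- rho) rho (- rho) rho z -> md (G z) <= M) ->
  md (sint (fun z => w ^+ N * (G z * (z^-1 ^+ N * (z - w)^-1)))) <=
    16 * M * (md w / rho) ^+ N.
Proof.
move=> cG w2 M0 h; have wr : md w < rho by have := rho0; lra.
have cc c : scont (fun=> c) by move=> ? ?; exact: ccont_cst.
(* The perimeter is [8 * rho], and on the boundary [rho <= md z] and [rho / 2 <= md (z - w)]. *)
have -> : 16 * M * (md w / rho) ^+ N =
   8 * rho * (md w ^+ N * (M * (rho^-1 ^+ N * (rho / 2)^-1))).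
  by rewrite exprMn; field; rewrite gt_eqF.
apply: square_bound.
  by apply: scontM => //; apply: scontM => //; apply: scontM;
    [exact: scontVX|exact: scontV].
move=> z zb zr; have zm := onlines_md (ltW rho0) zb.
have m0 : 0 < md z by rewrite (lt_le_trans rho0).
have zw : rho / 2 <= md (z - w) by have := md_triB z w; lra.
rewrite !mdM !mdX; have w0 := md_ge0 w.
apply: ler_wpM2l; first by rewrite exprn_ge0.
apply: ler_pM => //; [exact: md_ge0| |exact: h|].
  by rewrite mulr_ge0// ?exprn_ge0// md_ge0.
rewrite !mdV; apply: ler_pM.
- by rewrite exprn_ge0// invr_ge0 ltW.
- by rewrite invr_ge0 md_ge0.
- by rewrite lerXn2r ?nnegrE ?invr_ge0 ?(ltW m0) ?(ltW rho0)// lef_pV2.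
- by rewrite lef_pV2// ?posrE; have := rho0; lra.
Qed.

Lemma sintVX n : sint (fun z => z^-1 ^+ n.+2) = 0.
Proof.
apply: (@rint_derivative _ (fun z => - (n.+1%:R)^-1 * z^-1 ^+ n.+1)) => z zb.
have zr := onlines_md (ltW rho0) zb.
have z0 : z != 0 by rewrite -md_gt0 (lt_le_trans rho0).
have n0 : n.+1%:R != 0 :> R[i] by rewrite pnatr_eq0.
have := cdiffZ (- (n.+1%:R)^-1) (cdiffX n.+1 (cdiff_inv z0)).
congr cdiff; rewrite /= -exprVn !exprS expr0 mulr1.
by move: (n.+1%:R) n0 => k k0; move: (z^-1) (z^-1 ^+ n) => u v; field.
Qed.

Let Lam := sint (fun z => z^-1).

(** [Lam] is 2 pi i, but only a lower bound on its modulus matters. Each pair of opposite sides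
    contributes the integral of [A], which stays within [(2 * rho)^-1] of the constant [c]; so each
    contribution is within 1 of 3i, and [Lam] within 2 of 6i. *)
Lemma Lam_ge : 4 <= md Lam.
Proof.
have P t : 0 < t ^+ 2 + rho ^+ 2 by rewrite ltr_wpDl ?sqr_ge0// exprn_gt0.
pose A t : R[i] := 'i * (2 * rho / (t ^+ 2 + rho ^+ 2))%:C.
have cst : scont (fun z => z^-1).
  by move=> z zb; have := scontVX 1 zb; under eq_fun do rewrite expr1.
have [c1 c2 c3 c4] := econt_rcont cst.
have E1 : A = (fun t => (t +i* - rho)^-1 + -1 * (t +i* rho)^-1).
  apply/funext => t; rewrite !invcE sqrrN mulN1r /A.
  set D := t ^+ 2 + rho ^+ 2; have D0 : D != 0 by rewrite gt_eqF ?P.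
  by apply/eqP; rewrite eq_complex /=; apply/andP; split; apply/eqP; field.
have cA t : rcont A t.
  have := c2 t; have := c1 t => k1 k2.
  by rewrite E1; apply: rcontD => //; exact: rcontZ.
have LE : Lam = cint A (- rho) rho + cint A (- rho) rho.
  have ci c t : rcont (fun=> c : R[i]) t.
    by move=> e e0; exists 1 => // ? _; rewrite subrr md0.
  rewrite /Lam /sint /rint -![- cint _ _ _]mulN1r -!cintZ// -!cintD//; last 2 first.
  - by move=> t; exact: rcontZ.
  - by move=> t; exact: rcontZ.
  rewrite -cintZ; last by move=> t; apply: rcontD => //; exact: rcontZ.
  have E2 : (fun t => 'i * ((rho +i* t)^-1 + -1 * (- rho +i* t)^-1)) = A.
    apply/funext => t; rewrite !invcE sqrrN [rho ^+ 2 + _]addrC mulN1r /A.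
    set D := t ^+ 2 + rho ^+ 2; have D0 : D != 0 by rewrite gt_eqF ?P.
    by apply/eqP; rewrite eq_complex /=; apply/andP; split; apply/eqP; field.
  by rewrite -E1 E2 cintD.
pose c : R[i] := 'i * (3 / 2 / rho)%:C.
have cc t : rcont (fun=> -1 * c) t.
  by move=> e e0; exists 1 => // ? _; rewrite subrr md0.
have K : md (cint A (- rho) rho - 'i * 3%:R) <= 1.
  have -> : cint A (- rho) rho - 'i * 3%:R =
      cint (fun t => A t + -1 * c) (- rho) rho.
    rewrite cintD// cint_cst /c; congr (_ + _).
    have E : 3 / 2 / rho * (rho - - rho) = 3 by field; rewrite gt_eqF.
    have F : 3 = (3 / 2 / rho)%:C * (rho - - rho)%:C :> R[i].
      by rewrite -(rmorphM (real_complex R)) E (rmorph_nat (real_complex R)).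
    by rewrite {1}F; ring.
  have -> : 1 = (2 * rho)^-1 * (rho - - rho) by field; rewrite gt_eqF.
  apply: cint_bound => // [t|t /andP[t1 t2]]; first exact: rcontD.
  have -> : A t + -1 * c =
      'i * (2 * rho / (t ^+ 2 + rho ^+ 2) - 3 / 2 / rho)%:C.
    by rewrite /A /c (rmorphB (real_complex R)) /=; ring.
  rewrite mdM md_i mul1r md_real.
  have -> : 2 * rho / (t ^+ 2 + rho ^+ 2) - 3 / 2 / rho =
     (rho ^+ 2 - 3 * t ^+ 2) / (t ^+ 2 + rho ^+ 2) * (2 * rho)^-1.
    by field; rewrite !gt_eqF.
  rewrite normrM [X in _ * X]gtr0_norm; last by rewrite invr_gt0 mulr_gt0.
  rewrite ler_piMl//; first by rewrite invr_ge0 mulr_ge0// ltW.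
  rewrite normrM normfV [X in _ / X]gtr0_norm// ler_pdivrMr// mul1r.
  have : 0 <= (rho - t) * (rho + t) by apply: mulr_ge0; lra.
  have := sqr_ge0 t; rewrite ler_norml => ? ?; apply/andP; split; lra.
have E6 : md ('i * 3%:R + 'i * 3%:R : R[i]) = 6.
  by rewrite -mulrDr mdM md_i mul1r -natrD md_nat.
rewrite LE; set I := cint A (- rho) rho in K *.
have : 'i * 3%:R + 'i * 3%:R = (I + I) - ((I - 'i * 3%:R) + (I - 'i * 3%:R)).
  by ring.
move=> /(congr1 md); rewrite E6 => E.
have := mdB (I + I) ((I - 'i * 3%:R) + (I - 'i * 3%:R)); rewrite -E.
have := mdD (I - 'i * 3%:R) (I - 'i * 3%:R).
lra.
Qed.

(** In the expansion of [(z - w)^-1] all terms but the first have primitives and integrate to 0, and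
    the remainder tends to 0. *)
Lemma Lam_shift w : md w <= rho / 2 -> sint (fun z => (z - w)^-1) = Lam.
Proof.
move=> w2; have wr : md w < rho by have := rho0; lra.
have cc : scont (fun=> 1) by move=> ? ?; exact: ccont_cst.
have E N : md (sint (fun z => (z - w)^-1) - Lam) <= 16 * 1 * (md w / rho) ^+ N.+1.
  have := @sint_expand (fun=> 1) w N.+1 cc wr.
  rewrite big_ord_recl expr0 mul1r big1 => [|i _].
    rewrite addr0 (_ : (fun z => 1 * (z - w)^-1) = (fun z => (z - w)^-1)); last first.
      by apply/funext => z; rewrite mul1r.
    rewrite (_ : (fun z => 1 * z^-1 ^+ 1) = (fun z => z^-1)); last first.
      by apply/funext => z; rewrite mul1r expr1.
    move=> ->; rewrite addrC addKr.
    by apply: sint_rest => // z _ _; rewrite md1.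
  rewrite -[X in sint X](_ : (fun z => z^-1 ^+ i.+2) = _).
    by rewrite sintVX mulr0.
  by apply/funext => z; rewrite mul1r.
apply/eqP; rewrite -subr_eq0 -md_eq0 eq_le md_ge0 andbT.
apply/ler_addgt0Pr => e e0; rewrite add0r.
have [|n /(_ n.+1 (leqnSn n)) h] := @geometric_small _ (md w / rho) (16 * 1) e _ e0.
  apply/andP; split; first by rewrite divr_ge0 ?md_ge0 ?ltW.
  by rewrite ltr_pdivrMr// mul1r.
by rewrite (le_trans (E n))// ltW.
Qed.

(** The Caratheodory quotient [q] of [f] at [w] is continuous at [w] and differentiable elsewhere on
    the square, so [goursat_punctured] kills its integral; what remains is [f w] times the integral
    of [Lam_shift]. *)
Lemma cauchy_square f w : md w <= rho / 2 ->
  (forall z, inrect (- rho) rho (- rho) rho z -> exists d, cdiff f z d) ->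
  sint (fun z => f (clampc rho z) * (z - w)^-1) = f w * Lam.
Proof.
move=> w2 hf; have r0 := ltW rho0; have wr : md w < rho by have := rho0; lra.
have [w3 w4] : - rho < complex.Re w < rho /\ - rho < complex.Im w < rho.
  rewrite -!ltr_norml; split; first by rewrite (le_lt_trans (Re_le_md _)).
  by rewrite (le_lt_trans (Im_le_md _)).
have win : inrect (- rho) rho (- rho) rho w by split; lra.
have [d [q [fE cq _]]] := hf _ win.
have qd z : inrect (- rho) rho (- rho) rho z -> z != w ->
    exists d, cdiff (fun z => (f z - f w) * (z - w)^-1) z d.
  move=> zr zw; have [d' hd'] := hf _ zr; eexists.
  apply: cdiffM; first by apply: cdiffB; [exact: hd'|exact: cdiff_cst].
  apply: cdiffV; last by rewrite subr_eq0.
  by apply: cdiffB; [exact: cdiff_id|exact: cdiff_cst].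
have qE z : z != w -> q z = (f z - f w) * (z - w)^-1.
  by move=> zw; rewrite fE; field; rewrite subr_eq0.
have cQ z : ccont (fun z => q (clampc rho z)) z.
  apply: ccont_comp; first exact: ccont_clampc.
  have [->//|zw] := eqVneq (clampc rho z) w.
  have [d' hd'] := qd _ (clampc_in z r0) zw.
  have m0 : 0 < md (clampc rho z - w) by rewrite md_gt0 subr_eq0.
  apply: (@eq_ccont _ _ _ _ _ m0 _ (cdiff_ccont hd')) => x xz.
  rewrite qE//; apply: contraTneq xz => ->; by rewrite mdC ltxx.
have Q0 : sint (fun z => q (clampc rho z)) = 0.
  apply: (goursat_punctured w3 w4 cQ) => z zr zw.
  rewrite clampc_id//; split; last exact: qd zw.
  exact: qE.
have cQ' : scont (fun z => q (clampc rho z)) by move=> ? _.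
have cV := scontV wr.
have cV' : scont (fun z => f w * (z - w)^-1).
  by apply: scontM => // ? _; exact: ccont_cst.
have cF : scont (fun z => f (clampc rho z)).
  move=> z _; apply: ccont_comp; first exact: ccont_clampc.
  by have [d' /cdiff_ccont] := hf _ (clampc_in z r0).
rewrite -(Lam_shift w2) -rintZ// -[RHS]add0r -Q0 -rintD//.
apply: (eq_rint rhoN rhoN); first exact: scontM.
  by move=> z zb; apply: ccontD; [exact: cQ'|exact: cV'].
move=> z zb zr; have zm := onlines_md r0 zb.
rewrite clampc_id// qE; first by ring.
by apply: contraTneq zm => ->; rewrite -ltNge.
Qed.

End Square.

Definition chol a r f := forall z, md (z - a) < r -> exists d, cdiff f z d.

Lemma cdiff_shift f a z d :
  cdiff f (a + z) d <-> cdiff (fun z => f (a + z)) z d.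
Proof.
split=> h; first by have := cdiff_comp (cdiffD (cdiff_cst a z) (cdiff_id z)) h;
  rewrite add0r mulr1.
have := @cdiff_comp _ (fun w => w - a) (fun z => f (a + z)) (a + z) 1 d.
rewrite [a + z]addrC addrK mulr1 => K.
have : cdiff (fun w => f (a + (w - a))) (z + a) d.
  by apply: K => //; have := cdiffB (cdiff_id (z + a)) (cdiff_cst a _); rewrite subr0.
by congr cdiff; apply/funext => w; rewrite subrKC.
Qed.

(** The square of half-side [r / 3] around [a] lies in the disc, whence the ratio [3 / r];
    [md (z - a) <= r / 6] is the condition of [sint_rest]. The constants 2 and 4 are 8 and 16
    divided by the lower bound 4 of [md L]. *)
Lemma taylor f a r M : 0 < r -> chol a r f ->
  (forall z, md (z - a) < r -> md (f z) <= M) ->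
  exists c : nat -> R[i], (forall n, md (c n) <= 2 * M * (3 / r) ^+ n) /\
  forall N z, md (z - a) <= r / 6 ->
    md (f z - \sum_(n < N) c n * (z - a) ^+ n) <= 4 * M * (3 / r * md (z - a)) ^+ N.
Proof.
move=> r0 hf hM; pose rho := r / 3; have rho0 : 0 < rho by rewrite /rho; lra.
have M0 : 0 <= M by rewrite (le_trans (md_ge0 (f a)))// hM// subrr md0.
pose g z := f (a + z).
have inr z : inrect (- rho) rho (- rho) rho z -> md (a + z - a) < r.
  by move=> /inrect_md; rewrite addrAC subrr add0r /rho; lra.
have hg z : inrect (- rho) rho (- rho) rho z -> exists d, cdiff g z d.
  by move=> /inr/hf[d dd]; exists d; apply/cdiff_shift.
have gM z : inrect (- rho) rho (- rho) rho z -> md (g z) <= M by move=> /inr/hM.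
pose G z := g (clampc rho z).
pose L := rint (fun z => z^-1) (- rho) rho (- rho) rho.
have L4 : 4 <= md L by exact: Lam_ge.
have L0 : L != 0 by rewrite -md_gt0; lra.
have cG z : ccont G z.
  apply: ccont_comp; first exact/ccont_clampc/ltW.
  by have [d' /cdiff_ccont] := hg _ (clampc_in z (ltW rho0)).
have cG' : econt G (- rho) rho (- rho) rho by move=> ? _.
have GM z : md (G z) <= M by apply/gM/clampc_in/ltW.
exists (fun n => L^-1 * rint (fun z => G z * z^-1 ^+ n.+1) (- rho) rho (- rho) rho).
split=> [n|N z zr].
  rewrite mdM mdV ler_pdivrMl; last by rewrite (lt_le_trans _ L4).
  have := @square_bound rho rho0 (fun z => G z * z^-1 ^+ n.+1) (M * rho^-1 ^+ n.+1).
  move=> /(_ _ _)/le_trans -> //.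
  - exact/(scontM cG')/scontVX.
  - move=> z zb _; rewrite mdM ler_pM ?md_ge0// mdX mdV.
    have zm := onlines_md (ltW rho0) zb.
    by rewrite lerXn2r ?nnegrE ?invr_ge0 ?md_ge0 ?(ltW rho0)// lef_pV2// posrE (lt_le_trans rho0).
  - have -> : 8 * rho * (M * rho^-1 ^+ n.+1) = 4 * (2 * M * (3 / r) ^+ n).
      rewrite (_ : 3 / r = rho^-1); last by rewrite /rho invf_div.
      by rewrite exprS; field; rewrite gt_eqF.
    by rewrite ler_wpM2r// !mulr_ge0// exprn_ge0// divr_ge0// ltW.
pose w := z - a; have w2 : md w <= rho / 2 by rewrite /w /rho; lra.
have wr : md w < rho by lra.
have -> : f z = L^-1 * rint (fun z => G z * (z - w)^-1) (- rho) rho (- rho) rho.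
  rewrite (cauchy_square rho0 w2 hg) -/L /g /w subrKC.
  by field.
rewrite (sint_expand rho0 N cG' wr) mulrDr mulr_sumr.
rewrite addrAC -sumrB big1 ?add0r => [|i _]; last by rewrite -/w; ring.
rewrite mdM mdV ler_pdivrMl; last by rewrite (lt_le_trans _ L4).
have := sint_rest rho0 N cG' w2 M0 (fun z _ _ => GM z).
move=> /le_trans -> //.
have -> : md w / rho = 3 / r * md (z - a) by rewrite /rho /w; field; rewrite gt_eqF.
have -> : 16 * M * (3 / r * md (z - a)) ^+ N =
   4 * (4 * M * (3 / r * md (z - a)) ^+ N) by ring.
rewrite ler_wpM2r// !mulr_ge0// exprn_ge0// !mulr_ge0 ?md_ge0// invr_ge0 ltW//.
Qed.

End Taylor.

(** * Local behaviour of holomorphic maps *)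

Section Topology.
Context {R : realType}.
Implicit Types (A : set R[i]) (f : R[i] -> R[i]) (u : R[i] -> R) (z w a : R[i]).

Lemma nbhs_md z A : nbhs z A <->
  exists2 e : R, 0 < e & forall w, md (w - z) < e -> A w.
Proof.
split=> [/nbhs_ballP[e /= e0 h]|[e e0 h]].
  have eE : e = (complex.Re e)%:C by rewrite RRe_real// gtr0_real.
  exists (complex.Re e) => [|w wz]; first by rewrite -ltcR -eE.
  by apply: h; rewrite -ball_normE /= normE mdC eE ltcR.
apply/nbhs_ballP; exists e%:C => /=; first by rewrite ltcR.
by move=> w; rewrite -ball_normE /= normE mdC ltcR => /h.
Qed.

Lemma open_md A : open A <->
  forall z, A z -> exists2 e : R, 0 < e & forall w, md (w - z) < e -> A w.
Proof.
split=> [oA z Az|h]; first by apply/nbhs_md; exact: open_nbhs_nbhs.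
by rewrite openE => z /h; rewrite /interior => ?; apply/nbhs_md.
Qed.

Lemma closure_md A z : closure A z <->
  forall e : R, 0 < e -> exists2 w, A w & md (w - z) < e.
Proof.
split=> [h e e0|h B /nbhs_md[e e0 hB]].
  have [|w [Aw wz]] := h [set w | md (w - z) < e]; last by exists w.
  by apply/nbhs_md; exists e.
by have [w Aw /hB Bw] := h _ e0; exists w.
Qed.

Lemma open_ball_md a (r : R) : open [set z | md (z - a) < r].
Proof.
apply/open_md => z /= za; exists (r - md (z - a)) => [|w wz]; first by lra.
by have := md_tri z w a; rewrite /=; lra.
Qed.

Lemma ccontP f z : ccont f z <-> {for z, continuous f}.
Proof.
split=> [cf A /nbhs_md[e e0 h]|cf e e0].
  have [d d0 k] := cf _ e0; apply/nbhs_md; exists d => // w /k; exact: h.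
have /cf/nbhs_md[d d0 h] : nbhs (f z) [set w | md (w - f z) < e].
  by apply/nbhs_md; exists e.
by exists d.
Qed.

Lemma real_continuousP u z : (forall e : R, 0 < e ->
    exists2 d : R, 0 < d & forall w, md (w - z) < d -> `|u w - u z| < e) ->
  {for z, continuous u}.
Proof.
move=> h A /nbhs_ballP[e /= e0 k]; have [d d0 hd] := h _ e0.
apply/nbhs_md; exists d => // w /hd wz; apply: k.
by rewrite /ball /= distrC.
Qed.

Lemma md_continuous f z : ccont f z -> {for z, continuous (fun w => md (f w))}.
Proof.
move=> cf; apply: real_continuousP => e /cf[d d0 h]; exists d => // w /h.
apply: le_lt_trans; have := md_triB (f w) (f z); have := md_triB (f z) (f w).
by rewrite [md (f z - _)]mdC ler_norml => ? ?; apply/andP; split; lra.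
Qed.

Lemma complex_pair_continuous a (p : R * R) :
  {for p, continuous (fun p : R * R => a + (p.1 +i* p.2))}.
Proof.
move=> A /nbhs_md[e e0 h]; apply/nbhs_ballP; exists (e / 2); first by rewrite /= divr_gt0.
move=> q [] /=; rewrite /ball /= => h1 h2; apply: h.
apply: (le_lt_trans (md_le_ReIm _)).
rewrite opprD addrACA subrr add0r ReB ImB /= [X in X + _]distrC [X in _ + X]distrC.
lra.
Qed.

Lemma closed_ball_compact a (r : R) : compact [set z | md (z - a) <= r].
Proof.
have cpt : compact ((fun p : R * R => a + (p.1 +i* p.2)) @` (`[- r, r] `*` `[- r, r])).
  apply: continuous_compact; last by apply: compact_setX; exact: segment_compact.
  by apply: continuous_subspaceT => p; exact: complex_pair_continuous.
apply: subclosed_compact cpt _.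
  rewrite closure_id; apply/seteqP; split; first exact: subset_closure.
  move=> z /closure_md h; apply/ler_addgt0Pr => e e0 /=.
  have [w /= wr wz] := h _ e0.
  by have := md_tri w z a; rewrite [md (z - w)]mdC; lra.
move=> z /= zr; exists (complex.Re (z - a), complex.Im (z - a)); last first.
  by rewrite /=; case: (z - a) (subrK a z) => x y /= <-; rewrite addrC.
by split; rewrite /= in_itv /= -ler_norml (le_trans _ zr) ?Re_le_md ?Im_le_md.
Qed.

Lemma closed_ball_max u a (r : R) : 0 <= r ->
  (forall z, md (z - a) <= r -> {for z, continuous u}) ->
  exists2 z, md (z - a) <= r & forall w, md (w - a) <= r -> u w <= u z.
Proof.
move=> r0 cu; have [||z] := @compact_EVT_max _ _ u _ _ (@closed_ball_compact a r).
- by exists a; rewrite /= subrr md0.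
- by apply: continuous_in_subspaceT => z; rewrite inE => /cu.
rewrite inE => zr h; exists z => // w wr; apply: h.
by rewrite inE.
Qed.

End Topology.

(** * Derivatives of holomorphic maps and Cauchy's estimates *)

Section Derivative.
Context {R : realType}.
Implicit Types (f g : R[i] -> R[i]) (z w a : R[i]) (r s t M : R).

Lemma le_of_eq (x y : R) : x = y -> x <= y.
Proof. by move->. Qed.

Definition cder f z : R[i] := xget 0 [set d | cdiff f z d].

Lemma cderP f z : (exists d, cdiff f z d) -> cdiff f z (cder f z).
Proof.
by case=> d hd; rewrite /cder; case: xgetP => [_ -> //|/(_ d)].
Qed.

Lemma cderE f z d : cdiff f z d -> cder f z = d.
Proof. by move=> h; apply: (cdiff_unique _ h); apply: cderP; exists d. Qed.

Lemma chol_sub f a b r s : md (b - a) + s <= r -> chol a r f -> chol b s f.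
Proof.
by move=> bs hf z zb; apply: hf; have := md_tri b z a; lra.
Qed.

Lemma chol_bounded f a r s : 0 <= s -> s < r -> chol a r f ->
  exists2 M, 0 <= M & forall z, md (z - a) <= s -> md (f z) <= M.
Proof.
move=> s0 sr hf; have [|z zs h] := @closed_ball_max R (fun z => md (f z)) a s s0.
  move=> z zs; apply: md_continuous; have [|d /cdiff_ccont//] := hf z.
  lra.
by exists (md (f z)) => //; exact: md_ge0.
Qed.

Lemma quadratic_cdiff f z d t A : 0 < t ->
  (forall w, md (w - z) < t ->
    md (f w - f z - d * (w - z)) <= A * md (w - z) ^+ 2) -> cdiff f z d.
Proof.
move=> t0 h; apply/cdiffP => e e0.
exists (Num.min t (e / (`|A| + 1))) => [|w]; first by rewrite lt_min t0 divr_gt0.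
rewrite lt_min => /andP[/h wt]; rewrite ltr_pdivlMr// => we.
apply: (le_trans wt); rewrite expr2 mulrA ler_wpM2r ?md_ge0//.
apply: (le_trans _ (ltW we)); rewrite mulrC ler_wpM2l ?md_ge0//.
by rewrite (le_trans (ler_norm _))// lerDl.
Qed.

Lemma taylor_cder f a r M : 0 < r -> chol a r f ->
  (forall z, md (z - a) < r -> md (f z) <= M) ->
  exists c : nat -> R[i], [/\ c 0%N = f a, c 1%N = cder f a,
    forall n, md (c n) <= 2 * M * (3 / r) ^+ n &
    forall N z, md (z - a) <= r / 6 ->
      md (f z - \sum_(n < N) c n * (z - a) ^+ n) <=
        4 * M * (3 / r * md (z - a)) ^+ N].
Proof.
move=> r0 hf hM; have [c [c1 c2]] := taylor r0 hf hM.
have E0 : c 0%N = f a.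
  have := c2 1%N a; rewrite subrr md0 mulr0 expr0n mulr0 => K.
  apply/eqP; rewrite eq_sym -subr_eq0 -md_eq0 eq_le md_ge0 andbT.
  have := K (ltW (divr_gt0 r0 _)); rewrite big_ord_recl big_ord0 expr0 mulr1 addr0.
  by apply.
exists c; split => //; apply/esym/cderE.
apply: (@quadratic_cdiff _ _ _ (r / 6) (4 * M * (3 / r) ^+ 2)) => [|z zr].
  by rewrite divr_gt0.
have := c2 2%N z (ltW zr); rewrite !big_ord_recl big_ord0 /= E0.
rewrite expr0 mulr1 addr0 expr1 opprD addrA exprMn.
by rewrite [in leRHS]mulrA.
Qed.

Lemma cauchy_cder f a r M : 0 < r -> chol a r f ->
  (forall z, md (z - a) < r -> md (f z) <= M) -> md (cder f a) <= 6 * M / r.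
Proof.
move=> r0 hf hM; have [c [_ <- /(_ 1%N) h _]] := taylor_cder r0 hf hM.
by apply: (le_trans h); rewrite expr1; lra.
Qed.

Lemma taylor_lip f a r M : 0 < r -> chol a r f ->
  (forall z, md (z - a) < r -> md (f z) <= M) ->
  forall z, md (z - a) <= r / 6 -> md (f z - f a) <= 12 * M / r * md (z - a).
Proof.
move=> r0 hf hM z zr; have [c [E0 _ _ /(_ 1%N z zr)]] := taylor_cder r0 hf hM.
rewrite big_ord_recl big_ord0 expr0 mulr1 addr0 E0 expr1; lra.
Qed.

Lemma taylor_quadratic f a r M : 0 < r -> chol a r f ->
  (forall z, md (z - a) < r -> md (f z) <= M) ->
  forall z, md (z - a) <= r / 6 ->
  md (f z - f a - cder f a * (z - a)) <= 36 * M / r ^+ 2 * md (z - a) ^+ 2.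
Proof.
move=> r0 hf hM z zr; have [c [E0 E1 _ /(_ 2%N z zr)]] := taylor_cder r0 hf hM.
rewrite !big_ord_recl big_ord0 expr0 mulr1 addr0 E0 expr1 E1.
rewrite opprD addrA => /le_trans -> //.
by apply: le_of_eq; field; rewrite gt_eqF.
Qed.

Lemma taylor_cubic f a r M : 0 < r -> chol a r f ->
  (forall z, md (z - a) < r -> md (f z) <= M) ->
  exists c, forall z, md (z - a) <= r / 6 ->
  md (f z - f a - cder f a * (z - a) - c * (z - a) ^+ 2) <=
    108 * M / r ^+ 3 * md (z - a) ^+ 3.
Proof.
move=> r0 hf hM; have [c [E0 E1 _ h]] := taylor_cder r0 hf hM.
exists (c 2%N) => z zr; have := h 3%N z zr.
rewrite !big_ord_recl big_ord0 expr0 mulr1 addr0 E0 expr1 E1 /=.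
rewrite !opprD !addrA => /le_trans -> //.
by apply: le_of_eq; field; rewrite gt_eqF.
Qed.

(* The second-order Taylor expansions at [z + h], taken at [z] and [z + 2h],
   determine the derivative at [z + h] up to an error of order [h ^ 2]. *)
Lemma chol_cder f a r : chol a r f -> chol a r (cder f).
Proof.
move=> hf z za; pose s := (r - md (z - a)) / 2; have s0 : 0 < s by rewrite /s; lra.
have [M M0 hM] : exists2 M, 0 <= M & forall w, md (w - z) <= s -> md (f w) <= M.
  apply: (@chol_bounded _ _ (2 * s)); [lra|lra|].
  by apply: chol_sub hf; rewrite /s; lra.
have hz : chol z s f by apply: chol_sub hf; rewrite /s; lra.
have [c hc] := taylor_cubic s0 hz (fun w wz => hM w (ltW wz)).
have s20 : 0 < s / 2 by lra.
have t0 : 0 < s / 12 by lra.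
(* [A] and [B] control the cubic errors of the expansions at [z] and at [w]. After division by
   [2 * h], the errors [8 * A] and [2 * B] become [4 * A + B]. The radius [s / 12] puts [2 * h] and
   [h] within a sixth of [s] and [s / 2]. *)
pose A := 108 * M / s ^+ 3; pose B := 108 * M / (s / 2) ^+ 3.
exists (2 * c); apply: (@quadratic_cdiff _ _ _ _ (4 * A + B) t0) => w wz.
have hw : chol w (s / 2) f by apply: chol_sub hz; lra.
have hMw x : md (x - w) < s / 2 -> md (f x) <= M.
  by move=> xw; apply: hM; have := md_tri w x z; lra.
have [c' hc'] := taylor_cubic s20 hw hMw.
pose h := w - z; have wE : w = z + h by rewrite /h; ring.
have := hc (z + 2 * h); have := hc' z; have := hc' (z + 2 * h).
have -> : z + 2 * h - w = h by rewrite wE; ring.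
have -> : z - w = - h by rewrite wE; ring.
have -> : z + 2 * h - z = 2 * h by ring.
have h0 := md_ge0 h.
rewrite -/A -/B mdN sqrrN [md (2 * h)]mdM md_nat exprMn.
rewrite -/h in wz *.
move=> /(_ _)/[!mulrN] k1 /(_ _) k2 /(_ _) k3.
have {}k1 := k1 ltac:(lra). have {}k2 := k2 ltac:(lra). have {}k3 := k3 ltac:(lra).
have [hE|hn0] := eqVneq h 0.
  have -> : w = z by rewrite wE hE addr0.
  by rewrite hE !subrr mulr0 subr0 md0 expr0n mulr0.
have {}h0 : 0 < md h by rewrite md_gt0.
pose x := f (z + 2 * h) - f w - cder f w * h - c' * h ^+ 2.
pose y := f z - f w - - (cder f w * h) - c' * h ^+ 2.
pose v := f (z + 2 * h) - f z - cder f z * (2 * h) - c * (2 ^+ 2 * h ^+ 2).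
have E : 2 * h * (cder f w - cder f z - 2 * c * h) = v - (x - y).
  by rewrite /x /y /v; ring.
have := mdB v (x - y); have := mdB x y; rewrite -E !mdM md_nat -/h.
move=> m1 m2; rewrite -(ler_pM2l h0).
rewrite -/x in k1; rewrite -/y in k2; rewrite -/v in k3.
have -> : md h * ((4 * A + B) * md h ^+ 2) = 4 * A * md h ^+ 3 + B * md h ^+ 3.
  by rewrite !exprS; ring.
rewrite exprMn in k3; lra.
Qed.

End Derivative.

(** * Local inversion and Bloch's theorem *)

Section InverseFunction.
Context {R : realType}.
Implicit Types (f g : R[i] -> R[i]) (z w a b d : R[i]) (r s t M : R).

Lemma cdiff_rdiff f z v d (t : R) : cdiff f (z + t%:C * v) d ->
  rdiff (fun t => f (z + t%:C * v)) t (d * v).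
Proof.
move=> /cdiffP h e e0; have v0 : 0 < md v + 1 by have := md_ge0 v; lra.
have [del del0 k] := h _ (divr_gt0 e0 v0).
exists (del / (md v + 1)) => [|s]; first by rewrite divr_gt0.
rewrite ltr_pdivlMr// => st.
have E : z + s%:C * v - (z + t%:C * v) = (s - t)%:C * v.
  by rewrite (rmorphB (real_complex R)) /=; ring.
have n0 := normr_ge0 (s - t); have v1 := md_ge0 v.
have := k (z + s%:C * v); rewrite E mdM md_real => /(_ _) K.
have {}K := K ltac:(nra); rewrite mulrA in K.
rewrite -[d * v * _]mulrA [v * _]mulrC mulrA.
apply: (le_trans K); rewrite mulrCA [leRHS]mulrC ler_wpM2l// -mulrA ler_piMr ?(ltW e0)//.
by rewrite mulrC ler_pdivrMr// mul1r lerDl.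
Qed.

Lemma md_segment z w a r (t : R) : 0 <= t <= 1 -> md (z - a) < r -> md (w - a) < r ->
  md (z + t%:C * (w - z) - a) < r.
Proof.
move=> /andP[t0 t1] zr wr.
have -> : z + t%:C * (w - z) - a = (1 - t)%:C * (z - a) + t%:C * (w - a).
  by rewrite (rmorphB (real_complex R)) /=; ring.
apply: (le_lt_trans (mdD _ _)); rewrite !mdM !md_real !ger0_norm ?subr_ge0//.
have := md_ge0 (z - a); have := md_ge0 (w - a); move: zr wr.
move: (md (z - a)) (md (w - a)) => x y ? ? ? ?.
have [t1'|t1'] := leP t (1 / 2); nra.
Qed.

Lemma lipschitz_cder f a r M z w : chol a r f ->
  (forall x, md (x - a) < r -> md (cder f x) <= M) ->
  md (z - a) < r -> md (w - a) < r -> md (f w - f z) <= M * md (w - z).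
Proof.
move=> hf hM zr wr.
have := @rdiff_mean_bound R (fun t => f (z + t%:C * (w - z)))
  (fun t => cder f (z + t%:C * (w - z)) * (w - z)) 0 1 (M * md (w - z)) ler01.
rewrite mul1r mul0r addr0 subrKC subr0 mulr1; apply.
move=> t t01; have tr := md_segment t01 zr wr; split.
  by apply: cdiff_rdiff; exact/cderP/hf.
by rewrite mdM ler_wpM2r ?md_ge0// hM.
Qed.

Lemma cder_zero_cst f a r z w : chol a r f ->
  (forall x, md (x - a) < r -> cdiff f x 0) ->
  md (z - a) < r -> md (w - a) < r -> f z = f w.
Proof.
move=> hf h zr wr; apply/eqP; rewrite eq_sym -subr_eq0 -md_eq0 eq_le md_ge0 andbT.
rewrite -[leRHS](mul0r (md (w - z))); apply: (lipschitz_cder hf) zr wr => x xr.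
by rewrite (cderE (h x xr)) md0.
Qed.

(** A damped Newton step: it multiplies [f z - b] by [1 - s], up to an error of half the gain. So a
    minimum of [md (f z - b)] at which the derivative does not vanish is a zero. *)
Lemma descent f z d b t : cdiff f z d -> d != 0 -> f z != b -> 0 < t ->
  exists2 w, md (w - z) < t & md (f w - b) < md (f z - b).
Proof.
move=> /cdiffP hf d0 fb t0.
have m0 : 0 < md (f z - b) by rewrite md_gt0 subr_eq0.
have d1 : 0 < md d by rewrite md_gt0.
have e0 : 0 < md d / 2 by lra.
have [del del0 h] := hf _ e0.
pose v := - (f z - b) / d.
have vE : md v = md (f z - b) / md d by rewrite mdM mdN mdV.
have v0 : 0 < md v by rewrite vE divr_gt0.
pose s := Num.min (1 / 2) (Num.min del t / (2 * md v)).
have mt : 0 < Num.min del t by rewrite lt_min del0.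
have s0 : 0 < s by rewrite lt_min !divr_gt0// mulr_gt0.
have s1 : s <= 1 / 2 by rewrite ge_min lexx.
have s2 : s * (2 * md v) <= Num.min del t.
  by rewrite -ler_pdivlMr ?mulr_gt0// ge_min lexx orbT.
pose w := z + s%:C * v.
have wz : md (w - z) = s * md v.
  by rewrite /w addrAC subrr add0r mdM md_real gtr0_norm.
move: s2; rewrite le_min => /andP[s2 s3].
exists w; first by rewrite wz; nra.
have := h w; rewrite wz => /(_ _) K; have {}K := K ltac:(nra).
have E : f w - b = (f w - f z - d * (w - z)) + (1 - s)%:C * (f z - b).
  rewrite (rmorphB (real_complex R)) /= /w /v.
  by field.
rewrite E (le_lt_trans (mdD _ _))// [md (_ * (f z - b))]mdM md_real ger0_norm; last lra.
apply: (le_lt_trans (lerD K (lexx _))).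
rewrite vE; have -> : md d / 2 * (s * (md (f z - b) / md d)) = s / 2 * md (f z - b).
  by field; rewrite gt_eqF.
nra.
Qed.

(** Subtracting the linear part [cder f a * z] leaves a map with Lipschitz constant at most half of
    [md (cder f a)]. *)
Lemma local_expansion f a r : chol a r f ->
  (forall z, md (z - a) < r -> md (cder f z - cder f a) <= md (cder f a) / 2) ->
  forall z w, md (z - a) < r -> md (w - a) < r ->
  md (cder f a) / 2 * md (z - w) <= md (f z - f w).
Proof.
move=> hf h z w zr wr; pose g z := f z - cder f a * z.
have dg x : md (x - a) < r -> cdiff g x (cder f x - cder f a).
  move=> xr; apply: cdiffB; first exact/cderP/hf.
  by have := cdiffZ (cder f a) (cdiff_id x); rewrite mulr1.
have K : md (g z - g w) <= md (cder f a) / 2 * md (z - w).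
  apply: (@lipschitz_cder _ a r) => // [x xr|x xr].
    by exists (cder f x - cder f a); exact: dg.
  by rewrite (cderE (dg x xr)) h.
have := mdB (f z - f w) (g z - g w).
have -> : f z - f w - (g z - g w) = cder f a * (z - w) by rewrite /g; ring.
by rewrite mdM; lra.
Qed.

(** Minimize [md (f z - b)] over the closed disc of radius [s]: by [local_expansion] the minimum is
    not attained on the circle, and [descent] makes it 0. *)
Lemma local_surjection f a r s : 0 < s -> s < r -> chol a r f ->
  cder f a != 0 ->
  (forall z, md (z - a) < r -> md (cder f z - cder f a) <= md (cder f a) / 2) ->
  forall b, md (b - f a) < md (cder f a) * s / 4 ->
  exists2 z, md (z - a) < s & f z = b.
Proof.
move=> s0 sr hf d0 h b bs; have m0 : 0 < md (cder f a) by rewrite md_gt0.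
have [|z zs hz] := @closed_ball_max R (fun z => - md (f z - b)) a s (ltW s0).
  move=> z zs.
  have cN : {for z, continuous (fun w => md (f w - b))}.
    apply: md_continuous; have [|d dd] := hf z; first lra.
    by apply: ccontB; [exact: cdiff_ccont dd|exact: ccont_cst].
  exact: (@continuousN _ _ _ (fun w => md (f w - b)) z cN).
have za : md (f z - b) <= md (f a - b).
  by rewrite -lerN2; apply: hz; rewrite subrr md0 ltW.
have aa : md (a - a) < r by rewrite subrr md0; lra.
have zr : md (z - a) < r by lra.
have := local_expansion hf h zr aa.
have := md_tri b (f z) (f a); rewrite [md (f a - b)]mdC in za => k1 k2.
have zs' : md (z - a) < s. by nra.
exists z => //; apply/eqP; apply: contraT => fb.
have dz : cder f z != 0.
  have := h z zr; have := md_triB (cder f a) (cder f z).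
  by rewrite mdC -md_gt0; lra.
have t0 : 0 < s - md (z - a) by lra.
have [w wz wb] := descent (cderP (hf z zr)) dz fb t0.
have ws : md (w - a) <= s by have := md_tri z w a; lra.
have := hz w ws; lra.
Qed.

(* At a maximum [z] of [|f'| (s - |z - a|)] the derivative at most doubles on
   a disc of radius comparable with [s - |z - a|]. *)
Lemma bloch f a r s : 0 < s -> s < r -> chol a r f -> exists b, forall y,
  md (y - b) < s * md (cder f a) / 400 -> exists2 z, md (z - a) < r & f z = y.
Proof.
move=> s0 sr hf; have hd := chol_cder hf.
have [f0|f0] := eqVneq (cder f a) 0.
  exists 0 => y; rewrite f0 md0 mulr0 mul0r; have := md_ge0 (y - 0); lra.
have m0 : 0 < md (cder f a) by rewrite md_gt0.
have [|z zs hz] :=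
    @closed_ball_max R (fun z => md (cder f z * (s - md (z - a))%:C)) a s (ltW s0).
  move=> z zs; apply: md_continuous; apply: ccontM.
    by have [|d dd] := hd z; [lra|exact: cdiff_ccont dd].
  move=> e e0; exists e => // w wz; rewrite -(rmorphB (real_complex R)) md_real.
  apply: le_lt_trans wz; rewrite ler_norml.
  have := md_tri w z a; have := md_tri z w a; rewrite [md (z - w)]mdC.
  by move=> ? ?; apply/andP; split; lra.
have E x : md (x - a) <= s ->
    md (cder f x * (s - md (x - a))%:C) = md (cder f x) * (s - md (x - a)).
  by move=> xs; rewrite mdM md_real ger0_norm// subr_ge0.
have zE := E z zs.
have as0 : md (a - a) <= s by rewrite subrr md0 ltW.
have := hz a as0; rewrite zE (E a as0) subrr md0 subr0 => k1.
(* With [q] half of the remaining distance, [s - md (w - a)] is at least [q] on the disc of radius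
   [q] around [z], so maximality bounds the derivative there by [2 * m]. *)
pose m := md (cder f z); pose q := (s - md (z - a)) / 2.
have q0 : 0 < q by have := md_ge0 (cder f z); rewrite /q; nra.
have mm0 : 0 < m by have := md_ge0 (cder f z); rewrite /m; nra.
have mq : s * md (cder f a) <= 2 * (m * q) by rewrite /m /q; lra.
have dq w : md (w - z) < q -> md (cder f w) <= 2 * m.
  move=> wz; have wa : md (w - a) <= s by have := md_tri z w a; rewrite /q in wz; lra.
  have := hz w wa; rewrite zE E// -/m => k2.
  have := md_tri z w a => k3; have := md_ge0 (cder f w); rewrite /q in wz q0.
  nra.
have hq : chol z q (cder f) by apply: chol_sub hd; rewrite /q; lra.
have lip := taylor_lip q0 hq dq.
have hf' : chol z (q / 48) f by apply: chol_sub hf; rewrite /q; lra.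
have cf0 : cder f z != 0 by rewrite -md_gt0.
(* At distance at most [q / 48] from [z] the bound [24 * m / q * md (w - z)] on the variation of the
   derivative is at most [m / 2]. The covered radius [m * (q / 49) / 4] exceeds [m * q / 200], which
   is at least [s * md (cder f a) / 400]. *)
have q1 : 0 < q / 49 by lra.
have q2 : q / 49 < q / 48 by lra.
have half w : md (w - z) < q / 48 -> md (cder f w - cder f z) <= md (cder f z) / 2.
  move=> wz; apply: (le_trans (lip w _)); first lra.
  rewrite -/m; have -> : 12 * (2 * m) / q * md (w - z) = 24 * m * (md (w - z) / q).
    by field; rewrite gt_eqF.
  have : md (w - z) / q <= 1 / 48 by rewrite ler_pdivrMr//; lra.
  nra.
have surj := local_surjection q1 q2 hf' cf0 half.
exists (f z) => y yb; have [|x xz <-] := surj y; last first.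
  by exists x => //; have := md_tri z x a; rewrite /q in xz; lra.
by apply: (lt_le_trans yb); rewrite -/m; nra.
Qed.

End InverseFunction.

(** * Logarithms and the Koebe distortion theorem *)

Section Logarithm.
Context {R : realType}.
Implicit Types (f g u F L : R[i] -> R[i]) (z w a b p : R[i]) (r s t M x y : R).

Lemma cint_swap (g : R -> R[i]) (a b : R) : cint g b a = - cint g a b.
Proof. by rewrite /cint /=; set G := xget _ _; ring. Qed.

Lemma cint_bound_abs (g : R -> R[i]) (a b : R) M : (forall t, rcont g t) ->
  (forall t, `|t - a| <= `|b - a| -> md (g t) <= M) ->
  md (cint g a b) <= M * `|b - a|.
Proof.
move=> cg h; have [ab|/ltW ba] := leP a b.
  rewrite ger0_norm ?subr_ge0//; apply: cint_bound => // t /andP[ta tb].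
  by apply: h; rewrite !ger0_norm ?subr_ge0// lerD2r.
rewrite cint_swap mdN distrC ger0_norm ?subr_ge0//; apply: cint_bound => // t /andP[tb ta].
by apply: h; rewrite ![`|_ - a|]distrC !ger0_norm ?subr_ge0// lerD2l lerN2.
Qed.

Lemma goursat_any f F rho x x' y y' :
  (forall z, ccont F z) ->
  (forall z, inrect (- rho) rho (- rho) rho z -> F z = f z /\ exists d, cdiff f z d) ->
  - rho <= x <= rho -> - rho <= x' <= rho -> - rho <= y <= rho ->
  - rho <= y' <= rho -> rint F x x' y y' = 0.
Proof.
move=> cF hf; wlog xx : x x' / x <= x'.
  move=> W h1 h2 h3 h4; have [|/ltW] := leP x x'; first by move=> k; exact: W.
  move=> k; apply: oppr_inj; rewrite oppr0 -(W _ _ k h2 h1 h3 h4) /rint.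
  by rewrite ![cint _ x' x]cint_swap; ring.
wlog yy : y y' / y <= y'.
  move=> W h1 h2 h3 h4; have [|/ltW] := leP y y'; first by move=> k; exact: W.
  move=> k; apply: oppr_inj; rewrite oppr0 -(W _ _ k h1 h2 h4 h3) /rint.
  by rewrite ![cint _ y' y]cint_swap; ring.
move=> h1 h2 h3 h4; apply: (goursat xx yy cF) => z [z1 z2].
by apply: hf; split; lra.
Qed.

(** Integrate from the centre along a horizontal and then a vertical segment. By Goursat's lemma the
    increment from [z] to [w] is again an integral along two short segments, on which the integrand
    is close to its value at [z]. *)
Lemma primitive g a r : 0 < r -> chol a r g ->
  exists G, forall z, md (z - a) < r / 3 -> cdiff G z (g z).
Proof.
move=> r0 hg; pose rho := r / 3; have rho0 : 0 < rho by rewrite /rho; lra.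
pose f z := g (a + z); pose F z := f (clampc rho z).
have hf z : inrect (- rho) rho (- rho) rho z -> exists d, cdiff f z d.
  move=> /inrect_md zr; have [|d dd] := hg (a + z); last first.
    by exists d; apply/cdiff_shift.
  by rewrite addrAC subrr add0r; rewrite /rho in zr; lra.
have hF z : inrect (- rho) rho (- rho) rho z -> F z = f z /\ exists d, cdiff f z d.
  by move=> zr; rewrite /F clampc_id//; split => //; exact: hf.
have cF z : ccont F z.
  apply: ccont_comp; first exact/ccont_clampc/ltW.
  by have [d' /cdiff_ccont] := hf _ (clampc_in z (ltW rho0)).
pose P z := cint (fun x => F (x +i* 0)) 0 (complex.Re z) +
  'i * cint (fun y => F (complex.Re z +i* y)) 0 (complex.Im z).
have rE z : `|complex.Re z| < rho -> `|complex.Im z| < rho ->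
    - rho <= complex.Re z <= rho /\ - rho <= complex.Im z <= rho.
  by rewrite -!ler_norml => ? ?; rewrite !ltW.
have dP z : md z < rho -> cdiff P z (F z).
  move=> zr; apply/cdiffP => e e0; have e2 : 0 < e / 2 by lra.
  have [t t0 ht] := cF z _ e2.
  exists (Num.min (t / 2) (rho - md z)) => [|w]; first by rewrite lt_min; lra.
  rewrite lt_min => /andP[w1 w2].
  have wr : md w < rho by have := md_triB w z; lra.
  have [zx zy] := rE z (le_lt_trans (Re_le_md z) zr) (le_lt_trans (Im_le_md z) zr).
  have [wx wy] := rE w (le_lt_trans (Re_le_md w) wr) (le_lt_trans (Im_le_md w) wr).
  have rho1 : - rho <= 0 <= rho by lra.
  have := goursat_any cF hF zx wx rho1 zy; rewrite /rint.
  move: wx wy zx zy w1 w2 wr zr ht; rewrite /P.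
  case: w => x' y'; case: z => x y /= ? ? ? ? w1 w2 wr zr ht G0.
  have cH c s : rcont (fun x => F (x +i* c)) s by exact: rcont_h.
  have cV c s : rcont (fun y => F (c +i* y)) s by exact: rcont_v.
  have cc c s : rcont (fun=> c : R[i]) s.
    by move=> ? ?; exists 1 => // ? _; rewrite subrr md0.
  pose c := -1 * F (x +i* y).
  have wzE : x' +i* y' - (x +i* y) = (x' - x)%:C + 'i * (y' - y)%:C.
    by rewrite [LHS]complexRI.
  have -> : cint (fun x => F (x +i* 0)) 0 x' +
      'i * cint (fun y => F (x' +i* y)) 0 y' -
      (cint (fun x => F (x +i* 0)) 0 x + 'i * cint (fun y0 => F (x +i* y0)) 0 y) -
      F (x +i* y) * (x' +i* y' - (x +i* y)) =
      cint (fun s => F (s +i* y) + c) x x' + 'i * cint (fun s => F (x' +i* s) + c) y y'.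
    rewrite !cintD// !cint_cst wzE.
    rewrite (@cint_split _ _ x 0 x') (@cint_split _ (fun s => F (x' +i* s)) y 0 y').
    apply/eqP; rewrite -subr_eq0 -G0 /c; apply/eqP; ring.
  have hx : `|x' - x| <= md (x' +i* y' - (x +i* y)).
    by have := Re_le_md (x' +i* y' - (x +i* y)); rewrite ReB.
  have hy : `|y' - y| <= md (x' +i* y' - (x +i* y)).
    by have := Im_le_md (x' +i* y' - (x +i* y)); rewrite ImB.
  apply: (le_trans (mdD _ _)); rewrite mdM md_i mul1r.
  have K1 : md (cint (fun s => F (s +i* y) + c) x x') <= e / 2 * `|x' - x|.
    apply: cint_bound_abs => [s|s sx]; first exact: rcontD.
    rewrite /c mulN1r ltW// ht// md_h; lra.
  have K2 : md (cint (fun s => F (x' +i* s) + c) y y') <= e / 2 * `|y' - y|.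
    apply: cint_bound_abs => [s|s sx]; first exact: rcontD.
    rewrite /c mulN1r ltW// ht//; apply: (le_lt_trans (md_tri (x' +i* y) _ _)).
    by rewrite md_v md_h; lra.
  nra.
exists (fun z => P (z - a)) => z zr.
have := @cdiff_comp _ (fun z => z - a) P z 1 (F (z - a)).
rewrite mulr1 /F clampc_id /f ?subrKC; last first.
  have := Re_le_md (z - a); have := Im_le_md (z - a) => h1 h2.
  by rewrite /inrect -!ler_norml /rho; split; lra.
move=> K; apply: K; first by have := cdiffB (cdiff_id z) (cdiff_cst a z); rewrite subr0.
have := dP (z - a) zr; rewrite /F clampc_id /f ?subrKC//.
have := Re_le_md (z - a); have := Im_le_md (z - a) => h1 h2.
by rewrite /inrect -!ler_norml /rho; split; lra.
Qed.

Definition cexp z : R[i] :=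
  (expR (complex.Re z))%:C * (cos (complex.Im z) +i* sin (complex.Im z)).

Lemma cexpD z w : cexp (z + w) = cexp z * cexp w.
Proof.
rewrite /cexp ReD ImD expRD cosD sinD (rmorphM (real_complex R)) /=.
set c1 := cos _; set c2 := cos _; set s1 := sin _; set s2 := sin _.
have -> : (c1 * c2 - s1 * s2) +i* (s1 * c2 + c1 * s2) = (c1 +i* s1) * (c2 +i* s2).
  by simpc; congr (_ +i* _); ring.
by ring.
Qed.

Lemma cexp0 : cexp 0 = 1.
Proof. by rewrite /cexp /= expR0 cos0 sin0 mul1r. Qed.

Lemma cexpNK z : cexp z * cexp (- z) = 1.
Proof. by rewrite -cexpD subrr cexp0. Qed.

Lemma cexp_period : cexp ('i * (pi + pi)%:C) = 1.
Proof.
rewrite /cexp /=; rewrite !(mul0r, mulr0, mul1r, subr0, add0r).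
by rewrite cosD sinD cospi sinpi !mulr0 subr0 mul0r addr0 mulrNN mulr1 oppr0 expR0 mul1r.
Qed.

Lemma md_cis (t : R) : md (cos t +i* sin t) = 1.
Proof. by rewrite /md /= cos2Dsin2 sqrtr1. Qed.

Lemma md_cexp_le z : md (cexp z) <= expR (md z).
Proof.
rewrite mdM md_cis mulr1 md_real ger0_norm ?expR_ge0// ler_expR.
by rewrite (le_trans (ler_norm _))// Re_le_md.
Qed.

Lemma cexp_cdiff0 : cdiff cexp 0 1.
Proof.
apply/cdiffP => e e0.
have [e' [e'0 e'1 e'2]] : exists e' : R, [/\ 0 < e', e' <= 1 & e' <= e / 8].
  exists (Num.min 1 (e / 8)); rewrite lt_min ltr01 ge_min lexx ge_min lexx orbT.
  by split => //; lra.
have /is_deriveP/(_ _ e'0)[t1 t10 h1] := is_derive_expR (0 : R).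
have /is_deriveP/(_ _ e'0)[t2 t20 h2] := is_derive_cos (0 : R).
have /is_deriveP/(_ _ e'0)[t3 t30 h3] := is_derive_sin (0 : R).
pose t := Num.min (Num.min t1 e') (Num.min t2 t3).
exists t => [|w]; first by rewrite !lt_min t10 e'0 t20.
rewrite subr0 !lt_min => /andP[/andP[w1 w2] /andP[w3 w4]].
rewrite cexp0 mul1r; have mx := Re_le_md w; have my := Im_le_md w.
set x := complex.Re w in mx *; set y := complex.Im w in my *.
have {h1} := h1 x; rewrite subr0 expR0 mul1r => /(_ (le_lt_trans mx w1)) h1.
have {h2} := h2 y; rewrite subr0 cos0 sin0 oppr0 mul0r subr0 => /(_ (le_lt_trans my w3)) h2.
have {h3} := h3 y; rewrite subr0 cos0 sin0 mul1r subr0 => /(_ (le_lt_trans my w4)) h3.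
pose c := cos y +i* sin y.
have cE : md (c - 1 - 'i * y%:C) <= e' * `|y| + e' * `|y|.
  apply: (le_trans (md_le_ReIm _)); apply: lerD; [apply: le_trans h2|apply: le_trans h3].
    by apply: le_of_eq; congr (`|_|); rewrite /c /=; ring.
  by apply: le_of_eq; congr (`|_|); rewrite /c /=; ring.
have -> : cexp w - 1 - w =
   (expR x - 1 - x)%:C * c + (1 + x)%:C * (c - 1 - 'i * y%:C) + 'i * (x * y)%:C.
  rewrite [in LHS]/cexp -/x -/y -/c {1}(complexRI w) -/x -/y.
  rewrite (rmorphM (real_complex R)) (rmorphD (real_complex R)).
  by rewrite !(rmorphB (real_complex R)) /= (rmorph1 (real_complex R)); ring.
apply: (le_trans (mdD _ _)); apply: (le_trans (lerD (mdD _ _) (lexx _))).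
rewrite !mdM md_i mul1r md_cis mulr1 !md_real.
have x1 : `|1 + x| <= 2.
  by apply: (le_trans (ler_normD _ _)); rewrite normr1; lra.
rewrite normrM; have X0 := normr_ge0 x; have Y0 := normr_ge0 y.
have A0 := md_ge0 (c - 1 - 'i * y%:C).
have em : e' * md w <= e / 8 * md w by rewrite ler_wpM2r// md_ge0.
have h4 : e' * `|x| <= e' * md w by rewrite ler_wpM2l// ltW.
have h5 : e' * `|y| <= e' * md w by rewrite ler_wpM2l// ltW.
have h6 : `|x| * `|y| <= e' * md w by rewrite ler_pM// (le_trans mx)// ltW.
have h7 : `|1 + x| * md (c - 1 - 'i * y%:C) <= 2 * md (c - 1 - 'i * y%:C).
  by rewrite ler_wpM2r.
lra.
Qed.

Lemma cexp_cdiff z : cdiff cexp z (cexp z).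
Proof.
apply/cdiffP => e e0; have z1 : 0 < md (cexp z) + 1 by have := md_ge0 (cexp z); lra.
have /cdiffP/(_ _ (divr_gt0 e0 z1))[t t0 h] := cexp_cdiff0.
exists t => // w wz; have := h (w - z); rewrite subr0 cexp0 mul1r => /(_ wz) {}h.
have -> : cexp w = cexp z * cexp (w - z) by rewrite -cexpD subrKC.
have -> : cexp z * cexp (w - z) - cexp z - cexp z * (w - z) =
  cexp z * (cexp (w - z) - 1 - (w - z)) by ring.
rewrite mdM; apply: (le_trans (ler_wpM2l (md_ge0 _) h)).
rewrite mulrA ler_wpM2r ?md_ge0// mulrCA ler_piMr ?(ltW e0)//.
by rewrite ler_pdivrMr// mul1r lerDl.
Qed.

(** [L] is a primitive of [u' / u], so [u * cexp (- L)] has derivative 0. Comparing two points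
    spares a normalization of [L]. *)
Lemma logarithm u a r : 0 < r -> chol a r u ->
  (forall z, md (z - a) < r -> u z != 0) ->
  exists2 L, chol a (r / 3) L &
    forall z w, md (z - a) < r / 3 -> md (w - a) < r / 3 -> u z = u w * cexp (L z - L w).
Proof.
move=> r0 hu u0; have hd := chol_cder hu.
have hq : chol a r (fun z => cder u z * (u z)^-1).
  move=> z za; have [d dd] := hd z za; eexists; apply: cdiffM; first exact: dd.
  by apply: cdiffV (u0 z za); exact/cderP/hu.
have [L hL] := primitive r0 hq; exists L; first by move=> z za; eexists; exact: hL.
have r3 : r / 3 < r by lra.
pose v z := u z * cexp (- L z).
have dv z : md (z - a) < r / 3 -> cdiff v z 0.
  move=> za; have zr := lt_trans za r3.
  have := cdiffM (cderP (hu z zr)) (cdiff_comp (cdiffN (hL z za)) (cexp_cdiff (- L z))).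
  by congr cdiff; field; exact: u0.
move=> z w za wa.
have hv : chol a (r / 3) v by move=> x xa; exists 0; exact: dv.
have := cder_zero_cst hv dv za wa; rewrite /v => E.
rewrite addrC cexpD mulrA -E -mulrA [cexp (- _) * _]mulrC.
by rewrite cexpNK mulr1.
Qed.

(* On the disc of radius [r / 3], a logarithm [L] of [f - p] has an image
   disjoint from its translate by the period of the exponential; Bloch's
   theorem then bounds [L']. *)
Lemma koebe : exists2 C : R, 1 <= C & forall f a r p, 0 < r -> chol a r f ->
  (forall z w, md (z - a) < r -> md (w - a) < r -> f z = f w -> z = w) ->
  (forall z, md (z - a) < r -> f z != p) ->
  forall y y' : R[i], md (y - a) < r / 6 -> md (y' - a) < r / 6 ->
    md (f y - p) <= C * md (f y' - p).
Proof.
pose tau : R[i] := 'i * (pi + pi)%:C.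
have t0 : 0 < md tau.
  have pp : (0 : R) < pi + pi by apply: addr_gt0; exact: pi_gt0.
  by rewrite mdM md_i mul1r md_real gtr0_norm.
(* Bloch's theorem on a disc of radius [r / 7 < r / 6] covers a disc of radius
   [r / 7 * md (cder L z) / 400], which yields [md (cder L z) <= B * md tau / r]; two points at
   distance at most [r / 3] then give the exponent [B / 3 * md tau]. *)
have [B [B0 BE]] : exists B : R, 0 < B /\ B = 7 * 400 by exists (7 * 400); split; lra.
exists (expR (B / 3 * md tau)).
  by rewrite -expR0 ler_expR; apply: mulr_ge0; [exact: (divr_ge0 (ltW B0))|exact: ltW].
move=> f a r p r0 hf fi fp y y' yr y'r.
have hu : chol a r (fun z => f z - p).
  move=> z /hf[d dd]; exists (d - 0); apply: cdiffB => //; exact: cdiff_cst.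
have u0 z : md (z - a) < r -> f z - p != 0 by rewrite subr_eq0; exact: fp.
have [L hL LE] := logarithm r0 hu u0.
have dL z : md (z - a) < r / 6 -> md (cder L z) <= B * md tau / r.
  move=> zr; have hz : chol z (r / 6) L by apply: chol_sub hL; lra.
  have s0 : 0 < r / 7 by lra.
  have sr : r / 7 < r / 6 by lra.
  have [b hb] := bloch s0 sr hz.
  rewrite leNgt; apply/negP; rewrite ltr_pdivrMr// => K.
  have {}K : md tau < r / 7 * md (cder L z) / 400 by rewrite BE in K; lra.
  have [|z1 z1z E1] := hb b; first by rewrite subrr md0; lra.
  have [|z2 z2z E2] := hb (b + tau).
    by rewrite addrAC subrr add0r.
  have k1 : md (z1 - a) < r / 3 by have := md_tri z z1 a; lra.
  have k2 : md (z2 - a) < r / 3 by have := md_tri z z2 a; lra.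
  have := LE z2 z1 k2 k1; rewrite E1 E2 addrAC subrr add0r cexp_period mulr1.
  move=> /(addIr (- p)) /fi K'; move: E2; rewrite K' ?E1; [|lra|lra].
  by move=> /eqP; rewrite -subr_eq0 opprD addrA subrr sub0r oppr_eq0 -md_eq0 gt_eqF.
have hL6 : chol a (r / 6) L by move=> z zr; apply: hL; lra.
have := lipschitz_cder hL6 dL y'r yr => K.
rewrite (LE y y'); [|lra|lra].
rewrite mdM mulrC ler_wpM2r ?md_ge0// (le_trans (md_cexp_le _))// ler_expR.
apply: (le_trans K); have yy : md (y - y') <= r / 3.
  by have := md_tri a y y'; rewrite [md (a - y')]mdC; lra.
have -> : B / 3 * md tau = B * md tau / r * (r / 3) by field; rewrite gt_eqF.
by rewrite ler_wpM2l// divr_ge0// ?mulr_ge0// ltW.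
Qed.

End Logarithm.

(** * Univalent maps *)

Section HolomorphicMaps.
Context {R : realType}.
Implicit Types (f g k : R[i] -> R[i]) (z w a b : R[i]) (r s t M : R).

Lemma le_geometric (x y c q : R) : 0 <= q < 1 ->
  (forall n, x <= y + c * q ^+ n) -> x <= y.
Proof.
move=> q01 h; apply/ler_addgt0Pr => e e0.
have [n /(_ n (leqnn n)) cn] := geometric_small c q01 e0.
by rewrite (le_trans (h n))// lerD2l ltW.
Qed.

(** The first nonzero Taylor coefficient gives the second alternative; if there is none, [f] equals
    its remainders, which decay geometrically on the disc of radius [r / 12]. *)
Lemma zero_order f a r : 0 < r -> chol a r f ->
  (forall z, md (z - a) < r / 12 -> f z = 0) \/
  exists p c A t, [/\ c != 0, 0 < t & forall z, md (z - a) < t ->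
    md (f z - c * (z - a) ^+ p) <= A * md (z - a) ^+ p.+1].
Proof.
move=> r0 hf; have r20 : 0 < r / 2 by lra.
have [M M0 hM] := @chol_bounded _ f a r (r / 2) (ltW r20) ltac:(lra) hf.
have hf2 : chol a (r / 2) f by apply: chol_sub hf; rewrite subrr md0; lra.
have [c [_ h]] := taylor r20 hf2 (fun z zr => hM z (ltW zr)).
have [c0|] := pselect (forall n, c n = 0).
  left => z zr; apply/eqP; rewrite -md_eq0 eq_le md_ge0 andbT.
  have z0 := md_ge0 (z - a).
  apply: (@le_geometric _ _ (4 * M) (3 / (r / 2) * md (z - a))) => [|n].
    have -> : 3 / (r / 2) * md (z - a) = 6 * md (z - a) / r.
      by field; rewrite gt_eqF.
    by rewrite divr_ge0 ?(ltW r0) ?mulr_ge0//= ltr_pdivrMr//; lra.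
  rewrite add0r; have := h n z; rewrite big1 ?subr0 => [|i _]; last by rewrite c0 mul0r.
  by apply; lra.
move=> /existsNP/cid[n0 /eqP n0c]; right.
have ex : exists n, c n != 0 by exists n0.
have p0 := ex_minnP ex; case: p0 => p cp pmin.
exists p, (c p), (4 * M * (3 / (r / 2)) ^+ p.+1), (r / 2 / 6); split => // [|z zr].
  by rewrite !divr_gt0.
have := h p.+1 z (ltW zr); rewrite big_ord_recr /= big1 ?add0r => [|i _].
  by rewrite exprMn [in leRHS]mulrA.
have /eqP-> : c i == 0 by apply: contraTT (ltn_ord i) => /pmin; rewrite -leqNgt.
by rewrite mul0r.
Qed.

Lemma isolated_zero f a p c A t : c != 0 -> 0 < t ->
  (forall z, md (z - a) < t ->
    md (f z - c * (z - a) ^+ p) <= A * md (z - a) ^+ p.+1) ->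
  exists2 s : R, 0 < s & forall z, md (z - a) < s -> z != a -> f z != 0.
Proof.
move=> c0 t0 h; have m0 : 0 < md c by rewrite md_gt0.
exists (Num.min t (md c / (`|A| + 1))) => [|z]; first by rewrite lt_min t0 divr_gt0.
rewrite lt_min => /andP[/h zt zA] za; apply/negP => /eqP fz.
move: zt; rewrite fz sub0r mdN mdM mdX exprS mulrA.
have z0 : 0 < md (z - a) by rewrite md_gt0 subr_eq0.
rewrite ler_pM2r ?exprn_gt0// => K.
move: zA; rewrite ltr_pdivlMr//; have := ler_norm A; nra.
Qed.

(** The map [h w = (w - b) * k w] is differentiable at [b] too, with derivative [k b]; dividing its
    cubic Taylor estimate by [w - b] expands [k] to first order with a quadratic error. *)
Lemma removable k b s : 0 < s -> ccont k b ->
  (forall w, md (w - b) < s -> w != b -> exists d, cdiff k w d) ->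
  exists d, cdiff k b d.
Proof.
move=> s0 ck hk; pose h w := (w - b) * k w.
have hh : chol b s h.
  move=> w ws; have [->|wb] := eqVneq w b.
    by exists (k b); exists k; split => // x; rewrite /h; ring.
  have [d dd] := hk w ws wb; eexists; apply: cdiffM; last exact: dd.
  by apply: cdiffB; [exact: cdiff_id|exact: cdiff_cst].
have dh : cder h b = k b.
  by apply: cderE; exists k; split => // x; rewrite /h; ring.
have s20 : 0 < s / 2 by lra.
have [M M0 hM] := @chol_bounded _ h b s (s / 2) (ltW s20) ltac:(lra) hh.
have hh2 : chol b (s / 2) h by apply: chol_sub hh; rewrite subrr md0; lra.
have [c hc] := taylor_cubic s20 hh2 (fun z zr => hM z (ltW zr)).
exists c; have t0 : 0 < s / 2 / 6 by lra.
apply: (@quadratic_cdiff _ _ _ _ _ (108 * M / (s / 2) ^+ 3) t0) => w wt.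
have [->|wb] := eqVneq w b.
  by rewrite !subrr mulr0 subr0 md0 expr0n mulr0.
have m0 : 0 < md (w - b) by rewrite md_gt0 subr_eq0.
have := hc w (ltW wt); rewrite dh /h subrr mul0r subr0.
have -> : (w - b) * k w - k b * (w - b) - c * (w - b) ^+ 2 =
  (w - b) * (k w - k b - c * (w - b)) by ring.
by rewrite mdM [md (w - b) ^+ 3]exprS mulrCA ler_pM2l.
Qed.

Lemma inverse_cdiff f k b z d s : 0 < s -> cdiff f z d -> d != 0 -> k b = z ->
  ccont k b -> (forall w, md (w - b) < s -> f (k w) = w) -> cdiff k b d^-1.
Proof.
move=> s0 [q [fE cq qz]] d0 kb ck fk.
have cqk : ccont (fun w => q (k w)) b by apply: ccont_comp; rewrite ?kb.
have m0 : 0 < md d by rewrite md_gt0.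
have [t t0 ht] := cqk _ m0.
have st0 : 0 < Num.min s t by rewrite lt_min s0.
apply: (@eq_cdiff _ (fun w => z + (w - b) * (q (k w))^-1) _ _ _ _ st0).
  move=> w; rewrite lt_min => /andP[ws /ht wt].
  have q0 : q (k w) != 0.
    by apply: contraTneq wt => ->; rewrite kb qz sub0r mdN ltxx.
  have fb : f z = b by rewrite -kb fk// subrr md0.
  by have := fE (k w); rewrite fk// fb => {1}->; field.
exists (fun w => (q (k w))^-1); split => [w||].
- by rewrite subrr mul0r addr0.
- by apply: ccontV => //; rewrite kb qz.
- by rewrite kb qz.
Qed.

Definition cinj a r f :=
  forall z w, md (z - a) < r -> md (w - a) < r -> f z = f w -> z = w.

(** If [f] omitted a value [b] very close to [f z], the Koebe theorem would bound [md (f x - b)] by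
    [C * md (f z - b)] at a point [x] with [f x != f z]. The argument says nothing of the
    derivative, whose nonvanishing is deduced afterwards. *)
Lemma cinj_open f a r : chol a r f -> cinj a r f ->
  forall z t, md (z - a) < r -> 0 < t -> exists2 c : R, 0 < c &
    forall b, md (b - f z) < c ->
      exists w, [/\ md (w - z) < t, md (w - a) < r & f w = b].
Proof.
move=> hf fi z t zr t0; have [C C1 hC] := @koebe R.
pose s := Num.min t (r - md (z - a)).
have s0 : 0 < s by rewrite lt_min t0 subr_gt0.
have st : s <= t by rewrite ge_min lexx.
have sr : s <= r - md (z - a) by rewrite ge_min lexx orbT.
pose x := z + (s / 12)%:C.
have xz : md (x - z) = s / 12.
  by rewrite /x addrAC subrr add0r md_real gtr0_norm// divr_gt0.
have inr w : md (w - z) < s -> md (w - a) < r by have := md_tri z w a; lra.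
have xr : md (x - a) < r by apply: inr; lra.
have m0 : 0 < md (f x - f z).
  rewrite md_gt0 subr_eq0; apply/negP => /eqP/(fi _ _ xr zr) xzE.
  by move: xz; rewrite xzE subrr md0; lra.
exists (md (f x - f z) / (C + 2)) => [|b bc]; first by rewrite divr_gt0//; lra.
apply: contrapT => nw.
have om w : md (w - z) < s -> f w != b.
  move=> ws; apply/negP => /eqP fw; apply: nw; exists w; split => //; last exact: inr.
  exact: lt_le_trans ws st.
have hz : chol z s f by apply: chol_sub hf; lra.
have fz : cinj z s f by move=> v w vs ws; apply: fi; exact: inr.
have := hC f z s b s0 hz fz om x z.
rewrite xz subrr md0 => /(_ ltac:(lra) ltac:(lra)).
have := md_tri b (f x) (f z); rewrite [md (f z - b)]mdC.
move: bc; rewrite ltr_pdivlMr; last lra.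
nra.
Qed.

(** A zero of [cder f] is isolated, as otherwise [f] would be locally constant. The inverse,
    continuous by [cinj_open] and differentiable around the image of this zero, is then
    differentiable there too by [removable], and the chain rule gives 0 = 1. *)
Lemma cinj_inverse f a r : 0 < r -> chol a r f -> cinj a r f -> exists k,
  (forall z, md (z - a) < r -> k (f z) = z) /\
  forall z, md (z - a) < r -> cder f z != 0 /\ cdiff k (f z) (cder f z)^-1.
Proof.
move=> r0 hf fi; pose k b := xget a [set w | md (w - a) < r /\ f w = b].
have kf z : md (z - a) < r -> k (f z) = z.
  move=> zr; rewrite /k; case: xgetP => [w -> [wr /fi]|/(_ z)[]//].
  exact.
exists k; split => //.
have ck z : md (z - a) < r -> ccont k (f z).
  move=> zr e e0; have [c c0 hc] := cinj_open hf fi zr e0.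
  by exists c => // b /hc[w [wz wr <-]]; rewrite !kf.
have fk z : md (z - a) < r -> exists2 c : R, 0 < c & forall b, md (b - f z) < c ->
    f (k b) = b /\ md (k b - a) < r.
  move=> zr; have [c c0 hc] := cinj_open hf fi zr ltr01.
  by exists c => // b /hc[w [_ wr <-]]; rewrite kf.
have dk z : md (z - a) < r -> cder f z != 0 -> cdiff k (f z) (cder f z)^-1.
  move=> zr d0; have [c c0 hc] := fk z zr.
  apply: (inverse_cdiff c0 (cderP (hf z zr)) d0 (kf z zr) (ck z zr)) => b /hc[].
  by [].
suff d0 z : md (z - a) < r -> cder f z != 0 by move=> z zr; split; [exact: d0|exact/dk/d0].
move=> zr; pose s := r - md (z - a); have s0 : 0 < s by rewrite subr_gt0.
have inr w : md (w - z) < s -> md (w - a) < r by have := md_tri z w a; rewrite /s; lra.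
have hd : chol z s (cder f) by apply: chol_sub (chol_cder hf); rewrite /s; lra.
have [dz|[p [c [A [t [c0 t0 h]]]]]] := zero_order s0 hd.
  pose x := z + (s / 24)%:C.
  have xz : md (x - z) = s / 24.
    by rewrite /x addrAC subrr add0r md_real gtr0_norm// divr_gt0.
  have hz : chol z (s / 12) f by apply: chol_sub hf; rewrite /s; lra.
  have E : f z = f x.
    apply: (cder_zero_cst hz); rewrite ?subrr ?md0 ?xz; [|lra|lra].
    move=> w ws; rewrite -(dz w ws); apply: cderP; exact: hz.
  have : z = x by apply: fi => //; apply: inr; rewrite xz; lra.
  by move=> zx; move: xz; rewrite -zx subrr md0; lra.
have [t' t'0 nz] := isolated_zero c0 t0 h.
have t''0 : 0 < Num.min t' s by rewrite lt_min t'0.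
have [c' c'0 hc'] := cinj_open hf fi zr t''0.
have [d kd] : exists d, cdiff k (f z) d.
  apply: (removable c'0 (ck z zr)) => b /hc'[w [wz wr <-]] fwz.
  exists (cder f w)^-1; apply: dk => //; apply: nz.
    by move: wz; rewrite lt_min => /andP[].
  by apply: contraNneq fwz => ->.
have K := cdiff_comp (cderP (hf z zr)) kd.
have /(cdiff_unique K) E : cdiff (fun w => k (f w)) z 1.
  by apply: (@eq_cdiff _ id _ _ _ _ s0) (cdiff_id z) => w /inr/kf ->.
by apply/eqP => d0; move: E; rewrite d0 mulr0 => /esym/eqP; rewrite oner_eq0.
Qed.

Lemma geometric_limit (u : nat -> R[i]) (K q : R) : 0 <= K -> 0 <= q < 1 ->
  (forall n, md (u n.+1 - u n) <= K * q ^+ n) ->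
  exists l, forall n, md (u n - l) <= 2 * K / (1 - q) * q ^+ n.
Proof.
move=> K0 /andP[q0 q1] h; pose c n : R := K / (1 - q) * q ^+ n.
have c0 n : 0 <= c n by rewrite mulr_ge0 ?exprn_ge0// divr_ge0// subr_ge0 ltW.
have cS n : c n.+1 = c n - K * q ^+ n.
  by rewrite /c exprS; field; rewrite subr_eq0 gt_eqF.
have real (v : nat -> R) : (forall n, `|v n.+1 - v n| <= K * q ^+ n) ->
    exists l, forall n, `|v n - l| <= c n.
  move=> hv; have [||l hl] := @nested_point _ (fun n => v n - c n) (fun n => 2 * c n).
  - move=> n; have := hv n; rewrite cS ler_norml => /andP[? ?]; split; lra.
  - by move=> n; rewrite mulr_ge0.
  exists l => n; have /andP[? ?] := hl n; rewrite ler_norml.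
  by apply/andP; split; lra.
have [|x hx] := real (fun n => complex.Re (u n)).
  by move=> n; rewrite -ReB (le_trans (Re_le_md _)).
have [|y hy] := real (fun n => complex.Im (u n)).
  by move=> n; rewrite -ImB (le_trans (Im_le_md _)).
exists (x +i* y) => n; apply: (le_trans (md_le_ReIm _)); rewrite ReB ImB.
have := hx n; have := hy n; rewrite /c /= => ? ?.
have -> : 2 * K / (1 - q) * q ^+ n = K / (1 - q) * q ^+ n + K / (1 - q) * q ^+ n.
  by ring.
exact: lerD.
Qed.

(** Cauchy's estimate makes the derivatives converge geometrically; the quadratic Taylor bounds of
    the [fn n] hold with a constant [A] independent of [n] and pass to the limit. *)
Lemma uniform_limit (fn : nat -> R[i] -> R[i]) f a r K q : 0 <= K -> 0 <= q < 1 ->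
  (forall n, chol a r (fn n)) ->
  (forall n z, md (z - a) < r -> md (fn n z - f z) <= K * q ^+ n) ->
  chol a r f.
Proof.
move=> K0 q01 hfn hf z zr; have /andP[q0 q1] := q01.
pose s := r - md (z - a); have s0 : 0 < s by rewrite subr_gt0.
have inr w : md (w - z) < s -> md (w - a) < r by have := md_tri z w a; rewrite /s; lra.
have hz n : chol z s (fn n) by apply: chol_sub (hfn n); rewrite /s; lra.
have q2 n : K * q ^+ n <= K.
  by rewrite ler_piMr// exprn_ile1// ltW.
have d0 n : md (cder (fn n.+1) z - cder (fn n) z) <= 12 * K / s * q ^+ n.
  have hd : chol z s (fun w => fn n.+1 w - fn n w).
    move=> w ws; eexists; apply: cdiffB; apply: cderP; exact: hz.
  have := @cauchy_cder _ _ z s (2 * K * q ^+ n) s0 hd.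
  rewrite (cderE (cdiffB (cderP (hz n.+1 z _)) (cderP (hz n z _)))) ?subrr ?md0//.
  move=> /(_ _)/le_trans; apply; last by apply: le_of_eq; field; rewrite gt_eqF.
  move=> w /inr wr; have := hf n w wr; have := hf n.+1 w wr.
  have := md_tri (f w) (fn n.+1 w) (fn n w); rewrite [md (f w - _)]mdC.
  have : K * q ^+ n.+1 <= K * q ^+ n.
    by rewrite ler_wpM2l// exprS ler_piMl ?exprn_ge0// ltW.
  lra.
have K12 : 0 <= 12 * K / s by rewrite divr_ge0 ?(ltW s0)// mulr_ge0.
have [d hd] := geometric_limit K12 q01 d0.
have s2 : 0 < s / 2 by lra.
have [M M0 hM] := @chol_bounded _ (fn 0%N) z s (s / 2) (ltW s2) ltac:(lra) (hz 0%N).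
pose A := 36 * (M + 2 * K) / (s / 2) ^+ 2.
exists d; have s12 : 0 < s / 12 by lra.
apply: (@quadratic_cdiff _ _ _ _ _ A s12) => w ws.
have wr : md (w - a) < r by apply: inr; lra.
have zw := md_ge0 (w - z).
pose D := 2 * (12 * K / s) / (1 - q).
apply: (@le_geometric _ _ (2 * K + D * md (w - z)) q q01) => n.
have hz2 : chol z (s / 2) (fn n) by apply: chol_sub (hz n); rewrite subrr md0; lra.
have B x : md (x - z) < s / 2 -> md (fn n x) <= M + 2 * K.
  move=> xs; have := hM x (ltW xs); have xr : md (x - a) < r by apply: inr; lra.
  have := hf n x xr; have := hf 0%N x xr; have := q2 n; rewrite expr0 mulr1.
  have := md_tri (f x) (fn n x) (fn 0%N x); rewrite [md (f x - _)]mdC.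
  have := md_triB (fn n x) (fn 0%N x); lra.
have := taylor_quadratic s2 hz2 B (z := w) => /(_ ltac:(lra)); rewrite -/A => T.
have E : f w - f z - d * (w - z) =
   (fn n w - fn n z - cder (fn n) z * (w - z)) -
   ((fn n w - f w) - (fn n z - f z)) + (cder (fn n) z - d) * (w - z) by ring.
rewrite E; apply: (le_trans (mdD _ _)); rewrite mdM.
have h1 : md (cder (fn n) z - d) * md (w - z) <= D * q ^+ n * md (w - z).
  by rewrite ler_wpM2r// hd.
have := mdB (fn n w - fn n z - cder (fn n) z * (w - z)) ((fn n w - f w) - (fn n z - f z)).
have := mdB (fn n w - f w) (fn n z - f z).
have := hf n w wr; have := hf n z zr; lra.
Qed.

End HolomorphicMaps.

(** * Rescaling symmetries at an attracting fixed point *)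

Section Linearization.
Context {R : realType}.
Implicit Types (f g H phi : R[i] -> R[i]) (z w a b lam : R[i]) (r s t M : R).

Lemma iter_lin H b l s : (forall z, md (z - b) < s -> md (H z - b) <= l * md (z - b)) ->
  0 <= l <= 1 -> forall n z, md (z - b) < s -> md (iter n H z - b) <= l ^+ n * md (z - b).
Proof.
move=> h /andP[l0 l1]; elim=> [|n IH] z zs; first by rewrite expr0 mul1r.
have k := IH z zs; have ns : md (iter n H z - b) < s.
  apply: (le_lt_trans k); apply: (le_lt_trans _ zs).
  by rewrite ler_piMl ?md_ge0// exprn_ile1.
rewrite iterS (le_trans (h _ ns))// exprS -mulrA.
by rewrite ler_wpM2l.
Qed.

(** [phi] is the limit of the maps [fn n], the iterates of [H] centred at [b] and divided by
    [lam ^+ n]; the functional equation is the limit of [fn n (H z) = lam * fn n.+1 z]. *)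
Lemma koenigs H b r : 0 < r -> chol b r H -> H b = b ->
  0 < md (cder H b) < 1 ->
  exists s phi, [/\ 0 < s <= r, chol b s phi, phi b = 0, cder phi b = 1 &
    forall z, md (z - b) < s ->
      md (H z - b) < s /\ phi (H z) = cder H b * phi z].
Proof.
move=> r0 hH Hb /andP[l0 l1]; pose lam := cder H b; pose l := md lam.
rewrite -/lam -/l in l0 l1.
have lam0 : lam != 0 by rewrite -md_gt0.
have r20 : 0 < r / 2 by lra.
have [M M0 hM] := @chol_bounded _ H b r (r / 2) (ltW r20) ltac:(lra) hH.
have hH2 : chol b (r / 2) H by apply: chol_sub hH; rewrite subrr md0; lra.
have := taylor_quadratic r20 hH2 (fun z zr => hM z (ltW zr)).
rewrite -/lam Hb; set A := 36 * M / (r / 2) ^+ 2 => hA.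
have A0 : 0 <= A by rewrite divr_ge0 ?sqr_ge0// mulr_ge0.
(* A contraction rate above [l] with [mu ^+ 2 < l], so that the quadratic error at the n-th iterate,
   of order [mu ^+ (2 * n)], survives the division by [l ^+ n]. The harmonic mean of [l] and 1 is
   below their geometric mean. *)
have [mu [ml m1 m2]] : exists mu, [/\ l < mu, mu < 1 & mu ^+ 2 < l].
  have p0 : 0 < 1 + l by lra.
  exists (2 * l / (1 + l)); split.
  - by rewrite ltr_pdivlMr//; nra.
  - by rewrite ltr_pdivrMr//; lra.
  - rewrite exprMn exprVn ltr_pdivrMr ?exprn_gt0//.
    have : 0 < l * (1 - l) ^+ 2 by rewrite mulr_gt0// exprn_gt0// subr_gt0.
    nra.
pose s := Num.min (r / 12) ((mu - l) / (A + 1)).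
have A1 : 0 < A + 1 by lra.
have s0 : 0 < s by rewrite lt_min !divr_gt0// subr_gt0.
have sr : s <= r / 12 by rewrite ge_min lexx.
have sA : s * (A + 1) <= mu - l by rewrite -ler_pdivlMr// ge_min lexx orbT.
have step z : md (z - b) < s -> md (H z - b) <= mu * md (z - b).
  move=> zs; have := hA z ltac:(lra); have z0 := md_ge0 (z - b).
  have := mdD (H z - b - lam * (z - b)) (lam * (z - b)).
  rewrite subrK mdM -/l expr2 => h1 h2.
  have : A * (md (z - b) * md (z - b)) <= A * s * md (z - b).
    by rewrite mulrA ler_wpM2r// ler_wpM2l// ltW.
  nra.
have mu0 : 0 <= mu <= 1 by rewrite (ltW m1) andbT; lra.
have it := iter_lin step mu0.
have its n z : md (z - b) < s -> md (iter n H z - b) < s.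
  move=> zs; apply: (le_lt_trans (it n z zs)); apply: (le_lt_trans _ zs).
  by case/andP: mu0 => ? ?; rewrite ler_piMl ?md_ge0// exprn_ile1.
pose fn n z := lam^-1 ^+ n * (iter n H z - b).
have dit n : chol b s (iter n H).
  elim: n => [|n IH] z zs; first by exists 1; exact: cdiff_id.
  have [d dd] := IH z zs; have [|d' dd'] := hH (iter n H z).
    by have := its n z zs; lra.
  by eexists; exact: (cdiff_comp dd dd').
have dfn n : chol b s (fn n).
  move=> z zs; have [d dd] := dit n z zs; exists (lam^-1 ^+ n * (d - 0)).
  by apply: cdiffZ; apply: cdiffB => //; exact: cdiff_cst.
pose q := mu ^+ 2 / l.
have q01 : 0 <= q < 1.
  by rewrite divr_ge0 ?sqr_ge0 ?(ltW l0)//= ltr_pdivrMr// mul1r.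
pose K := A * s ^+ 2 / l.
have K0 : 0 <= K by rewrite divr_ge0 ?(ltW l0)// mulr_ge0// sqr_ge0.
have dlt n z : md (z - b) < s -> md (fn n.+1 z - fn n z) <= K * q ^+ n.
  move=> zs; have u := its n z zs; have := hA (iter n H z) ltac:(lra).
  have -> : fn n.+1 z - fn n z = lam^-1 ^+ n.+1 *
      (H (iter n H z) - b - lam * (iter n H z - b)).
    by rewrite /fn iterS exprS; field.
  rewrite mdM mdX mdV -/l => h1.
  apply: (le_trans (ler_wpM2l _ h1)); first by rewrite exprn_ge0// invr_ge0 ltW.
  have h2 : md (iter n H z - b) ^+ 2 <= (mu ^+ n * s) ^+ 2.
    rewrite lerXn2r ?nnegrE ?md_ge0//.
      by rewrite mulr_ge0 ?(ltW s0)// exprn_ge0//; case/andP: mu0.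
    apply: (le_trans (it n z zs)); rewrite ler_wpM2l ?(ltW zs)//.
    by rewrite exprn_ge0//; case/andP: mu0.
  have -> : K * q ^+ n = l^-1 ^+ n.+1 * (A * (mu ^+ n * s) ^+ 2).
    by rewrite /K /q !exprMn -!exprM [(n * 2)%N]mulnC [l^-1 ^+ n.+1]exprS mul2n -addnn exprD; ring.
  by rewrite ler_wpM2l ?exprn_ge0 ?invr_ge0 ?(ltW l0)// ler_wpM2l.
have /choice[phi hphi] : forall z, exists y, md (z - b) < s ->
    forall n, md (fn n z - y) <= 2 * K / (1 - q) * q ^+ n.
  move=> z; have [zs|zs] := ltP (md (z - b)) s; last by exists 0.
  by have [y hy] := geometric_limit K0 q01 (fun n => dlt n z zs); exists y.
have K'0 : 0 <= 2 * K / (1 - q).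
  by case/andP: q01 => _ /ltW q1; rewrite divr_ge0// ?subr_ge0// mulr_ge0.
have hchol : chol b s phi.
  by apply: (uniform_limit K'0 q01 dfn) => n z zs; exact: hphi.
have lim0 x y C : (forall n, md (x - y) <= C * q ^+ n) -> x = y.
  move=> h; apply/eqP; rewrite -subr_eq0 -md_eq0 eq_le md_ge0 andbT.
  by apply: (@le_geometric _ _ _ C q q01) => n; rewrite add0r.
have bs : md (b - b) < s by rewrite subrr md0.
have itb n : iter n H b = b by elim: n => // n; rewrite iterS => ->.
exists s, phi; split => //.
- by rewrite s0; lra.
- apply/esym; apply: (lim0 _ _ (2 * K / (1 - q))) => n; have := hphi b bs n.
  by rewrite /fn itb subrr mulr0.
- apply/esym; apply: (lim0 _ _ (6 * (2 * K / (1 - q)) / s)) => n.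
  have dn : cdiff (fn n) b 1.
    have it1 : cdiff (iter n H) b (lam ^+ n).
      elim: n => [|n IH]; first exact: cdiff_id.
      rewrite exprS; apply: (cdiff_comp IH); rewrite itb.
      by apply/cderP/hH; rewrite subrr md0.
    have := cdiffZ (lam^-1 ^+ n) (cdiffB it1 (cdiff_cst b b)).
    by rewrite subr0 -exprMn mulVf// expr1n.
  have dphi := cderP (hchol b bs).
  have h : chol b s (fun z => fn n z - phi z).
    move=> z zs; eexists; apply: cdiffB; first exact: cderP (dfn n z zs).
    exact: cderP (hchol z zs).
  rewrite -(cderE (cdiffB dn dphi)).
  have := cauchy_cder s0 h (fun z zs => hphi z zs n).
  by move=> /le_trans; apply; apply: le_of_eq; ring.
- move=> z zs; have Hs : md (H z - b) < s by exact: (its 1%N).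
  split => //; rewrite -/lam.
  apply: (lim0 _ _ (2 * K / (1 - q) * (1 + l))) => n.
  have h1 := hphi _ Hs n; have h2 := hphi _ zs n.+1.
  have E : fn n (H z) = lam * fn n.+1 z by rewrite /fn -iterSr exprS; field.
  have -> : phi (H z) - lam * phi z = lam * (fn n.+1 z - phi z) - (fn n (H z) - phi (H z)).
    by rewrite E; ring.
  apply: (le_trans (mdB _ _)); rewrite mdM -/l.
  have h3 : 2 * K / (1 - q) * q ^+ n.+1 <= 2 * K / (1 - q) * q ^+ n.
    case/andP: q01 => q0 q1.
    by rewrite ler_wpM2l// exprS ler_piMl ?exprn_ge0// ltW.
  have h4 : l * md (fn n.+1 z - phi z) <= l * (2 * K / (1 - q) * q ^+ n).
    by rewrite ler_wpM2l ?(ltW l0)// (le_trans h2).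
  lra.
Qed.

Lemma local_injective f a r : 0 < r -> chol a r f -> cder f a != 0 ->
  exists2 s, 0 < s <= r & cinj a s f.
Proof.
move=> r0 hf d0; have m0 : 0 < md (cder f a) by rewrite md_gt0.
have aa : md (a - a) < r by rewrite subrr md0.
have [d dd] := chol_cder hf aa.
have m20 : 0 < md (cder f a) / 2 by lra.
have [t t0 ht] := cdiff_ccont dd m20.
exists (Num.min t r); first by rewrite lt_min t0 r0 ge_min lexx orbT.
move=> z w; rewrite !lt_min => /andP[zt zr] /andP[wt wr] E.
have h : chol a (Num.min t r) f by apply: chol_sub hf; rewrite subrr md0 add0r ge_min lexx orbT.
have := @local_expansion _ f a (Num.min t r) h.
move=> /(_ _ z w)/=; rewrite !lt_min zt zr wt wr E subrr md0 => /(_ _ isT isT) K.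
have {}K : md (cder f a) / 2 * md (z - w) <= 0.
  by apply: K => x; rewrite lt_min => /andP[/ht/ltW].
by apply/eqP; rewrite -subr_eq0 -md_eq0 eq_le md_ge0 andbT; have := md_ge0 (z - w); nra.
Qed.

(** * Conjugation by powers of the multiplier *)

Section Scaling.
Variables (K : set R[i]) (lam : R[i]) (rho rho1 : R).
Hypotheses (lam0 : 0 < md lam) (lam1 : md lam < 1) (rho0 : 0 < rho) (rho10 : 0 < rho1).
Hypothesis Klam : forall w, md w < rho -> (K w <-> K (lam * w)).

Definition near_id_symmetry (e : R) g :=
  [/\ chol 0 rho1 g, forall w, md w < rho1 -> md (g w - w) <= e,
      ~ (exists2 t : R, 0 < t & forall w, md w < t -> g w = w) &
      forall w, md w < rho1 -> md (g w) < rho -> (K w <-> K (g w))].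

Hypothesis near : forall e : R, 0 < e -> exists g, near_id_symmetry e g.

Let rho2 := Num.min 1 (Num.min (rho1 / 6) (rho / 2)).

(* A step, of length [delta], along the flow of the vector field [c w ^ p]. *)
Definition flow_step (r : R) p c (eta : R) := exists delta g,
  [/\ 0 < delta < eta, chol 0 r g,
      forall w, md w < r -> md (g w - w - delta%:C * c * w ^+ p) <= eta * delta &
      forall w, md w < r -> (K w <-> K (g w))].

Lemma Klam_iter m w : md w < rho -> (K w <-> K (lam ^+ m * w)).
Proof.
move=> wr; elim: m => [|m IH]; first by rewrite expr0 mul1r.
rewrite IH exprS -mulrA; apply: Klam.
rewrite mdM mdX; apply: le_lt_trans wr; rewrite ler_piMl ?md_ge0//.
by rewrite exprn_ile1 ?md_ge0// ltW.
Qed.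

Lemma rho2_le : [/\ rho2 <= 1, rho2 <= rho1 / 6 & rho2 <= rho / 2].
Proof. by rewrite !ge_min !lexx ?orbT; split. Qed.

(** The conjugate of [g] by multiplication by [lam ^+ m] preserves [K] on the disc of radius [rho2]:
    the bounds on [eta] keep its values in the disc of radius [rho], where [Klam] applies. *)
Lemma rescale_symmetry g e m p c (delta eta : R) : near_id_symmetry e g ->
  0 < delta -> delta < eta -> md c = 1 -> eta <= 1 -> eta <= rho / 4 ->
  (forall w, md w < rho2 ->
    md (lam^-1 ^+ m * (g (lam ^+ m * w) - lam ^+ m * w) - delta%:C * c * w ^+ p)
      <= eta * delta) ->
  flow_step rho2 p c eta.
Proof.
move=> [hg _ _ gK] d0 de c1 e1 e4 h; have [r1 r2 r3] := rho2_le.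
have l0 : lam != 0 by rewrite -md_gt0.
have lm0 : lam ^+ m != 0 by rewrite expf_neq0.
have lm w : md (lam ^+ m * w) <= md w.
  by rewrite mdM mdX ler_piMl ?md_ge0// exprn_ile1 ?md_ge0// ltW.
pose G w := lam^-1 ^+ m * g (lam ^+ m * w).
have GE w : G w - w = lam^-1 ^+ m * (g (lam ^+ m * w) - lam ^+ m * w).
  by rewrite /G exprVn; field.
exists delta, G; split; first by rewrite d0.
- move=> w; rewrite subr0 => wr; have [|d dd] := hg (lam ^+ m * w).
    by rewrite subr0; have := lm w; have := rho10; lra.
  eexists; apply: cdiffZ; apply: cdiff_comp dd.
  by have := cdiffZ (lam ^+ m) (cdiff_id w); exact.
- by move=> w /h; rewrite GE.
- move=> w wr; have := h w wr; rewrite -GE => hw.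
  have Gr : md (G w) < rho.
    have := mdD (G w - w - delta%:C * c * w ^+ p) (delta%:C * c * w ^+ p + w).
    have -> : G w - w - delta%:C * c * w ^+ p + (delta%:C * c * w ^+ p + w) = G w by ring.
    have := mdD (delta%:C * c * w ^+ p) w.
    rewrite !mdM md_real c1 mulr1 mdX (gtr0_norm d0).
    have : md w ^+ p <= 1 by rewrite exprn_ile1 ?md_ge0//; lra.
    nra.
  have wr1 : md w < rho by have := rho0; lra.
  rewrite (Klam_iter m wr1) (Klam_iter m Gr).
  have -> : lam ^+ m * G w = g (lam ^+ m * w).
    by rewrite /G mulrA -exprMn mulfV// expr1n mul1r.
  apply: gK; first by have := lm w; have := rho10; lra.
  have -> : g (lam ^+ m * w) = lam ^+ m * G w.
    by rewrite /G mulrA -exprMn mulfV// expr1n mul1r.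
  exact: le_lt_trans (lm _) Gr.
Qed.

Lemma unit_part (c : R[i]) : c != 0 -> exists2 u, md u = 1 & c = (md c)%:C * u.
Proof.
move=> c0; have m0 : 0 < md c by rewrite md_gt0.
have mc0 : (md c)%:C != 0 :> R[i] by rewrite -md_gt0 md_real normr_gt0 gt_eqF.
exists (c / (md c)%:C); last by field.
by rewrite mdM mdV md_real gtr0_norm// divff// gt_eqF.
Qed.

(** Conjugation multiplies the coefficient [c] by [lam ^+ (m * p)] and the error by
    [md lam ^+ (m * p.+1)], so the relative error tends to 0 as [m] grows. For [p > 0] so does the
    step length; for [p = 0] that length remains [md c], which has to be small from the start. *)
Lemma flow_step_fixed g e p c A t (eta : R) : near_id_symmetry e g ->
  c != 0 -> 0 < t ->
  (forall w, md w < t -> md (g w - w - c * w ^+ p.+1) <= A * md w ^+ p.+2) ->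
  (p = 0%N -> md c < eta) -> 0 < eta -> eta <= 1 -> eta <= rho / 4 ->
  exists2 u, md u = 1 & flow_step rho2 p.+1 u eta.
Proof.
move=> hg c0 t0 h pc e0 e1 e4; have [r1 r2 r3] := rho2_le.
have m0 : 0 < md c by rewrite md_gt0.
have q01 : 0 <= md lam < 1 by rewrite md_ge0.
(* [n1] brings [lam ^+ m * w] into the disc of the expansion, [n2] makes the relative error at most
   [eta], and [n3] makes the step shorter than [eta] when [p > 0]. *)
have [n1 h1] := geometric_small 1 q01 t0.
have [n2 h2] := geometric_small `|A| q01 (mulr_gt0 e0 m0).
have [n3 h3] := geometric_small (md c) q01 e0.
pose m := (n1 + n2 + n3)%N.
have {}h1 := h1 m ltac:(by rewrite /m -addnA leq_addr).
have {}h2 := h2 m ltac:(by rewrite /m addnAC leq_addl).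
have {}h3 := h3 m ltac:(by rewrite /m leq_addl).
have l0 : lam != 0 by rewrite -md_gt0.
have lp0 k : 0 < md lam ^+ k by rewrite exprn_gt0.
pose a := lam ^+ (m * p) * c.
have a0 : a != 0 by rewrite mulf_neq0 ?expf_neq0.
have [u u1 aE] := unit_part a0.
have aM : md a = md lam ^+ (m * p) * md c by rewrite mdM mdX.
exists u => //; apply: (rescale_symmetry (m := m) (delta := md a) hg) => //.
- by rewrite md_gt0.
- rewrite aM; case: (p) pc => [/(_ erefl)|p' _]; first by rewrite muln0 expr0 mul1r.
  apply: le_lt_trans h3; rewrite mulrC ler_wpM2l ?md_ge0//.
  by rewrite mulnS exprD ler_piMr ?exprn_ge0 ?md_ge0// exprn_ile1 ?md_ge0// ltW.
- move=> w wr; rewrite -aE.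
  have w1 : md w <= 1 by lra.
  have lw : md (lam ^+ m * w) < t.
    rewrite mdM mdX; apply: le_lt_trans h1; rewrite mul1r ler_piMr//.
    exact: ltW.
  have -> : lam^-1 ^+ m * (g (lam ^+ m * w) - lam ^+ m * w) - a * w ^+ p.+1 =
      lam^-1 ^+ m * (g (lam ^+ m * w) - lam ^+ m * w - c * (lam ^+ m * w) ^+ p.+1).
    rewrite /a exprMn -exprM mulnS exprD exprVn; field.
    by rewrite expf_neq0.
  rewrite mdM mdX mdV exprVn ler_pdivrMl//; apply: (le_trans (h _ lw)).
  rewrite aM mdM mdX exprMn -exprM.
  have E : md lam ^+ m * (eta * (md lam ^+ (m * p) * md c)) =
     md lam ^+ (m * p.+1) * (eta * md c) by rewrite mulnS exprD; ring.
  rewrite E.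
  have -> : A * (md lam ^+ (m * p.+2) * md w ^+ p.+2) =
    md lam ^+ (m * p.+1) * (A * md lam ^+ m * md w ^+ p.+2).
    by rewrite [(m * p.+2)%N]mulnS exprD; ring.
  rewrite ler_pM2l//; apply: (le_trans _ (ltW h2)).
  have : A * md lam ^+ m * md w ^+ p.+2 <= `|A| * md lam ^+ m * md w ^+ p.+2.
    by rewrite !ler_wpM2r ?exprn_ge0 ?md_ge0// ler_norm.
  move=> /le_trans; apply; rewrite ler_piMr ?mulr_ge0 ?exprn_ge0 ?md_ge0//.
  by rewrite exprn_ile1 ?md_ge0.
Qed.

(** Conjugation magnifies the displacement [g 0] by [lam^-1 ^+ m]; the least admissible [m] puts the
    step length between [eta * md lam] and [eta]. The variation of the displacement is not
    magnified, as the disc shrinks by the same factor: it stays below [12 * e / rho1], hence below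
    [eta] times the step. *)
Lemma flow_step_moving g e (eta : R) : near_id_symmetry e g -> 0 < e ->
  g 0 != 0 -> e < eta -> 12 * e / rho1 <= eta * (eta * md lam) ->
  eta <= 1 -> eta <= rho / 4 ->
  exists2 u, md u = 1 & flow_step rho2 0 u eta.
Proof.
move=> hg e0 g0 eeta epsE e1 e4; have [r1 r2 r3] := rho2_le.
have m0 : 0 < md (g 0) by rewrite md_gt0.
have eta0 : 0 < eta by exact: lt_trans eeta.
have q01 : 0 <= md lam < 1 by rewrite md_ge0.
have [hc he _ _] := hg.
have g0e : md (g 0) <= e by have := he 0; rewrite subr0; apply; rewrite md0.
have ex : exists n, eta * md lam ^+ n.+1 <= md (g 0).
  have [n /(_ n.+1 (leqnSn n)) h] := geometric_small eta q01 m0.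
  by exists n; exact: ltW.
case: (ex_minnP ex) => m hm mmin.
have hm' : md (g 0) < eta * md lam ^+ m.
  case: m mmin {hm} => [|m] mmin; first by rewrite expr0 mulr1; lra.
  by rewrite ltNge; apply/negP => /mmin; rewrite ltnn.
have lp0 k : 0 < md lam ^+ k by rewrite exprn_gt0.
have l0 : lam != 0 by rewrite -md_gt0.
pose a := lam^-1 ^+ m * g 0.
have a0 : a != 0 by rewrite mulf_neq0 ?expf_neq0 ?invr_eq0.
have [u u1 aE] := unit_part a0.
have aM : md a = md (g 0) / md lam ^+ m by rewrite mdM mdX mdV exprVn mulrC.
have ge : eta * md lam <= md a.
  by rewrite aM ler_pdivlMr// -mulrA -exprS.
exists u => //; apply: (rescale_symmetry (m := m) (delta := md a) hg) => //.
- by rewrite md_gt0.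
- by rewrite aM ltr_pdivrMr.
- move=> w wr; rewrite -aE expr0 mulr1 {1}/a -mulrBr.
  have hd : chol 0 rho1 (fun w => g w - w).
    by move=> z /hc[d dd]; exists (d - 1); apply: cdiffB => //; exact: cdiff_id.
  have hb z : md (z - 0) < rho1 -> md (g z - z) <= e by rewrite subr0; exact: he.
  have lm : md (lam ^+ m * w) <= md w.
    by rewrite mdM mdX ler_piMl ?md_ge0// exprn_ile1 ?md_ge0// ltW.
  have := taylor_lip rho10 hd hb (z := lam ^+ m * w).
  rewrite !subr0 => /(_ ltac:(lra)) T.
  rewrite mdM mdX mdV exprVn ler_pdivrMl//; apply: (le_trans T).
  rewrite mdM mdX [leLHS]mulrCA ler_wpM2l ?exprn_ge0 ?md_ge0//.
  have k0 : 0 <= 12 * e / rho1 by rewrite divr_ge0 ?(ltW rho10)// mulr_ge0// ltW.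
  apply: (@le_trans _ _ (12 * e / rho1)); first by rewrite ler_piMr//; lra.
  by apply: (le_trans epsE); rewrite ler_wpM2l// ltW.
Qed.

(** The exponent may not depend on [eta]. If arbitrarily close symmetries move 0, it is 0. Otherwise
    all close ones fix 0. If the displacement of one of them vanishes to order at least 2, this
    single map serves every [eta]; if none does, all orders are 1, and the coefficient, the
    derivative of [g w - w] at 0, is small by Cauchy's estimate. *)
Lemma flow_step_exists : exists p, forall eta : R, 0 < eta ->
  eta <= 1 -> eta <= rho / 4 -> exists2 u, md u = 1 & flow_step rho2 p u eta.
Proof.
have [h|] := pselect (forall e : R, 0 < e -> exists2 g, near_id_symmetry e g & g 0 != 0).
  exists 0%N => eta eta0 e1 e4.
  pose e := Num.min (eta / 2) (eta * (eta * md lam) * rho1 / 12).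
  have e0 : 0 < e by rewrite lt_min !(divr_gt0, mulr_gt0).
  have [g hg g0] := h e e0; apply: (flow_step_moving hg) => //.
    by apply: (@le_lt_trans _ _ (eta / 2)); [rewrite ge_min lexx|lra].
  have : e <= eta * (eta * md lam) * rho1 / 12 by rewrite ge_min lexx orbT.
  by rewrite ler_pdivrMr//; lra.
move=> /existsNP[e1 /not_implyP[e10 /forall2NP nomove]].
have fixed g e : near_id_symmetry e g -> e <= e1 -> g 0 = 0.
  move=> [h1 h2 h3 h4] ee; have [k|/negP/negPn/eqP//] := nomove g.
  by exfalso; apply: k; split => // w /h2 /le_trans; exact.
have order g e : near_id_symmetry e g -> e <= e1 -> exists p c A t,
    [/\ c != 0, 0 < t & forall w, md w < t ->
      md (g w - w - c * w ^+ p.+1) <= A * md w ^+ p.+2].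
  move=> hg ee; have g0 := fixed _ _ hg ee; case: hg => hc he hid _.
  have hd : chol 0 rho1 (fun w => g w - w).
    by move=> z /hc[d dd]; exists (d - 1); apply: cdiffB => //; exact: cdiff_id.
  have [z0|[p [c [A [t [c0 t0 h]]]]]] := zero_order rho10 hd.
    exfalso; apply: hid; exists (rho1 / 12); first exact: divr_gt0.
    move=> w wr; have := z0 w; rewrite subr0 => /(_ wr) /eqP.
    by rewrite subr_eq0 => /eqP.
  case: p h => [|p] h.
    have := h 0; rewrite g0 !subr0 md0 expr0 mulr1 sub0r mdN expr1 mulr0.
    by move=> /(_ t0); have := md_gt0 c; rewrite c0 leNgt => ->.
  by exists p, c, A, t; split => // w wt; have := h w; rewrite !subr0; exact.
have [[g [p [c [A [t [hg c0 t0 h]]]]]]|nop] := pselect (exists g p c A t,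
    [/\ near_id_symmetry e1 g, c != 0, 0 < t & forall w, md w < t ->
      md (g w - w - c * w ^+ p.+2) <= A * md w ^+ p.+3]).
  by exists p.+2 => eta *; apply: (flow_step_fixed hg c0 t0 h).
exists 1%N => eta eta0 e1' e4.
pose e := Num.min e1 (eta * rho1 / 12).
have e0 : 0 < e by rewrite lt_min e10 divr_gt0// mulr_gt0.
have ee1 : e <= e1 by rewrite ge_min lexx.
have ee2 : e <= eta * rho1 / 12 by rewrite ge_min lexx orbT.
have [g hg] := near e0.
have [[|p] [c [A [t [c0 t0 h]]]]] := order g e hg ee1; last first.
  exfalso; apply: nop; exists g, p, c, A, t; split => //.
  by case: hg => h1 h2 h3 h4; split => // w /h2 /le_trans; exact.
apply: (flow_step_fixed hg c0 t0 h) => // _.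
have g0 := fixed _ _ hg ee1; case: hg => hc he _ _.
have hd : chol 0 rho1 (fun w => g w - w).
  by move=> z /hc[d dd]; exists (d - 1); apply: cdiffB => //; exact: cdiff_id.
have <- : cder (fun w => g w - w) 0 = c.
  apply: cderE; apply: (@quadratic_cdiff _ _ _ _ _ A t0) => w; rewrite subr0 => wt.
  by rewrite g0 !subr0; have := h w wt; rewrite expr1.
have := @cauchy_cder _ _ 0 rho1 e rho10 hd.
move=> /(_ _)/le_lt_trans; apply; first by move=> z; rewrite subr0; exact: he.
by rewrite ltr_pdivrMr//; have := mulr_gt0 eta0 rho10; lra.
Qed.

End Scaling.

End Linearization.

(** * Charts making a compact set laminar *)

Section LibraryDerivative.
Context {R : realType}.
Implicit Types (f : R[i] -> R[i]) (z w a d : R[i]) (A B : set R[i]).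

Lemma dnbhs_limP f (d : R[i]) : f h @[h --> (0 : R[i])^'] --> d <->
  forall e : R, 0 < e -> exists2 t : R, 0 < t &
    forall h, h != 0 -> md h < t -> md (f h - d) < e.
Proof.
split=> [fd e e0|fd A /nbhs_md[e e0 hA]].
  have : nbhs d [set w | md (w - d) < e] by apply/nbhs_md; exists e.
  move=> /fd; rewrite /nbhs /= /dnbhs /within /= => /nbhs_md[t t0 h].
  by exists t => // x x0 xt; apply: h => //; rewrite subr0.
have [t t0 h] := fd e e0; rewrite /nbhs /= /dnbhs /within /=.
by apply/nbhs_md; exists t => // x; rewrite subr0 => xt x0; apply/hA/h.
Qed.

Lemma quotient_cdiff f z d : cdiff f z d <->
  h^-1 * (f (h + z) - f z) @[h --> (0 : R[i])^'] --> d.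
Proof.
rewrite dnbhs_limP cdiffP; split=> h e e0.
  have e2 : 0 < e / 2 by lra.
  have [t t0 ht] := h _ e2; exists t => // x x0 xt.
  have := ht (x + z); rewrite addrK => /(_ xt).
  have -> : f (x + z) - f z - d * x = (x^-1 * (f (x + z) - f z) - d) * x by field.
  by rewrite mdM ler_pM2r ?md_gt0// => /le_lt_trans; apply; lra.
have [t t0 ht] := h _ e0; exists t => // w wt.
have [->|wz] := eqVneq w z; first by rewrite !subrr mulr0 subr0 md0 mulr0.
have wz0 : w - z != 0 by rewrite subr_eq0.
have := ht (w - z) wz0 wt; rewrite subrK => k.
have -> : f w - f z - d * (w - z) = ((w - z)^-1 * (f w - f z) - d) * (w - z) by field.
by rewrite mdM ler_wpM2r ?md_ge0// ltW.
Qed.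

Lemma derivable_cdiff f z : derivable f z 1 <-> exists d, cdiff f z d.
Proof.
have E : (fun h : R[i] => h^-1 *: ((f \o shift z) (h *: 1) - f z)) =
         (fun h : R[i] => h^-1 * (f (h + z) - f z)).
  by apply/funext => h /=; rewrite -[h *: 1]/(h * 1) mulr1.
rewrite /derivable E; split=> [/cvg_ex[d fd]|[d fd]].
  by exists d; apply/quotient_cdiff.
by apply/cvg_ex; exists d; apply/quotient_cdiff.
Qed.

Lemma derive1_cdiff f z d : cdiff f z d -> (f^`())%classic z = d.
Proof.
move=> /quotient_cdiff fd; rewrite /derive1.
by apply: cvg_lim => //; exact: norm_hausdorff.
Qed.

Lemma star_connected A a : A a ->
  (forall z (t : R), A z -> 0 <= t <= 1 -> A (a + t%:C * (z - a))) -> connected A.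
Proof.
move=> Aa star; pose S z := (fun t : R => a + t%:C * (z - a)) @` `[0, 1]%classic.
have -> : A = \bigcup_(z in A) S z.
  apply/seteqP; split=> [z Az|w [z Az [t]]].
    exists z => //; exists 1; first by rewrite /= in_itv /= ler01 lexx.
    by rewrite mul1r subrKC.
  by rewrite /= in_itv /= => t01 <-; exact: star.
apply: bigcup_connected => [|z _].
  exists a => z _; exists 0; first by rewrite /= in_itv /= ler01 lexx.
  by rewrite mul0r addr0.
apply: connected_continuous_connected; first exact: segment_connected.
apply: continuous_subspaceT => t B /nbhs_md[e e0 hB].
have z1 : 0 < md (z - a) + 1 by have := md_ge0 (z - a); lra.
apply/nbhs_ballP; exists (e / (md (z - a) + 1)); first exact: divr_gt0.
move=> s; rewrite /ball /= ltr_pdivlMr// distrC => st; apply: hB.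
have -> : a + s%:C * (z - a) - (a + t%:C * (z - a)) = (s - t)%:C * (z - a).
  by rewrite (rmorphB (real_complex R)) /=; ring.
rewrite mdM md_real; apply: le_lt_trans st.
by rewrite ler_wpM2l// lerDl.
Qed.

Lemma within_continuousP (T : pseudoMetricType R) (A : set T) (f : T -> R[i]) :
  {within A, continuous f} <-> forall x, A x -> forall e : R, 0 < e ->
    exists2 t : R, 0 < t & forall y, A y -> ball x t y -> md (f y - f x) < e.
Proof.
rewrite subspace_continuousP; split=> h x Ax.
  move=> e e0; have : nbhs (f x) [set w | md (w - f x) < e] by apply/nbhs_md; exists e.
  move=> /(h x Ax); rewrite /nbhs /= /within /= => /nbhs_ballP[t /= t0 k].
  by exists t => // y Ay xy; exact: k.
move=> B /nbhs_md[e e0 hB]; have [t t0 k] := h x Ax e e0.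
rewrite /nbhs /= /within /=; apply/nbhs_ballP; exists t => //= y xy Ay.
exact/hB/k.
Qed.

End LibraryDerivative.

(** * A coordinate in which the set is invariant under horizontal translations *)

Section Laminar.
Context {R : realType}.
Variables (K N : set R[i]) (kap The : R[i] -> R[i]) (u0 : R[i]) (tau : R).
Hypotheses (clK : closed K) (openN : open N).
Hypothesis kapN : forall u, md (u - u0) < tau ->
  [/\ N (kap u), The (kap u) = u & ccont kap u].
Hypothesis TheN : forall z, N z ->
  [/\ md (The z - u0) < tau, kap (The z) = z & exists d, cdiff The z d].
Hypothesis transl : forall u (t : R), md (u - u0) < tau ->
  md (u + t%:C - u0) < tau -> K (kap u) -> K (kap (u + t%:C)).

Let box (u1 : R[i]) (e : R) : set R[i] :=
  [set u | `|complex.Re (u - u1)| < e /\ `|complex.Im (u - u1)| < e].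
Let cbox (u1 : R[i]) (e : R) : set R[i] :=
  [set u | `|complex.Re (u - u1)| <= e /\ `|complex.Im (u - u1)| <= e].

Let Re_scale (t : R) (z : R[i]) : complex.Re (t%:C * z) = t * complex.Re z.
Proof. by case: z => x y /=; rewrite mul0r subr0. Qed.

Let Im_scale (t : R) (z : R[i]) : complex.Im (t%:C * z) = t * complex.Im z.
Proof. by case: z => x y /=; rewrite mul0r addr0. Qed.

Let cbox_md u1 e u : cbox u1 e u -> md (u - u1) <= 2 * e.
Proof. by move=> [h1 h2]; have := md_le_ReIm (u - u1); lra. Qed.

Let box_star u1 e u v (t : R) : box u1 e u -> box u1 e v -> 0 <= t <= 1 ->
  box u1 e (u + t%:C * (v - u)).
Proof.
move=> [h1 h2] [h3 h4] /andP[t0 t1].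
have -> : u + t%:C * (v - u) = u1 + ((1 - t)%:C * (u - u1) + t%:C * (v - u1)).
  by rewrite (rmorphB (real_complex R)) /=; ring.
have key (x y : R) : `|x| < e -> `|y| < e -> `|(1 - t) * x + t * y| < e.
  rewrite !ltr_norml => /andP[? ?] /andP[? ?].
  by have [t2|t2] := leP t (1 / 2); apply/andP; split; nra.
rewrite /box /= addrAC subrr add0r !ReD !ImD !Re_scale !Im_scale.
by split; apply: key.
Qed.

(** The coordinate box is convex: loops contract to their base point along segments in the
    coordinate [The]. *)
Let kap_image_simply_connected u1 e : 0 < e ->
  (forall u, md (u - u1) < 4 * e -> md (u - u0) < tau) ->
  simply_connected (kap @` box u1 e).
Proof.
move=> e0 inB gam cgam gamO gam01.
have boxB u : box u1 e u -> md (u - u0) < tau.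
  by move=> [h1 h2]; apply: inB; have := md_le_ReIm (u - u1); lra.
have gbox t : 0 <= t <= 1 -> box u1 e (The (gam t)) /\ kap (The (gam t)) = gam t.
  move=> t01; have [u ub <-] : (kap @` box u1 e) (gam t).
    by apply: gamO; exists t => //; rewrite /= in_itv.
  by have [_ -> _] := kapN (boxB u ub).
have one : 0 <= (1 : R) <= 1 by rewrite ler01 lexx.
have zero : 0 <= (0 : R) <= 1 by rewrite ler01 lexx.
pose c (p : R * R) := The (gam p.2) + p.1%:C * (The (gam 0) - The (gam p.2)).
exists (fun p => kap (c p)); split.
- apply/within_continuousP => -[s t] [/= s01 t01] d d0.
  rewrite !in_itv /= in s01 t01.
  have [gt1 gt2] := gbox t t01; have [g01 g02] := gbox 0 zero.
  have cb : box u1 e (c (s, t)) by exact: box_star.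
  have [_ _ ck] := kapN (boxB _ cb); have [r r0 hr] := ck d d0.
  have Nt : N (gam t) by rewrite -gt2; have [] := kapN (boxB _ gt1).
  have [_ _ [d' dT]] := TheN Nt.
  pose X := md (The (gam 0) - The (gam t)) + 1.
  have X0 : 0 < X by rewrite ltr_wpDl// md_ge0.
  have r4 : 0 < r / 4 by lra.
  have [r1 r10 hr1] := cdiff_ccont dT r4.
  have t01' : `[0, 1]%classic t by rewrite /= in_itv.
  have := (@within_continuousP _ R `[0, 1]%classic gam).1 cgam t t01' r1 r10.
  move=> [r2 r20 hr2].
  have rX : 0 < r / (2 * X) by rewrite divr_gt0// mulr_gt0.
  exists (Num.min r2 (r / (2 * X))); first by rewrite lt_min r20.
  move=> [s' t'] [/= s01' t01''] [/=]; rewrite /ball /= !lt_min.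
  rewrite !in_itv /= in s01' t01''.
  move=> /andP[_ hs] /andP[ht _]; apply: hr.
  have ht' : md (gam t' - gam t) < r1.
    by apply: hr2; [rewrite /= in_itv|exact: ht].
  have hT := hr1 _ ht'.
  rewrite /c /=.
  have -> : The (gam t') + s'%:C * (The (gam 0) - The (gam t')) -
     (The (gam t) + s%:C * (The (gam 0) - The (gam t))) =
     (1 - s')%:C * (The (gam t') - The (gam t)) +
     (s' - s)%:C * (The (gam 0) - The (gam t)).
    by rewrite !(rmorphB (real_complex R)) /=; ring.
  apply: (le_lt_trans (mdD _ _)); rewrite !mdM !md_real.
  have h1 : `|1 - s'| * md (The (gam t') - The (gam t)) <= r / 4.
    apply: (@le_trans _ _ (1 * md (The (gam t') - The (gam t)))); last by rewrite mul1r ltW.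
    by rewrite ler_wpM2r ?md_ge0// ler_norml; lra.
  have h2 : `|s' - s| * md (The (gam 0) - The (gam t)) <= r / 2.
    rewrite distrC; move: hs; rewrite ltr_pdivlMr ?mulr_gt0// => hs.
    have : `|s - s'| * md (The (gam 0) - The (gam t)) <= `|s - s'| * X.
      by rewrite ler_wpM2l// lerDl.
    by lra.
  lra.
- move=> _ [[s t] [/= s01 t01] <-]; rewrite !in_itv /= in s01 t01.
  by exists (c (s, t)) => //; apply: box_star => //; [have [] := gbox t t01|have [] := gbox 0 zero].
- by move=> t t01; rewrite /c /= mul0r addr0; have [] := gbox t t01.
- by move=> t t01; rewrite /c /= mul1r subrKC; have [] := gbox 0 zero.
- move=> s s01; rewrite /c /= gam01; split.
    by rewrite subrr mulr0 addr0; have [] := gbox 1 one.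
  by rewrite subrr mulr0 addr0; have [] := gbox 1 one.
Qed.

(** In the coordinate, translation invariance makes the trace of [K] on a closed box the product of
    a horizontal interval and a vertical slice; [psi] rescales the box so that the interval becomes
    [[0, 1]]. *)
Lemma chart_laminar : laminar_relative K N.
Proof.
move=> O oO ON [z0 [Oz0 Kz0]]; have [zt zk _] := TheN (ON _ Oz0).
pose u1 := The z0; have [_ _ ck] := kapN zt.
have [r r0 hr] : exists2 r : R, 0 < r & forall w, md (w - z0) < r -> O w.
  by move/open_md: oO; apply.
have [d d0 hd] := ck r r0.
(* A quarter, since the closed box of half-side [e] lies in the closed disc of radius [2 * e], well
   inside the disc of radius [4 * e]. *)
pose e := Num.min d (tau - md (u1 - u0)) / 4.
have m0 : 0 < Num.min d (tau - md (u1 - u0)) by rewrite lt_min d0 subr_gt0.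
have e0 : 0 < e by rewrite divr_gt0.
have ed : 4 * e <= d by rewrite /e mulrC divfK// ge_min lexx.
have et : 4 * e <= tau - md (u1 - u0) by rewrite /e mulrC divfK// ge_min lexx orbT.
have inB u : md (u - u1) < 4 * e -> md (u - u0) < tau by have := md_tri u1 u u0; lra.
have inO u : md (u - u1) < 4 * e -> O (kap u).
  by move=> ue; apply: hr; rewrite -[X in _ - X]zk; apply: hd; rewrite -/u1; lra.
have cin u : cbox u1 e u -> md (u - u1) < 4 * e by move=> /cbox_md; lra.
have boxc u : box u1 e u -> cbox u1 e u by move=> [? ?]; split; exact: ltW.
have ccb : compact (cbox u1 e).
  apply: subclosed_compact (@closed_ball_compact R u1 (2 * e)) _; last first.
    by move=> u; exact: cbox_md.
  rewrite closure_id; apply/seteqP; split; first exact: subset_closure.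
  move=> u /closure_md h; split; apply/ler_addgt0Pr => x x0.
    have [w [hw _] wu] := h x x0; have := Re_le_md (w - u).
    have -> : u - u1 = (w - u1) - (w - u) by ring.
    by rewrite ReB => k; apply: (le_trans (ler_normB _ _)); lra.
  have [w [_ hw] wu] := h x x0; have := Im_le_md (w - u).
  have -> : u - u1 = (w - u1) - (w - u) by ring.
  by rewrite ImB => k; apply: (le_trans (ler_normB _ _)); lra.
have ckap u : cbox u1 e u -> {for u, continuous kap}.
  by move=> /cin/inB/kapN[_ _ /ccontP].
have clE : closure (kap @` box u1 e) = kap @` cbox u1 e.
  (* The image of the closed box is compact, hence closed; conversely, its points are approached by
     shrinking the box slightly towards its centre. *)
  apply/seteqP; split=> [z|z [u uc <-]].
    have cl : closed (kap @` cbox u1 e).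
      apply: compact_closed; first exact: norm_hausdorff.
      apply: continuous_compact => //; apply: continuous_in_subspaceT => u.
      by rewrite inE => /ckap.
    move=> hz; apply: cl; apply: closureS hz.
    by move=> _ [u /boxc ub <-]; exists u.
  apply/closure_md => x x0; have [_ _ cku] := kapN (inB _ (cin _ uc)).
  have [y y0 hy] := cku x x0.
  pose t := Num.min (1 / 2) (y / (4 * e)).
  have t0 : 0 < t by rewrite lt_min divr_gt0//= divr_gt0// mulr_gt0.
  have t1 : t <= 1 / 2 by rewrite ge_min lexx.
  have t2 : t * (4 * e) <= y by rewrite -ler_pdivlMr ?mulr_gt0// ge_min lexx orbT.
  have v1 : u1 + (1 - t)%:C * (u - u1) - u1 = (1 - t)%:C * (u - u1) by ring.
  exists (kap (u1 + (1 - t)%:C * (u - u1))).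
    exists (u1 + (1 - t)%:C * (u - u1)) => //; case: uc => h1 h2.
    have p (y' : R) : `|y'| <= e -> `|(1 - t) * y'| < e.
      by move=> h; rewrite normrM ger0_norm; [have := normr_ge0 y'; nra|lra].
    by split; rewrite v1 ?Re_scale ?Im_scale; apply: p.
  apply: hy; have -> : u1 + (1 - t)%:C * (u - u1) - u = - (t%:C * (u - u1)).
    by rewrite (rmorphB (real_complex R)) /=; ring.
  rewrite mdN mdM md_real gtr0_norm//; have := cbox_md uc; nra.
have u1c : box u1 e u1 by rewrite /box /= subrr /= normr0.
exists (kap @` box u1 e); split.
- split.
    apply/open_md => _ [u ub <-]; have ue := boxc _ ub; have uB := inB _ (cin _ ue).
    have [Nu Tu _] := kapN uB; have [_ _ [d' dT]] := TheN Nu.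
    pose m := Num.min (e - `|complex.Re (u - u1)|) (e - `|complex.Im (u - u1)|).
    have mm0 : 0 < m by case: ub => *; rewrite lt_min !subr_gt0; apply/andP.
    have [x x0 hx] := cdiff_ccont dT mm0.
    have [y y0 hy] := (open_md N).1 openN _ Nu.
    exists (Num.min x y) => [|w]; first by rewrite lt_min x0.
    rewrite lt_min => /andP[/hx wx /hy Nw]; have [_ kw _] := TheN Nw.
    exists (The w) => //; rewrite Tu lt_min in wx; case/andP: wx => w1 w2.
    have := Re_le_md (The w - u); have := Im_le_md (The w - u).
    have -> : box u1 e (The w) = (`|complex.Re ((The w - u) + (u - u1))| < e /\
        `|complex.Im ((The w - u) + (u - u1))| < e).
      by rewrite /box /= addrA subrK.
    rewrite ReD ImD => h1 h2.
    by split; [apply: (le_lt_trans (ler_normD _ _)); lra|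
      apply: (le_lt_trans (ler_normD _ _)); lra].
  apply: connected_continuous_connected; last first.
    by apply: continuous_in_subspaceT => u; rewrite inE => /boxc/ckap.
  by apply: (@star_connected _ _ u1) => // u t ub t01; exact: box_star.
- exact: kap_image_simply_connected.
- by move=> _ [u /boxc/cin ub <-]; exact: inO.
(* The slice of [K] by the vertical line through the centre of the box, in the scale of [psi]; it
   contains 0 because [z0] is in [K]. *)
pose L : set R[i] := [set l | [/\ complex.Re l = 0, `|complex.Im l| <= 1 / 2 &
  K (kap (u1 + (2 * e)%:C * l))]].
pose psi z := (2 * e)^-1%:C * (The z - u1) + (1 / 2)%:C.
have e20 : (2 * e)%:C != 0 :> R[i].
  by rewrite -md_gt0 md_real normr_gt0 mulf_neq0// gt_eqF.
have e2V : (2 * e)^-1%:C = ((2 * e)%:C)^-1 :> R[i] by exact: (fmorphV (real_complex R)).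
have Lc l : L l -> cbox u1 e (u1 + (2 * e)%:C * l).
  move=> [h1 h2 _]; rewrite /cbox /= addrAC subrr add0r Re_scale Im_scale h1 mulr0 normr0.
  by split; [exact: ltW|rewrite normrM gtr0_norm ?mulr_gt0//; nra].
exists L, N, psi; split.
  split.
  - exists 0; split => //; first by rewrite normr0; lra.
    by rewrite mulr0 addr0 /u1 zk.
  - apply: subclosed_compact (@closed_ball_compact R 0 1) _; last first.
      move=> l [h1 h2 _]; have := md_le_ReIm l.
      by rewrite /= subr0 h1 normr0; lra.
    rewrite closure_id; apply/seteqP; split; first exact: subset_closure.
    move=> l /closure_md h.
    have l1 : complex.Re l = 0.
      apply/eqP; rewrite -normr_le0; apply/ler_addgt0Pr => x x0.
      have [w [hw _ _] wu] := h x x0; have := Re_le_md (w - l).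
      by rewrite ReB hw sub0r normrN add0r; lra.
    have l2 : `|complex.Im l| <= 1 / 2.
      apply/ler_addgt0Pr => x x0; have [w [_ hw _] wu] := h x x0.
      have := Im_le_md (w - l); rewrite ImB => k.
      have -> : complex.Im l = complex.Im w - (complex.Im w - complex.Im l) by ring.
      by apply: (le_trans (ler_normB _ _)); lra.
    split => //; apply: clK; apply/closure_md => x x0.
    have lin : cbox u1 e (u1 + (2 * e)%:C * l).
      rewrite /cbox /= addrAC subrr add0r Re_scale Im_scale l1 mulr0 normr0.
      by split; [exact: ltW|rewrite normrM gtr0_norm ?mulr_gt0//; nra].
    have [_ _ ckl] := kapN (inB _ (cin _ lin)).
    have [y y0 hy] := ckl x x0.
    have ye : 0 < y / (2 * e) by rewrite divr_gt0// mulr_gt0.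
    have [w Lw wl] := h _ ye.
    exists (kap (u1 + (2 * e)%:C * w)); first by case: Lw.
    apply: hy; have -> : u1 + (2 * e)%:C * w - (u1 + (2 * e)%:C * l) =
      (2 * e)%:C * (w - l) by ring.
    by rewrite mdM md_real gtr0_norm ?mulr_gt0// mulrC -ltr_pdivlMr ?mulr_gt0.
  - by move=> l [].
split.
- exact: openN.
- by rewrite clE => _ [u /cin/inB/kapN[Nu _ _] <-].
- move=> z /TheN[_ _ [d' dT]]; apply/derivable_cdiff; eexists.
  apply: cdiffD; last exact: cdiff_cst.
  by apply: cdiffZ; apply: cdiffB; [exact: dT|exact: cdiff_cst].
- move=> z w; rewrite !inE => /TheN[_ kz _] /TheN[_ kw _] /addIr E.
  rewrite -kz -kw; congr kap; apply: (addIr (- u1)).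
  by apply: mulfI E; rewrite e2V invr_eq0.
(* A point of [K] in the box slides horizontally to the central line, where it gives an element of
   [L]; the other inclusion slides it back. *)
rewrite clE; apply/seteqP; split=> [_ [z [[u uc <-] Kz] <-]|_ [x x01] [l Ll] <-].
  have uB := inB _ (cin _ uc); have [_ Tu _] := kapN uB; rewrite /psi Tu.
  case: uc => u1' u2'; pose X := complex.Re (u - u1); pose Y := complex.Im (u - u1).
  have uE : u - u1 = X%:C + 'i * Y%:C by exact: complexRI.
  have lE : u1 + (2 * e)%:C * ('i * (Y / (2 * e))%:C) = u + (- X)%:C.
    rewrite mulrCA -(rmorphM (real_complex R)) /= [2 * e * _]mulrC divfK; last first.
      by rewrite gt_eqF ?mulr_gt0.
    by rewrite -[u](subrK u1) uE (rmorphN (real_complex R)) /=; ring.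
  exists (X / (2 * e) + 1 / 2).
    rewrite /= in_itv /=; move: u1'; rewrite ler_norml -/X => /andP[? ?].
    have : -1 / 2 <= X / (2 * e) by rewrite ler_pdivlMr ?mulr_gt0//; lra.
    have : X / (2 * e) <= 1 / 2 by rewrite ler_pdivrMr ?mulr_gt0//; lra.
    by lra.
  have Lx : cbox u1 e (u + (- X)%:C).
    rewrite -lE /cbox /= addrAC subrr add0r Re_scale Im_scale /=.
    rewrite !(mul0r, mulr0, mul1r, add0r, addr0, subr0, oppr0) mulrC divfK ?gt_eqF ?mulr_gt0//.
    by rewrite normr0 (ltW e0).
  exists ('i * (Y / (2 * e))%:C).
    split; rewrite ?lE /=; first by rewrite !(mul0r, mulr0) subr0.
      rewrite !(mul0r, mul1r, add0r) normrM normfV [X in _ / X]gtr0_norm ?mulr_gt0//.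
      by rewrite ler_pdivrMr ?mulr_gt0//; move: u2'; rewrite -/Y; lra.
    by apply: transl => //; apply: inB; exact: cin.
  rewrite uE (rmorphD (real_complex R)) !(rmorphM (real_complex R)) /= !e2V.
  by ring.
rewrite /= in_itv /= in x01.
have lc := Lc l Ll; have lB := inB _ (cin _ lc).
pose u := u1 + (2 * e)%:C * l + (2 * e * (x - 1 / 2))%:C.
have ucb : cbox u1 e u.
  have uu : u - u1 = (2 * e)%:C * l + (2 * e * (x - 1 / 2))%:C by rewrite /u; ring.
  case: Ll => l1 l2 _; rewrite /cbox /= uu.
  rewrite ReD ImD Re_scale Im_scale /= l1 mulr0 add0r addr0; split.
    by rewrite ler_norml; apply/andP; split; nra.
  by rewrite normrM gtr0_norm ?mulr_gt0//; nra.
have uB := inB _ (cin _ ucb); have [_ Tu _] := kapN uB.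
exists (kap u).
  split; first by exists u.
  by apply: transl => //; case: Ll.
rewrite /psi Tu /u e2V.
have -> : (2 * e * (x - 1 / 2))%:C = (2 * e)%:C * (x%:C - (1 / 2)%:C) :> R[i].
  by rewrite -(rmorphB (real_complex R)) -(rmorphM (real_complex R)).
by move: (2 * e)%:C (1 / 2)%:C e20 => c h c0; field.
Qed.

End Laminar.

(** * Translations in the time coordinate of a flow *)

Section Flow.
Context {R : realType}.
Implicit Types (K : set R[i]) (f g T k : R[i] -> R[i]) (z w u : R[i]) (r s t : R).

Lemma floor_steps (a d : R) : 0 <= a -> 0 < d ->
  exists n, n%:R * d <= a < n.+1%:R * d.
Proof.
move=> a0 d0.
have ex : exists n, a < n.+1%:R * d.
  exists (Num.bound (a / d)); rewrite -ltr_pdivrMr//.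
  have ad : 0 <= a / d by rewrite divr_ge0// ltW.
  have := archi_boundP ad => /lt_trans; apply.
  by rewrite ltr_nat.
case: (ex_minnP ex) => n hn nmin; exists n; rewrite hn andbT.
case: n nmin {hn} => [|n] nmin; first by rewrite mul0r.
by rewrite leNgt; apply/negP => /nmin; rewrite ltnn.
Qed.

Section Translation.
Variables (K : set R[i]) (T k : R[i] -> R[i]) (w0 : R[i]) (s tau : R).
Hypotheses (s0 : 0 < s) (tau0 : 0 < tau).
Hypothesis kT : forall z, md (z - w0) < s -> k (T z) = z /\ ccont k (T z).
Hypothesis clK : forall y, md (y - w0) < s ->
  (forall e : R, 0 < e -> exists2 x, K x & md (x - y) < e) -> K y.
Hypothesis step : forall eta : R, 0 < eta -> exists2 delta : R, 0 < delta < eta &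
  forall x, K x -> md (x - w0) < s / 2 -> forall sg : R, sg = 1 \/ sg = -1 ->
  exists x', [/\ K x', md (x' - w0) < s &
    md (T x' - T x - (sg * delta)%:C) <= eta * delta].
Hypothesis surj : forall u, md (u - T w0) < 4 * tau ->
  exists2 z, md (z - w0) < s / 2 & T z = u.

(* Iterating [|t| / delta] steps moves a point by [t] up to an error of order
   [eta]. *)
Lemma translation_invariant u t : md (u - T w0) < tau ->
  md (u + t%:C - T w0) < tau -> K (k u) -> K (k (u + t%:C)).
Proof.
move=> ut vt Ku; have tp := tau0; have sp := s0; have s2 : s / 2 < s by lra.
pose sg : R := if 0 <= t then 1 else -1; pose a := `|t|.
have sgE : sg = 1 \/ sg = -1 by rewrite /sg; case: ifP => _; [left|right].
have sga : sg * a = t.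
  rewrite /sg /a; case: (leP 0 t) => h; first by rewrite mul1r ger0_norm.
  by rewrite mulN1r ltr0_norm ?opprK.
have sg1 : `|sg| = 1 by case: sgE => ->; rewrite ?normrN normr1.
have a2 : a <= 2 * tau.
  have := mdB (u + t%:C - T w0) (u - T w0).
  have -> : u + t%:C - T w0 - (u - T w0) = t%:C by ring.
  by rewrite md_real -/a; lra.
have [y ys yE] : exists2 z, md (z - w0) < s / 2 & T z = u + t%:C by apply: surj; lra.
have [z zs zE] : exists2 z, md (z - w0) < s / 2 & T z = u by apply: surj; lra.
have [ky cky] := kT (lt_trans ys s2); have [kz _] := kT (lt_trans zs s2).
rewrite yE in ky cky; rewrite zE in kz; rewrite ky; rewrite kz in Ku.
apply: clK; first by lra.
move=> e e0; have [d d0 hd] := cky e e0.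
(* The iteration ends within [delta + 2 * tau * eta], hence within [d], of the target;
   [eta <= 1 / 4] keeps the orbit where [surj] applies. *)
pose eta := Num.min (1 / 4) (d / (1 + 2 * tau)).
have p0 : 0 < 1 + 2 * tau by lra.
have eta0 : 0 < eta by rewrite lt_min !divr_gt0.
have eta1 : eta <= 1 / 4 by rewrite ge_min lexx.
have eta2 : eta * (1 + 2 * tau) <= d by rewrite -ler_pdivlMr// ge_min lexx orbT.
have [delta /andP[delta0 deltae] hstep] := step eta0.
have it n : n%:R * delta <= a -> exists x, [/\ K x, md (x - w0) < s / 2 &
    md (T x - u - (sg * (n%:R * delta))%:C) <= n%:R * (eta * delta)].
  elim: n => [|n IH] na.
    by exists z; rewrite !mul0r mulr0 zE subrr subr0 md0.
  have nS : n.+1%:R = n%:R + 1 :> R by rewrite -natr1.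
  have [|x [Kx xs hx]] := IH; first by rewrite nS in na; lra.
  have [x' [Kx' x's hx']] := hstep x Kx xs sg sgE.
  have E : md (T x' - u - (sg * (n.+1%:R * delta))%:C) <= n.+1%:R * (eta * delta).
    have -> : T x' - u - (sg * (n.+1%:R * delta))%:C =
      (T x - u - (sg * (n%:R * delta))%:C) + (T x' - T x - (sg * delta)%:C).
      rewrite nS mulrDl mul1r mulrDr (rmorphD (real_complex R)) /=; ring.
    by apply: (le_trans (mdD _ _)); rewrite nS; lra.
  have En : n.+1%:R * (eta * delta) <= tau / 2.
    have -> : n.+1%:R * (eta * delta) = eta * (n.+1%:R * delta) by ring.
    have : eta * (n.+1%:R * delta) <= 1 / 4 * a.
      by rewrite ler_pM ?(ltW eta0)// mulr_ge0// ltW.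
    lra.
  (* [step] only leaves [x'] in the disc of radius [s]. Its time coordinate being in the range of
     [surj], injectivity of [T] puts it back into the disc of radius [s / 2], where the next step
     may start. *)
  have [x'' xs'' xE] : exists2 z, md (z - w0) < s / 2 & T z = T x'.
    apply: surj.
    have -> : T x' - T w0 = (T x' - u - (sg * (n.+1%:R * delta))%:C) +
       (u - T w0) + (sg * (n.+1%:R * delta))%:C by ring.
    apply: (le_lt_trans (mdD _ _)); rewrite md_real normrM sg1 mul1r.
    have := mdD (T x' - u - (sg * (n.+1%:R * delta))%:C) (u - T w0).
    rewrite ger0_norm; first by lra.
    by rewrite mulr_ge0// ltW.
  exists x'; split => //; have [k1 _] := kT x's; have [k2 _] := kT (lt_trans xs'' s2).
  by rewrite -k1 -xE k2.
have [n /andP[n1 n2]] := floor_steps (normr_ge0 t) delta0.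
have [x [Kx xs hx]] := it n n1; exists x => //.
have [kx _] := kT (lt_trans xs s2); rewrite -kx -[y]ky; apply: hd.
have nS : n.+1%:R = n%:R + 1 :> R by rewrite -natr1.
have -> : T x - (u + t%:C) = (T x - u - (sg * (n%:R * delta))%:C) +
    (sg * (n%:R * delta - a))%:C.
  by rewrite mulrBr sga (rmorphB (real_complex R)) /=; ring.
apply: (le_lt_trans (mdD _ _)); rewrite md_real normrM sg1 mul1r.
have h1 : `|n%:R * delta - a| <= delta.
  by rewrite ler_norml; rewrite nS in n2; apply/andP; split; rewrite /a; lra.
have h2 : n%:R * (eta * delta) <= 2 * tau * eta.
  have -> : n%:R * (eta * delta) = n%:R * delta * eta by ring.
  by rewrite ler_wpM2r ?(ltW eta0)// (le_trans n1).
lra.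
Qed.

End Translation.

(** Directions for a sequence of precisions accumulate at some [u] on the unit circle. As [r <= 1],
    replacing [c n] by [u] adds an error of at most [delta * md (c n - u)], which is again small
    relative to [delta]. *)
Lemma fixed_direction K r p (e0 : R) : 0 < r <= 1 -> 0 < e0 ->
  (forall eta : R, 0 < eta -> eta <= e0 ->
    exists2 u, md u = 1 & flow_step K r p u eta) ->
  exists2 u, md u = 1 & forall eta : R, 0 < eta -> flow_step K r p u eta.
Proof.
move=> /andP[r0 r1] e00 h.
have /choice[c hc] : forall n : nat, exists u, md u = 1 /\
    flow_step K r p u (Num.min e0 n.+1%:R^-1).
  move=> n; have [||u u1 hu] := h (Num.min e0 n.+1%:R^-1).
  - by rewrite lt_min e00 invr_gt0 ltr0n.
  - by rewrite ge_min lexx.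
  by exists u.
have [|u [_ uc]] := @closed_ball_compact R 0 1 (c @ \oo).
  by exists 0%N => // n _; rewrite /= subr0 (hc n).1.
have near_u (e : R) : 0 < e -> exists n, md (c n - u) < e /\ n.+1%:R^-1 < e.
  move=> e_0; have [||_ [[n /= Nn <-] nu]] :=
      uc [set c n | n in [set n | n.+1%:R^-1 < e]] [set w | md (w - u) < e].
  - have [N _ hN] := near_infty_natSinv_lt (PosNum e_0).
    by exists N => // n Nn; exists n => //; exact: hN.
  - by apply/nbhs_md; exists e.
  by exists n.
have u1 : md u = 1.
  apply/eqP; rewrite eq_le; apply/andP; split; apply/ler_addgt0Pr => e e_0.
    have [n [cn _]] := near_u e e_0; have := (hc n).1.
    by have := md_triB u (c n); rewrite mdC; lra.
  have [n [cn _]] := near_u e e_0; have := (hc n).1.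
  by have := md_triB (c n) u; lra.
exists u => // eta eta0; have e2 : 0 < eta / 2 by lra.
have [n [cn nN]] := near_u (eta / 2) e2.
have [_ [delta [g [/andP[d0 d1] gc gd gK]]]] := hc n.
have me : Num.min e0 n.+1%:R^-1 <= eta / 2.
  by apply: (le_trans _ (ltW nN)); rewrite ge_min lexx orbT.
exists delta, g; split => //.
  by rewrite d0 /=; apply: (lt_le_trans d1); apply: (le_trans me); lra.
move=> w wr; have := gd w wr.
have -> : g w - w - delta%:C * u * w ^+ p = (g w - w - delta%:C * c n * w ^+ p) +
   delta%:C * (c n - u) * w ^+ p by ring.
move=> h1; apply: (le_trans (mdD _ _)); rewrite !mdM md_real mdX gtr0_norm//.
have w1 : md w ^+ p <= 1 by rewrite exprn_ile1 ?md_ge0//; lra.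
have h2 : delta * md (c n - u) * md w ^+ p <= delta * (eta / 2).
  apply: (@le_trans _ _ (delta * md (c n - u) * 1)).
    by rewrite ler_wpM2l// mulr_ge0 ?md_ge0// ltW.
  by rewrite mulr1 ler_wpM2l ?ltW.
have h3 : Num.min e0 n.+1%:R^-1 * delta <= eta / 2 * delta.
  by rewrite ler_wpM2r ?(ltW d0).
lra.
Qed.

(* [T] is a primitive of [1 / (c w ^ p)]. *)
Lemma flow_chart K r p (c w0 : R[i]) : 0 < r <= 1 -> md c = 1 ->
  (forall eta : R, 0 < eta -> flow_step K r p c eta) ->
  w0 != 0 -> md w0 < r ->
  exists T s, [/\ 0 < s <= r - md w0, chol w0 s T, cinj w0 s T &
    forall eta : R, 0 < eta -> exists2 delta : R, 0 < delta < eta &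
    forall x, K x -> md (x - w0) < s / 2 -> forall sg : R, sg = 1 \/ sg = -1 ->
    exists x', [/\ K x', md (x' - w0) < s &
      md (T x' - T x - (sg * delta)%:C) <= eta * delta]].
Proof.
move=> /andP[r0 r1] c1 fl w00 w0r; pose v := md w0.
have v0 : 0 < v by rewrite md_gt0.
have c0 : c != 0 by rewrite -md_gt0 c1.
pose G w := (c * w ^+ p)^-1.
have wv w : md (w - w0) < v -> w != 0.
  by apply: contraTneq => ->; rewrite sub0r mdN ltxx.
have cw0 w : w != 0 -> c * w ^+ p != 0 by move=> ?; rewrite mulf_neq0 ?expf_neq0.
have hG : chol w0 v G.
  move=> w /wv w_0; eexists; apply: cdiffV; last exact: cw0.
  by apply: cdiffZ; apply: cdiffX; exact: cdiff_id.
have [T hT] := primitive v0 hG.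
pose sa := Num.min (v / 3) (r - v).
have sa0 : 0 < sa by rewrite lt_min divr_gt0// subr_gt0.
have sa1 : sa <= v / 3 by rewrite ge_min lexx.
have sa2 : sa <= r - v by rewrite ge_min lexx orbT.
have hTa : chol w0 sa T by move=> w wa; eexists; apply: hT; lra.
have Tne : cder T w0 != 0.
  rewrite (cderE (hT w0 _)) ?subrr ?md0 ?divr_gt0//.
  by rewrite invr_eq0; exact: cw0.
have [s /andP[s0 ss] Tinj] := local_injective sa0 hTa Tne.
have hTs : chol w0 s T by move=> w ws; apply: hTa; lra.
exists T, s; split => //; first by rewrite s0 /= -/v; lra.
have [M M0 hM] := @chol_bounded _ T w0 s (7 / 8 * s) ltac:(lra) ltac:(lra) hTs.
have s80 : 0 < s / 8 by lra.
pose A := 36 * M / (s / 8) ^+ 2.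
have A0 : 0 <= A by rewrite divr_ge0 ?sqr_ge0// mulr_ge0.
pose Bd := (2 / v) ^+ p.
have Bd0 : 0 <= Bd by rewrite exprn_ge0// divr_ge0// ltW.
have inr w : md (w - w0) < s -> md w < r.
  by have := md_triB w w0; rewrite /v in sa2; lra.
have mdp w : md w < r -> md w ^+ p <= 1.
  by move=> /ltW wr; rewrite exprn_ile1 ?md_ge0// (le_trans wr).
(* First-order expansion of [T] at [w]: its derivative [G w] turns the field [c * w ^+ p] into 1.
   The deviation from the field costs [Bd * e * delta], and the quadratic remainder costs
   [4 * A * delta ^+ 2], at most [4 * A * e * delta]. *)
have est w w' (delta e : R) : 0 < delta -> delta <= s / 96 -> 0 < e -> e <= 1 ->
    delta <= e -> md (w - w0) < 3 / 4 * s ->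
    md (w' - w - delta%:C * c * w ^+ p) <= e * delta ->
    md (T w' - T w - delta%:C) <= (Bd + 4 * A) * e * delta.
  move=> d0 ds e_0 e1 de ws hw.
  have wr : md w < r by apply: inr; clear -ws s0; lra.
  have wp := mdp w wr.
  have dw : md (w' - w) <= 2 * delta.
    have -> : w' - w = (w' - w - delta%:C * c * w ^+ p) + delta%:C * c * w ^+ p by ring.
    apply: (le_trans (mdD _ _)); rewrite !mdM md_real c1 mulr1 mdX gtr0_norm//.
    clear -d0 e1 wp hw; nra.
  have hw8 : chol w (s / 8) T by apply: chol_sub hTs; clear -ws s0; lra.
  have Mw x : md (x - w) < s / 8 -> md (T x) <= M.
    by move=> xw; apply: hM; have := md_tri w x w0; clear -ws xw; lra.
  have := taylor_quadratic s80 hw8 Mw (z := w') => /(_ ltac:(clear -dw ds; lra)).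
  have w3 : md (w - w0) < v / 3 by clear -ws s0 ss sa1; lra.
  have w_0 : w != 0 by apply: wv; clear -w3 v0; lra.
  rewrite (cderE (hT w w3)) -/A => k1.
  have Gd : G w * (delta%:C * c * w ^+ p) = delta%:C.
    by rewrite /G -mulrA mulrCA mulVf ?mulr1//; exact: cw0.
  have E : T w' - T w - delta%:C = (T w' - T w - G w * (w' - w)) +
      G w * (w' - w - delta%:C * c * w ^+ p).
    by rewrite -[in LHS]Gd; ring.
  have Gw : md (G w) <= Bd.
    rewrite mdV mdM c1 mul1r mdX /Bd exprMn exprVn.
    have vw : v / 2 <= md w by have := md_triB w0 w; rewrite mdC -/v; clear -w3 v0; lra.
    rewrite -exprVn -exprMn -exprVn lerXn2r ?nnegrE ?invr_ge0 ?md_ge0//.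
      by rewrite divr_ge0// ltW.
    have -> : 2 / v = (v / 2)^-1 by rewrite invf_div.
    by rewrite lef_pV2 ?posrE//; [rewrite md_gt0|rewrite divr_gt0].
  rewrite E; apply: (le_trans (mdD _ _)); rewrite mdM.
  have k2 : md (G w) * md (w' - w - delta%:C * c * w ^+ p) <= Bd * (e * delta).
    by apply: ler_pM => //; exact: md_ge0.
  have k3 : A * md (w' - w) ^+ 2 <= A * (4 * (e * delta)).
    rewrite ler_wpM2l//; have := md_ge0 (w' - w); clear -dw de d0; nra.
  clear -k1 k2 k3; lra.
move=> eta eta0.
have Q0 : 0 < Bd + 4 * A + 1 by lra.
pose e := Num.min (Num.min 1 eta) (Num.min (s / 400) (eta / (Bd + 4 * A + 1))).
have e_0 : 0 < e.
  have s4 : 0 < s / 400 by clear -s0; lra.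
  by rewrite !lt_min ltr01 eta0 s4 divr_gt0.
have e1 : e <= 1 by rewrite !ge_min lexx.
have e2 : e <= eta by rewrite !ge_min lexx ?orbT.
have e3 : e <= s / 400 by rewrite !ge_min lexx ?orbT.
have e4 : (Bd + 4 * A) * e <= eta.
  have : e * (Bd + 4 * A + 1) <= eta by rewrite -ler_pdivlMr// !ge_min lexx ?orbT.
  clear -e_0; lra.
have [delta [g [/andP[d0 d1] gc gd gK]]] := fl e e_0.
exists delta; first by rewrite d0 /= (lt_le_trans d1).
have de := ltW d1; have ds : delta <= s / 400 := le_trans de e3.
have ds' : delta <= s / 96 by clear -ds s0; lra.
have fin (X : R) : X <= (Bd + 4 * A) * e * delta -> X <= eta * delta.
  by move=> /le_trans; apply; rewrite ler_wpM2r// ltW.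
have disp w : md w < r -> md (g w - w) <= 2 * delta.
  move=> wr; have := gd w wr.
  have wp := mdp w wr.
  have := mdD (g w - w - delta%:C * c * w ^+ p) (delta%:C * c * w ^+ p).
  rewrite subrK !mdM md_real c1 mulr1 mdX (gtr0_norm d0); clear -d0 e1 wp; nra.
(* A forward step applies [g]; a backward step takes a preimage of [x] under [g], provided by
   [local_surjection] because the derivative of [g] is close to 1. *)
move=> x Kx xs sg [->|->].
  have xr : md x < r by apply: inr; clear -xs s0; lra.
  exists (g x); split; first exact: (gK x xr).1.
    by have := md_tri x (g x) w0; have := disp x xr; clear -xs ds s0; lra.
  rewrite mul1r; apply: fin; apply: (est x (g x) delta e) => //; last exact: gd.
  by clear -xs s0; lra.
have xr2 : md x + s / 2 < r by have := md_triB x w0; clear -xs ss sa2; rewrite /v in sa2; lra.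
have cx : chol x (32 * delta) g by apply: chol_sub gc; rewrite subr0; clear -xr2 ds s0; lra.
have dg z : md (z - x) < 32 * delta -> md (cder g z - 1) <= 1 / 8.
  move=> zx; have zr : md z + s / 4 < r by have := md_triB z x; clear -xr2 zx ds s0; lra.
  have s40 : 0 < s / 4 by clear -s0; lra.
  have h : chol z (s / 4) (fun w => g w - w).
    move=> w wz; have [|d dd] := gc w.
      by rewrite subr0; have := md_triB w z; clear -wz zr; lra.
    by exists (d - 1); apply: cdiffB => //; exact: cdiff_id.
  have [d dd] : exists d, cdiff g z d by apply: gc; rewrite subr0; clear -zr s0; lra.
  rewrite (cderE dd) -(cderE (cdiffB dd (cdiff_id z))).
  have := @cauchy_cder _ _ z (s / 4) (2 * delta) s40 h.
  move=> /(_ _)/le_trans; apply.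
    by move=> w wz; apply: disp; have := md_triB w z; clear -wz zr; lra.
  by rewrite ler_pdivrMr//; clear -ds s0; lra.
have xx : md (x - x) < 32 * delta by rewrite subrr md0 mulr_gt0.
have dgx := dg x xx.
have dg1 : 7 / 8 <= md (cder g x).
  by have := md_triB 1 (cder g x); rewrite mdC md1; clear -dgx; lra.
have gx0 : cder g x != 0 by rewrite -md_gt0; clear -dg1; lra.
have d160 : 0 < 16 * delta by rewrite mulr_gt0.
have d1632 : 16 * delta < 32 * delta by rewrite ltr_pM2r// ltr_nat.
have half z : md (z - x) < 32 * delta -> md (cder g z - cder g x) <= md (cder g x) / 2.
  move=> /dg zx; have := md_tri 1 (cder g z) (cder g x).
  by rewrite [md (1 - _)]mdC; clear -zx dgx dg1; lra.
have [|x' x'x gx'] := local_surjection d160 d1632 cx gx0 half (b := x).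
  by rewrite mdC; have := disp x ltac:(clear -xr2 s0; lra); clear -d0 dg1; nra.
have x's : md (x' - w0) < 3 / 4 * s by have := md_tri x x' w0; clear -xs x'x ds s0; lra.
have x'r : md x' < r by apply: inr; clear -x's s0; lra.
exists x'; split.
- by apply: (gK x' x'r).2; rewrite gx'.
- by clear -x's s0; lra.
- rewrite mulN1r (rmorphN (real_complex R)) /= opprK -mdN.
  have -> : - (T x' - T x + delta%:C) = T x - T x' - delta%:C by ring.
  apply: fin; apply: (est x' x delta e) => //.
  by have := gd x' x'r; rewrite gx'.
Qed.

End Flow.

(** * From symmetries close to the identity to a laminar domain *)

Section NearIdentity.
Context {R : realType}.

Lemma ball_connected (a : R[i]) (r : R) : connected [set z | md (z - a) < r].
Proof.
have [r0|r0] := ltP 0 r; last first.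
  rewrite (_ : [set z | _] = set0); first exact: connected0.
  apply/seteqP; split => // z /=; have := md_ge0 (z - a); lra.
apply: (@star_connected _ _ a) => [|z t /= zr /andP[t0 t1]].
  by rewrite /= subrr md0.
rewrite addrAC subrr add0r mdM md_real ger0_norm//.
by apply: le_lt_trans zr; rewrite ler_piMl ?md_ge0.
Qed.

Lemma attracting_chol (K D : set R[i]) H b : local_symmetry K D H ->
  attracting_fixed_point D H b -> exists r : R,
  [/\ 0 < r, chol b r H, H b = b, 0 < md (cder H b) < 1 &
    forall x, md (x - b) < r -> (K x <-> K (H x))].
Proof.
move=> [[oD _] _ hH sK] [Db Hb]; have [r r0 hr] := (open_md D).1 oD b Db.
have cH : chol b r H by move=> z /hr/hH/derivable_cdiff.
have dH : cdiff H b (cder H b) by apply/cderP/cH; rewrite subrr md0.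
rewrite (derive1_cdiff dH) normE !ltcR => l01.
exists r; split => // x /hr Dx; have [h1 h2] := sK x Dx.
split=> [Kx|KHx]; first by case: h1.
by case: h2 => //; split => //; exists x.
Qed.

(** The Koenigs coordinate [phi] transports the problem to 0, where the results on scaling and flows
    apply; the laminar chart is the time coordinate [T] composed with [phi]. *)
Lemma near_identity_laminar (K : set R[i]) (D : set R[i]) H b (r1 : R) :
  closed K -> K b -> local_symmetry K D H -> attracting_fixed_point D H b ->
  (forall e : R, 0 < e -> exists x, [/\ K x, x != b & md (x - b) < e]) ->
  0 < r1 ->
  (forall e : R, 0 < e -> exists h,
    [/\ chol b r1 h, forall z, md (z - b) < r1 -> md (h z - z) <= e,
      ~ (exists2 t : R, 0 < t & forall z, md (z - b) < t -> h z = z) &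
      forall z, md (z - b) < r1 -> (K z <-> K (h z))]) ->
  exists U, [/\ domain U, U `&` K !=set0 & laminar_relative K U].
Proof.
move=> clK Kb symK attr perf r10 near.
have [rD [rD0 hH Hb l01 HK]] := attracting_chol symK attr.
pose lam := cder H b; rewrite -/lam in l01.
have [s1 [phi [/andP[s10 s1D] hphi phib dphib phiH]]] := koenigs rD0 hH Hb l01.
have dphi0 : cder phi b != 0 by rewrite dphib oner_eq0.
have [s2 /andP[s20 s21] iphi] := local_injective s10 hphi dphi0.
have hphi2 : chol b s2 phi by apply: chol_sub hphi; rewrite subrr md0 add0r.
have bb (r : R) : 0 < r -> md (b - b) < r by rewrite subrr md0.
have [k [kphi dk]] := cinj_inverse s20 hphi2 iphi.
have [dl dl0 hdl] : exists2 d : R, 0 < d & forall z, md (z - b) < d -> md (H z - b) < s2.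
  have [d dd] := hH b (bb _ rD0).
  by have [t t0 ht] := cdiff_ccont dd s20; exists t => // z /ht; rewrite Hb.
pose dl' := Num.min dl (Num.min r1 (s2 / 2)).
have dl'0 : 0 < dl' by rewrite !lt_min dl0 r10 divr_gt0.
have dle : [/\ dl' <= dl, dl' <= r1 & dl' <= s2 / 2].
  by rewrite !ge_min !lexx ?orbT.
have [rho rho0 hrho] := cinj_open hphi2 iphi (bb _ s20) dl'0.
rewrite phib in hrho.
have kw w : md w < rho -> md (k w - b) < dl' /\ phi (k w) = w.
  by move=> wr; have [|z [zd zs <-]] := hrho w; rewrite ?subr0// kphi.
(* The set [K] seen in the coordinate [phi], to be used on the disc of radius [rho], where [k]
   inverts [phi]. *)
pose Kt : set R[i] := [set w | K (k w)].
have lam0 : 0 < md lam by case/andP: l01.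
have lam1 : md lam < 1 by case/andP: l01.
have ck w : md w < rho -> ccont k w.
  move=> wr; have [zd E] := kw w wr; have [_] : cder phi (k w) != 0 /\
    cdiff k (phi (k w)) (cder phi (k w))^-1 by apply: dk; case: dle; lra.
  by rewrite E => /cdiff_ccont.
have Klam w : md w < rho -> (Kt w <-> Kt (lam * w)).
  move=> wr; have [zd E] := kw w wr; case: dle => d1 d2 d3.
  have zs : md (k w - b) < s1 by clear -zd d3 s21 s20; lra.
  have [Hs HE] := phiH _ zs.
  rewrite /Kt /= -[in K (k (lam * w))]E -HE kphi; last by apply: hdl; lra.
  by apply: HK; lra.
have [Mp Mp0 hMp] := @chol_bounded _ (cder phi) b s2 (3 / 4 * s2)
  ltac:(lra) ltac:(lra) (chol_cder hphi2).
have nearw (e : R) : 0 < e -> exists g, near_id_symmetry Kt rho rho e g.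
  (* [Mp] bounds the derivative of [phi], so the conjugated map moves points by at most [Mp * e'];
     [e' <= s2 / 4] keeps the values of [h] where this bound holds. *)
  move=> e0; pose e' := Num.min (e / (Mp + 1)) (s2 / 4).
  have Mp1 : 0 < Mp + 1 by lra.
  have e'0 : 0 < e' by rewrite lt_min !divr_gt0.
  have e'1 : Mp * e' <= e.
    have : e' * (Mp + 1) <= e by rewrite -ler_pdivlMr// ge_min lexx.
    lra.
  have e'2 : e' <= s2 / 4 by rewrite ge_min lexx orbT.
  have [h [hh hid hne hK]] := near e' e'0; case: dle => d1 d2 d3.
  have hz z : md (z - b) < dl' -> md (h z - b) < 3 / 4 * s2.
    move=> zd; have := hid z (lt_le_trans zd d2).
    by have := md_tri z (h z) b; clear -zd d3 e'2; lra.
  exists (fun w => phi (h (k w))); split.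
  - move=> w; rewrite subr0 => wr; have [zd E] := kw w wr.
    have [_] : cder phi (k w) != 0 /\ cdiff k (phi (k w)) (cder phi (k w))^-1.
      by apply: dk; clear -zd d3 s20; lra.
    rewrite E => dkw; have [dh dhE] := hh (k w) (lt_le_trans zd d2).
    have [|dp dpE] := hphi2 (h (k w)); first by have := hz _ zd; clear -s20; lra.
    by eexists; exact: (cdiff_comp dkw (cdiff_comp dhE dpE)).
  - move=> w wr; have [zd E] := kw w wr; rewrite -[in X in _ - X]E.
    have h3 : chol b (3 / 4 * s2) phi by apply: chol_sub hphi2; rewrite subrr md0; clear -s20; lra.
    have := @lipschitz_cder _ phi b (3 / 4 * s2) Mp (k w) (h (k w)) h3.
    move=> /(_ _ _ (hz _ zd))/le_trans; apply; first by move=> x /ltW/hMp.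
      clear -zd d3 s20; lra.
    apply: le_trans e'1; rewrite ler_wpM2l//.
    exact/hid/(lt_le_trans zd).
  - move=> [t t0 ht]; apply: hne.
    have mt : 0 < Num.min t rho by rewrite lt_min t0.
    have [d d0 hd] := cdiff_ccont (cderP (hphi2 b (bb _ s20))) mt.
    exists (Num.min d dl'); first by rewrite lt_min d0.
    move=> z; rewrite lt_min => /andP[/hd + zd]; rewrite phib subr0 lt_min.
    have zs : md (z - b) < s2 by clear -zd d3 s20; lra.
    move=> /andP[zt zr]; have := ht _ zt; rewrite kphi// => E.
    by apply: iphi => //; have := hz z zd; clear -s20; lra.
  - move=> w wr gr; have [zd E] := kw w wr.
    rewrite /Kt /= kphi; last by have := hz _ zd; clear -s20; lra.
    exact/hK/(lt_le_trans zd).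
have [p hp] := flow_step_exists lam0 lam1 rho0 rho0 Klam nearw.
set rho2 := Num.min 1 _ in hp.
have rho20 : 0 < rho2 by rewrite !lt_min ltr01 !divr_gt0.
have rho21 : 0 < rho2 <= 1 by rewrite rho20 ge_min lexx.
have rho2r : rho2 <= rho / 2 by rewrite !ge_min lexx ?orbT.
have e00 : 0 < Num.min 1 (rho / 4) by rewrite lt_min ltr01 divr_gt0.
have [|c c1 hc] := @fixed_direction _ Kt rho2 p (Num.min 1 (rho / 4)) rho21 e00.
  by move=> eta eta0; rewrite le_min => /andP[? ?]; exact: hp.
(* The chart needs a centre [w0] other than 0, where the field may vanish; [K] provides one because
   [b] is not isolated. *)
have [x [Kx xb xr]] : exists x, [/\ K x, x != b & md (x - b) < s2 /\ md (phi x) < rho2].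
  have [d d0 hd] := cdiff_ccont (cderP (hphi2 b (bb _ s20))) rho20.
  have mds : 0 < Num.min d s2 by rewrite lt_min d0.
  have [x [Kx xb]] := perf _ mds; rewrite lt_min => /andP[/hd + xs].
  by rewrite phib subr0 => xr; exists x.
case: xr => xs xr; pose w0 := phi x.
have w00 : w0 != 0.
  apply: contraNneq xb => E; apply/eqP; apply: iphi => //; first exact: bb.
  by rewrite -/w0 E phib.
have [T [s [/andP[s0 sr] hT iT step]]] := flow_chart rho21 c1 hc w00 xr.
have [kT [kTT dkT]] := cinj_inverse s0 hT iT.
have ww (r : R) : 0 < r -> md (w0 - w0) < r by rewrite subrr md0.
have [c4 c40 hc4] := cinj_open hT iT (ww _ s0) (divr_gt0 s0 (ltr0n _ 2)).
pose tau := c4 / 4; have tau0 : 0 < tau by rewrite divr_gt0.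
have surj u : md (u - T w0) < 4 * tau -> exists2 z, md (z - w0) < s / 2 & T z = u.
  have -> : 4 * tau = c4 by rewrite /tau; field.
  by move=> /hc4[w [w1 _ w2]]; exists w.
have inrho w : md (w - w0) < s -> md w < rho.
  by have := md_triB w w0; clear -sr rho2r rho0; lra.
have kTc z : md (z - w0) < s -> kT (T z) = z /\ ccont kT (T z).
  by move=> zs; split; [exact: kTT|have [_ /cdiff_ccont] := dkT z zs].
have clKt y : md (y - w0) < s ->
    (forall e : R, 0 < e -> exists2 x, Kt x & md (x - y) < e) -> Kt y.
  move=> ys h; apply: clK; apply/closure_md => e e0.
  have [d d0 hd] := ck y (inrho y ys) e e0.
  by have [z Kz zy] := h d d0; exists (k z) => //; exact: hd.
have trans := translation_invariant s0 tau0 kTc clKt step surj.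
pose N : set R[i] := [set z | [/\ md (z - b) < s2, md (phi z - w0) < s / 2 &
  md (T (phi z) - T w0) < tau]].
pose kap u := k (kT u).
have kapN u : md (u - T w0) < tau ->
    [/\ N (kap u), T (phi (kap u)) = u & ccont kap u].
  move=> ut; have [|w ws wE] := surj u; first by clear -ut tau0; lra.
  have ws' : md (w - w0) < s by clear -ws s0; lra.
  have [kw1 kw2] := kTc w ws'; rewrite wE in kw1 kw2.
  have [zd zE] := kw w (inrho w ws'); case: dle => _ _ d3.
  rewrite /kap kw1 zE wE; split => //.
    by rewrite /N /= zE wE; split => //; clear -zd d3 s20; lra.
  by apply: (ccont_comp kw2); rewrite kw1; exact/ck/inrho.
have TheN z : N z -> [/\ md (T (phi z) - T w0) < tau, kap (T (phi z)) = z &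
    exists d, cdiff (fun z => T (phi z)) z d].
  move=> [z1 z2 z3]; split => //.
    by rewrite /kap kTT ?kphi//; clear -z2 s0; lra.
  have [d dd] := hphi2 z z1; have [|d' dd'] := hT (phi z); first by clear -z2 s0; lra.
  by eexists; exact: (cdiff_comp dd dd').
have openN : open N.
  apply/open_md => z Nz; have [_ _ [d dd]] := TheN z Nz; case: Nz => z1 z2 z3.
  have a0 : 0 < tau - md (T (phi z) - T w0) by rewrite subr_gt0.
  have [ta ta0 hta] := cdiff_ccont dd a0.
  have b0 : 0 < s / 2 - md (phi z - w0) by rewrite subr_gt0.
  have [tb tb0 htb] := cdiff_ccont (cderP (hphi2 z z1)) b0.
  exists (Num.min (s2 - md (z - b)) (Num.min ta tb)).
    by rewrite !lt_min ta0 tb0 subr_gt0 z1.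
  move=> w; rewrite !lt_min => /and3P[w1 /hta w2 /htb w3]; split.
  - by have := md_tri z w b; clear -w1; lra.
  - by have := md_tri (phi z) (phi w) w0; clear -w3; lra.
  - by have := md_tri (T (phi z)) (T (phi w)) (T w0); clear -w2; lra.
exists N; split.
- split => //.
  have -> : N = kap @` [set u | md (u - T w0) < tau].
    apply/seteqP; split=> [z /TheN[z1 z2 _]|_ [u /kapN[Nu _ _] <-]//].
    by exists (T (phi z)).
  apply: connected_continuous_connected; first exact: ball_connected.
  by apply: continuous_in_subspaceT => u; rewrite inE => /kapN[_ _ /ccontP].
- exists x; split => //; split => //; rewrite -/w0 ?subrr ?md0//.
  by rewrite divr_gt0.
- have tr u (t : R) : md (u - T w0) < tau -> md (u + t%:C - T w0) < tau ->
    K (kap u) -> K (kap (u + t%:C)) by move=> u1 u2; exact: trans.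
  exact: (@chart_laminar R K N kap (fun z => T (phi z)) (T w0) tau clK openN kapN
    TheN tr).
Qed.

End NearIdentity.

(** * The conformal self-maps of a compact set *)

Section CompactSets.
Context {R : realType}.
Implicit Types (K : set R[i]).

Lemma seq_min (T : eqType) (s : seq T) (r : T -> R) : (forall x, x \in s -> 0 < r x) ->
  exists2 m : R, 0 < m & forall x, x \in s -> m <= r x.
Proof.
elim: s => [|a s IH] h; first by exists 1.
have [x xs|m m0 hm] := IH; first by rewrite h// inE xs orbT.
exists (Num.min m (r a)); first by rewrite lt_min m0 h ?mem_head.
move=> x; rewrite inE ge_min => /orP[/eqP->|/hm->//].
by rewrite lexx orbT.
Qed.

Lemma compact_net K (r : R[i] -> R) : compact K -> (forall x, K x -> 0 < r x) ->
  exists s : seq R[i], (forall x, x \in s -> K x) /\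
    forall y, K y -> exists2 x, x \in s & md (y - x) < r x.
Proof.
rewrite compact_cover => cK r0.
have [x Kx|y Ky|D' DK Dcov] := cK _ K (fun x => [set y | md (y - x) < r x]).
- exact: open_ball_md.
- by exists y => //=; rewrite subrr md0 r0.
exists (finmap.enum_fset D'); split=> [x /DK|y /Dcov[x xD xy]]; first by rewrite inE.
by exists x.
Qed.

Lemma compact_uniform K (P : R[i] -> R -> Prop) : compact K ->
  (forall y (r r' : R), 0 < r' -> r' <= r -> P y r -> P y r') ->
  (forall x, K x -> exists2 r : R, 0 < r & forall y, md (y - x) < r -> P y r) ->
  exists2 r : R, 0 < r & forall y, K y -> P y r.
Proof.
move=> cK mono loc.
have /choice[r hr] : forall x, exists r, K x -> 0 < r /\ forall y, md (y - x) < r -> P y r.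
  move=> x; have [Kx|Kx] := pselect (K x); last by exists 0.
  by have [r r0 h] := loc x Kx; exists r.
have [s [sK scov]] := compact_net cK (fun x Kx => (hr x Kx).1).
have [m m0 hm] := seq_min (fun x xs => (hr x (sK x xs)).1).
exists m => // y /scov[x xs xy]; apply: mono (hm x xs) _ => //.
exact: (hr x (sK x xs)).2.
Qed.

Lemma compact_thickening K (V : set R[i]) : compact K -> open V -> K `<=` V ->
  exists2 r : R, 0 < r & forall x, K x -> forall z, md (z - x) < r -> V z.
Proof.
move=> cK /open_md oV KV; apply: compact_uniform => //.
  by move=> y r r' _ rr h z zr; apply: h; exact: lt_le_trans rr.
move=> x /KV/oV[e e0 he]; exists (e / 2); first by rewrite divr_gt0.
move=> y yx z zy; apply: he; have := md_tri y z x; lra.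
Qed.

Lemma compact_bounded K : compact K ->
  exists2 M : R, 0 < M & forall x, K x -> md x <= M.
Proof.
move=> cK; have [s [sK scov]] := @compact_net K (fun=> 1) cK (fun _ _ => ltr01).
exists (\sum_(x <- s) md x + 1).
  by rewrite ltr_wpDl// sumr_ge0// => x _; exact: md_ge0.
move=> y /scov[x xs xy].
have : md x <= \sum_(x <- s) md x.
  by rewrite (big_rem x)//= lerDl sumr_ge0// => z _; exact: md_ge0.
have := md_triB y x; lra.
Qed.

Lemma not_isolated_md K : isolated K = set0 -> forall x, K x ->
  forall e : R, 0 < e -> exists y, [/\ K y, y != x & md (y - x) < e].
Proof.
move=> iso x Kx e e0; apply: contrapT => h.
have : isolated K x.
  split; first by rewrite inE.
  exists [set y | md (y - x) < e]; first by apply/nbhs_md; exists e.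
  apply/seteqP; split=> [y [/= yx Ky]|y ->]; last by split => //=; rewrite subrr md0.
  by apply: contrapT => /eqP yx'; apply: h; exists y.
by rewrite iso.
Qed.

(** Compactness makes the absence of isolated points uniform at each scale [d]. The bound [e] need
    not be proportional to [d], as it would be in the classical notion of a uniformly perfect
    set. *)
Lemma uniformly_perfect K : compact K -> isolated K = set0 ->
  forall d : R, 0 < d -> exists2 e : R, 0 < e & forall p, K p ->
    exists y, [/\ K y, e <= md (y - p) & md (y - p) <= d].
Proof.
move=> cK /not_isolated_md perf d d0; apply: compact_uniform => //.
  by move=> y r r' _ rr [z [z1 z2 z3]]; exists z; split => //; exact: le_trans z2.
move=> x Kx; have d2 : 0 < d / 2 by lra.
have [y [Ky yx yd]] := perf x Kx _ d2.
have m0 : 0 < md (y - x) by rewrite md_gt0 subr_eq0.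
exists (md (y - x) / 2) => [|p px]; first by rewrite divr_gt0.
exists y; split => //.
  by have := md_tri p y x; lra.
by have := md_tri x y p; rewrite [md (x - p)]mdC; lra.
Qed.

End CompactSets.

(** * Distortion estimates uniform over the family of self-maps *)

Section SelfMaps.
Context {R : realType}.
Implicit Types (f g h k : R[i] -> R[i]) (a b p z w x y : R[i]).

Lemma mdJ z : md (conjc z) = md z.
Proof. by case: z => x y; rewrite /md /= sqrrN. Qed.

Lemma conjB z w : conjc (z - w) = conjc z - conjc w.
Proof. exact: (rmorphB (@conjc R)). Qed.

(** Conjugation preserves moduli and injectivity, so the estimates for holomorphic maps extend to
    both types at once. *)
Definition semihol a (r : R) f := chol a r f \/ chol a r (fun z => conjc (f z)).

Lemma semihol_sub f a b (r s : R) : md (b - a) + s <= r -> semihol a r f -> semihol b s f.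
Proof. by move=> h [|] /(chol_sub h); [left|right]. Qed.

Lemma semihol_lip f a (r M : R) : 0 < r -> semihol a r f ->
  (forall z, md (z - a) < r -> md (f z) <= M) ->
  forall z, md (z - a) <= r / 6 -> md (f z - f a) <= 12 * M / r * md (z - a).
Proof.
move=> r0 [hf|hf] hM z zr; first exact: taylor_lip hM z zr.
have hM' w : md (w - a) < r -> md (conjc (f w)) <= M by rewrite mdJ; exact: hM.
by have := taylor_lip r0 hf hM' zr; rewrite -conjB mdJ.
Qed.

Definition koebe_const (C : R) := forall f a (r : R) p, 0 < r -> semihol a r f ->
  cinj a r f -> (forall z, md (z - a) < r -> f z != p) ->
  forall y y' : R[i], md (y - a) < r / 6 -> md (y' - a) < r / 6 ->
    md (f y - p) <= C * md (f y' - p).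

Lemma koebe_semihol : exists2 C : R, 1 <= C & koebe_const C.
Proof.
have [C C1 hC] := @koebe R; exists C => // f a r p r0 [hf|hf] fi fp y y' yr y'r.
  exact: (hC f a r p).
have ci : cinj a r (fun z => conjc (f z)).
  by move=> z w zr wr /(can_inj (@conjcK R)); exact: fi.
have om z : md (z - a) < r -> conjc (f z) != conjc p.
  by move=> zr; rewrite (can_eq (@conjcK R)) fp.
by have := hC _ a r (conjc p) r0 hf ci om y y' yr y'r; rewrite -!conjB !mdJ.
Qed.

Section Family.
Variables (K V : set R[i]) (r0 C : R).
Hypotheses (cK : compact K) (perfK : isolated K = set0).
Hypotheses (r00 : 0 < r0) (thick : forall x, K x -> forall z, md (z - x) < r0 -> V z).
Hypotheses (C1 : 1 <= C) (hC : koebe_const C).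

Definition self_map f := [/\ f @` K = K, set_inj V f &
  forall x, K x -> semihol x r0 f].

Let inV x z : K x -> md (z - x) < r0 -> V z. Proof. by move=> /thick; apply. Qed.

Lemma self_map_cinj f a (r : R) : self_map f ->
  (forall z, md (z - a) < r -> V z) -> cinj a r f.
Proof. by move=> [_ fi _] h z w /h zV /h wV; apply: fi; rewrite inE. Qed.

(** A point [f z] of [K] is the image of a point of [K], which is [z] by injectivity on [V]. Applied
    to both [f] and [g], this makes [g^-1 f] preserve [K]. *)
Lemma self_mapK f z : self_map f -> V z -> (forall x, K x -> V x) ->
  (K z <-> K (f z)).
Proof.
move=> [fK fi _] Vz KV; split=> [Kz|]; first by rewrite -fK; exists z.
rewrite -{1}fK => -[x Kx /fi]; rewrite !inE => <- //.
exact: KV.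
Qed.

(* [K] contains points at [N + 1] very different scales around [p = f z], but
   the Koebe theorem confines [f] to one scale on each of the [N] discs of a
   cover not containing [z]. *)
Lemma nondegenerate (s : R) : 0 < s -> exists2 c : R, 0 < c &
  forall f z, self_map f -> K z -> exists x, [/\ K x, md (x - z) < s & c <= md (f x - f z)].
Proof.
move=> s0; wlog sr : s s0 / s <= r0.
  move=> W; have m0 : 0 < Num.min s r0 by rewrite lt_min s0.
  have [|c c0 h] := W _ m0; first by rewrite ge_min lexx orbT.
  exists c => // f z hf Kz; have [x [Kx xz cx]] := h f z hf Kz.
  by exists x; split => //; apply: lt_le_trans xz _; rewrite ge_min lexx.
have s12 : 0 < s / 12 by lra.
have [xs [xsK xscov]] := @compact_net _ K (fun=> s / 12) cK (fun _ _ => s12).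
have /choice[E hE] : forall d : R, exists e : R, 0 < d -> [/\ 0 < e, e <= d & forall p, K p ->
    exists y, [/\ K y, e <= md (y - p) & md (y - p) <= d]].
  move=> d; have [d0|d0] := ltP 0 d; last by exists 0.
  have [e e0 he] := uniformly_perfect cK perfK d0.
  exists (Num.min e d) => _; split; first by rewrite lt_min e0.
    by rewrite ge_min lexx orbT.
  move=> p /he[y [y1 y2 y3]]; exists y; split => //.
  by rewrite ge_min y2.
have C0 : 0 < C := lt_le_trans ltr01 C1.
(* Scales for which the annuli between [E (d n)] and [d n] are separated by factors [2 * C], more
   than the distortion [C] that the Koebe theorem allows. *)
pose d := fix d n : R := if n is m.+1 then E (d m) / (2 * C) else 1.
have d0 n : 0 < d n.
  elim: n => [|n IH] //=; have [e0 _ _] := hE _ IH.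
  by rewrite divr_gt0// mulr_gt0.
have Ed n : E (d n) = 2 * C * d n.+1 by rewrite /=; field; rewrite gt_eqF.
have dS n : 2 * C * d n.+1 <= d n by rewrite -Ed; have [] := hE _ (d0 n).
have dle i j : (i <= j)%N -> d j <= d i.
  elim: j => [|j IH]; first by rewrite leqn0 => /eqP->.
  rewrite leq_eqVlt => /orP[/eqP->//|]; rewrite ltnS => /IH IHd.
  apply: le_trans IHd; apply: le_trans (dS j).
  by rewrite ler_peMl ?(ltW (d0 _))//; have := C1; lra.
pose N := size xs.
exists (E (d N)); first by have [] := hE _ (d0 N).
move=> f z hf Kz; apply: contrapT => nx; have [fK fi fs] := hf.
have Kp : K (f z) by rewrite -fK; exists z.
(* A point of [K] whose image lies in the [i]-th annulus around [f z]. It is at distance at least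
   [s] from [z], since a closer one would already be the point sought. *)
have /choice[u hu] : forall i, exists x, (i <= N)%N -> [/\ K x, s <= md (x - z),
    E (d i) <= md (f x - f z) & md (f x - f z) <= d i].
  move=> i; have [iN|iN] := leqP i N; last by exists 0.
  have [_ _ /(_ _ Kp)[y [Ky y1 y2]]] := hE _ (d0 i).
  move: Ky y1 y2; rewrite -{1}fK => -[x Kx <-] y1 y2; exists x => _; split => //.
  rewrite leNgt; apply/negP => xz; apply: nx; exists x; split => //.
  apply: le_trans y1; rewrite !Ed; have := dle _ _ (iN : (i.+1 <= N.+1)%N).
  by rewrite ler_pM2l// mulr_gt0.
have /choice[j hj] : forall i, exists q, (i <= N)%N -> q \in xs /\ md (u i - q) < s / 12.
  move=> i; have [iN|iN] := leqP i N; last by exists 0.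
  have [Kx _ _ _] := hu i iN; have [q qx qd] := xscov _ Kx.
  by exists q.
have : ~~ uniq [seq j i | i <- iota 0 N.+1].
  apply/negP => uS.
  have sub : {subset [seq j i | i <- iota 0 N.+1] <= xs}.
    move=> q; case/seq.mapP => i; rewrite mem_iota add0n ltnS => /andP[_ iN] ->.
    by have [] := hj i iN.
  by have := uniq_leq_size uS sub; rewrite size_map size_iota ltnn.
move=> /(uniqPn 0)[i [i' [ii']]]; rewrite size_map size_iota => i'N.
have iN : (i < N.+1)%N by exact: ltn_trans i'N.
rewrite !(nth_map 0%N) ?size_iota// !nth_iota// !add0n => jE.
have [qx ui] := hj i iN; have [_ ui'] := hj i' i'N; rewrite -jE in ui'.
have [Ku us u1 _] := hu i iN; have [_ _ _ u2] := hu i' i'N.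
set q := j i in jE qx ui ui'; have Kq := xsK _ qx.
have s2 : 0 < s / 2 by lra.
have sh : semihol q (s / 2) f by apply: semihol_sub (fs q Kq); rewrite subrr md0; lra.
have ci : cinj q (s / 2) f.
  by apply: self_map_cinj hf _ => w wq; apply: (inV Kq); lra.
have om w : md (w - q) < s / 2 -> f w != f z.
  move=> wq; apply/negP => /eqP/fi; rewrite !inE => /(_ (inV Kq _) (inV Kz _)) wz.
  have {}wz : w = z by apply: wz; rewrite ?subrr ?md0//; lra.
  by have := md_tri q (u i) z; rewrite wz [md (z - q)]mdC in wq; lra.
have := hC s2 sh ci om (y := u i) (y' := u i') ltac:(lra) ltac:(lra).
have := dle _ _ ii'; rewrite Ed in u1; have := d0 i.+1; nra.
Qed.

(** On a disc too small to contain both of two chosen points of [K], the map omits its value [f y]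
    at one of them; the Koebe theorem then compares [f z - f y] with [f x - f y], whose two terms
    lie in [K]. *)
Lemma self_map_bounded : K !=set0 -> exists r M : R, [/\ 0 < r <= r0, 0 <= M &
  forall f x z, self_map f -> K x -> md (z - x) < r -> md (f z) <= M].
Proof.
move=> [x0 Kx0]; have C0 : 0 < C := lt_le_trans ltr01 C1.
have [x1 [Kx1 x10 _]] := not_isolated_md perfK Kx0 ltr01.
have m0 : 0 < md (x1 - x0) by rewrite md_gt0 subr_eq0.
pose r := Num.min r0 (md (x1 - x0) / 2).
have r_0 : 0 < r by rewrite lt_min r00 divr_gt0.
have rr : r <= r0 by rewrite ge_min lexx.
have r2 : r <= md (x1 - x0) / 2 by rewrite ge_min lexx orbT.
have [M M0 hM] := compact_bounded cK.
exists (r / 6), ((2 * C + 1) * M); split.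
- by apply/andP; split; lra.
- by rewrite mulr_ge0 ?(ltW M0)//; lra.
move=> f x z hf Kx zx; have [fK fi fs] := hf.
have [y Ky yx] : exists2 y, K y & r <= md (y - x).
  have [h|h] := leP r (md (x1 - x)); first by exists x1.
  by exists x0 => //; have := md_tri x x1 x0; rewrite [md (x - x0)]mdC; lra.
have sh : semihol x r f by apply: semihol_sub (fs x Kx); rewrite subrr md0; lra.
have ci : cinj x r f by apply: self_map_cinj hf _ => w wq; apply: (inV Kx); lra.
have om w : md (w - x) < r -> f w != f y.
  move=> wq; apply/negP => /eqP/fi; rewrite !inE => /(_ (inV Kx _) (inV Ky _)) wz.
  have {}wz : w = y by apply: wz; rewrite ?subrr ?md0//; lra.
  by rewrite wz in wq; lra.
have xx : md (x - x) < r / 6 by rewrite subrr md0; lra.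
have := hC r_0 sh ci om zx xx.
have Kf w : K w -> K (f w) by move=> Kw; rewrite -fK; exists w.
have := hM _ (Kf _ Kx); have := hM _ (Kf _ Ky).
have := mdB (f x) (f y); have := md_triB (f z) (f y); nra.
Qed.

Section NearPoint.
Variables (b : R[i]) (rb : R).
Hypotheses (Kb : K b) (rb0 : 0 < rb) (rbr : rb <= r0).

Let inVb z : md (z - b) < rb -> V z.
Proof. by move=> zb; apply: (inV Kb); exact: lt_le_trans rbr. Qed.

Let cball f a (r : R) : self_map f -> md (a - b) + r <= rb -> semihol a r f /\ cinj a r f.
Proof.
move=> hf ar; have [_ _ fs] := hf; split.
  by apply: semihol_sub (fs b Kb); have := rbr; lra.
by apply: self_map_cinj hf _ => z za; apply: inVb; have := md_tri a z b; lra.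
Qed.

(** Multiplying the radius by [8 / 7] costs a factor [C]. For [y] on the circle of radius
    [t * (7 / 8)] around [z], the open disc around [y] of that radius omits the value [f z], and a
    sixth of its radius reaches beyond distance [t] from [z], as [7 / 8 * (7 / 6) > 1]. *)
Lemma oscillation_growth f z n (t m : R) : self_map f -> md (z - b) < rb / 8 ->
  0 < t -> t <= rb / 4 -> 0 <= m ->
  (forall x, md (x - z) <= t * (7 / 8) ^+ n -> md (f x - f z) <= m) ->
  forall x, md (x - z) <= t -> md (f x - f z) <= C ^+ n * m.
Proof.
move=> hf zb; elim: n t => [|n IH] t t0 tr m0 h x xt.
  by rewrite mul1r; apply: h; rewrite expr0 mulr1.
have C0 : 0 < C := lt_le_trans ltr01 C1.
have t80 : 0 < t * (7 / 8) by lra.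
have {}IH := IH (t * (7 / 8)) t80 ltac:(lra) m0 ltac:(by move=> w; rewrite -mulrA -exprS; exact: h).
have Cn : C ^+ n * m <= C ^+ n.+1 * m.
  by rewrite exprS -mulrA ler_peMl ?mulr_ge0// exprn_ge0// ltW.
have [xt8|xt8] := leP (md (x - z)) (t * (7 / 8)).
  exact: le_trans (IH x xt8) Cn.
pose v : R := t * (7 / 8) / md (x - z).
have m_0 : 0 < md (x - z) by lra.
have v0 : 0 < v by rewrite divr_gt0.
have v1 : v <= 1 by rewrite ler_pdivrMr//; lra.
pose y := z + v%:C * (x - z).
have yz : md (y - z) = t * (7 / 8).
  by rewrite /y addrAC subrr add0r mdM md_real gtr0_norm// divfK// gt_eqF.
have xy : md (x - y) < t * (7 / 8) / 6.
  have -> : x - y = (1 - v)%:C * (x - z) by rewrite /y (rmorphB (real_complex R)) /=; ring.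
  rewrite mdM md_real ger0_norm ?subr_ge0// mulrBl mul1r divfK ?gt_eqF//; lra.
have yb : md (y - b) + t * (7 / 8) <= rb by have := md_tri z y b; have := rb0; lra.
have [sh ci] := cball hf yb.
have om w : md (w - y) < t * (7 / 8) -> f w != f z.
  have [_ fi _] := hf; move=> wy; apply/negP => /eqP/fi; rewrite !inE => wz.
  have {}wz : w = z.
    by apply: wz; apply: inVb; have := rb0; [have := md_tri y w b; lra|lra].
  by move: wy; rewrite wz mdC yz ltxx.
have yy : md (y - y) < t * (7 / 8) / 6 by rewrite subrr md0; lra.
apply: (le_trans (hC t80 sh ci om xy yy)).
by rewrite exprS -mulrA ler_wpM2l ?(ltW C0)// IH// yz.
Qed.

(** This extends [nondegenerate] to points off [K]. If the oscillation near [z] were tiny,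
    [oscillation_growth] would keep it below [c0 / 3] on the disc of radius [rb / 4], which contains
    [b] and a point whose image is [c0] away from [f b]. *)
Lemma oscillation (s : R) : 0 < s -> exists2 c : R, 0 < c &
  forall f z, self_map f -> md (z - b) < rb / 8 ->
    exists2 x, md (x - z) < s & c <= md (f x - f z).
Proof.
move=> s0; have rb8 : 0 < rb / 8 by have := rb0; lra.
have [c0 c00 hc0] := nondegenerate rb8.
have q01 : 0 <= (7 / 8 : R) < 1 by apply/andP; split; lra.
have [n /(_ n (leqnn n)) hn] := geometric_small (rb / 4) q01 s0.
have C0 : 0 < C := lt_le_trans ltr01 C1.
have Cn : 0 < C ^+ n by rewrite exprn_gt0.
pose m := c0 / 3 / C ^+ n.
have m0 : 0 < m by rewrite !divr_gt0.
exists m => // f z hf zb; apply: contrapT => nx.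
have rb4 : 0 < rb / 4 by have := rb0; lra.
have small x : md (x - z) <= rb / 4 * (7 / 8) ^+ n -> md (f x - f z) <= m.
  move=> xz; rewrite leNgt; apply/negP => mx; apply: nx; exists x; last exact: ltW.
  exact: le_lt_trans hn.
have K1 := oscillation_growth hf zb rb4 (lexx _) (ltW m0) small.
have [x [Kx xb cx]] := hc0 f b hf Kb.
have := K1 x ltac:(have := md_tri b x z; rewrite [md (b - z)]mdC; lra).
have := K1 b ltac:(rewrite mdC; lra).
have -> : C ^+ n * m = c0 / 3 by rewrite /m mulrC divfK// gt_eqF.
by have := md_tri (f z) (f x) (f b); rewrite [md (f z - f b)]mdC; lra.
Qed.

(** The argument of [cinj_open], with the lower bound of [oscillation] in place of one that depends
    on the map. *)
Lemma uniform_openness (s : R) : 0 < s -> exists2 c : R, 0 < c &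
  forall f z p, self_map f -> md (z - b) < rb / 8 -> md (p - f z) < c ->
    exists2 x, md (x - z) < s & f x = p.
Proof.
move=> s0; pose t := Num.min s (rb / 2).
have t0 : 0 < t by rewrite lt_min s0 divr_gt0.
have ts : t <= s by rewrite ge_min lexx.
have tr : t <= rb / 2 by rewrite ge_min lexx orbT.
have t60 : 0 < t / 6 by lra.
have [c c0 hc] := oscillation t60.
have C2 : 0 < C + 2 by have := C1; lra.
exists (c / (C + 2)); first exact: divr_gt0.
move=> f z p hf zb pc; apply: contrapT => nx.
have om w : md (w - z) < t -> f w != p.
  move=> wz; apply/negP => /eqP wp; apply: nx; exists w => //.
  exact: lt_le_trans ts.
have zt : md (z - b) + t <= rb by have := rb0; lra.
have [sh ci] := cball hf zt.
have [x xz cx] := hc f z hf zb.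
have zz : md (z - z) < t / 6 by rewrite subrr md0.
have := hC t0 sh ci om xz zz; move: pc; rewrite ltr_pdivlMr//.
have := md_tri p (f x) (f z); have := md_ge0 (p - f z).
by rewrite [md (f z - p)]mdC; nra.
Qed.

End NearPoint.

End Family.

(** The map [h] is [g^-1 f]. Antiholomorphic pairs reduce to holomorphic ones, since conjugating
    both maps does not change [g^-1 f]. *)
Lemma transition_map f g b (r s : R) : 0 < r -> s <= r / 8 ->
  (chol b r f /\ chol b r g) \/
  (chol b r (fun z => conjc (f z)) /\ chol b r (fun z => conjc (g z))) ->
  cinj b r g ->
  (forall z, md (z - b) < r / 8 -> exists2 x, md (x - z) < s & g x = f z) ->
  exists2 h, chol b (r / 8) h &
    forall z, md (z - b) < r / 8 -> md (h z - z) < s /\ g (h z) = f z.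
Proof.
wlog H : f g / chol b r f /\ chol b r g.
  move=> W r0 sr [|hc gi ex]; first by move=> H; apply: W => //; left.
  have [||z /ex[x xz gx]|h hh hz] := W _ _ hc r0 sr.
  - by left.
  - by move=> z w zr wr /(can_inj (@conjcK R)); exact: gi.
  - by exists x => //; rewrite gx.
  by exists h => // z /hz[h1 /(can_inj (@conjcK R))].
case: H => hf hg r0 sr _ gi ex; have [k [kg dk]] := cinj_inverse r0 hg gi.
have hE z : md (z - b) < r / 8 -> exists x, [/\ md (x - z) < s, md (x - b) < r,
    g x = f z & k (f z) = x].
  move=> zb; have [x xz gx] := ex z zb.
  have xr : md (x - b) < r by have := md_tri z x b; lra.
  by exists x; split => //; rewrite -gx kg.
exists (fun z => k (f z)) => z zb; have [x [xz xr gx kx]] := hE z zb.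
  have [|d dd] := hf z; first lra.
  have [_] := dk x xr; rewrite gx => dkx.
  by eexists; exact: (cdiff_comp dd dkx).
by rewrite kx.
Qed.

End SelfMaps.

(** * Connected components and the identity theorem *)

Section Components.
Context {R : realType}.
Implicit Types (D V K : set R[i]) (f g u : R[i] -> R[i]) (a b x z w : R[i]).

Lemma identity_theorem D u b (t : R) : open D -> connected D ->
  (forall z, D z -> exists d, cdiff u z d) -> D b -> 0 < t ->
  (forall w, md (w - b) < t -> u w = 0) -> forall z, D z -> u z = 0.
Proof.
move=> oD cD hu Db t0 ub.
pose Z : set R[i] := [set z | D z /\ exists2 t : R, 0 < t &
  forall w, md (w - z) < t -> u w = 0].
have oZ : open Z.
  apply/open_md => z [Dz [s s0 hs]]; have [e e0 he] := (open_md D).1 oD z Dz.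
  exists (Num.min e (s / 2)) => [|w]; first by rewrite lt_min e0 divr_gt0.
  rewrite lt_min => /andP[/he Dw ws]; split => //.
  exists (s / 2) => [|w' ww']; first by rewrite divr_gt0.
  by apply: hs; have := md_tri w w' z; lra.
have ZE : Z = D.
  apply: cD.
  - by exists b; split => //; exists t.
  - by exists Z => //; apply/seteqP; split=> [z []|z [_]//]; split.
  exists (closure Z); first exact: closed_closure.
  apply/seteqP; split=> [z Zz|z [Dz clz]].
    by split; [case: Zz|exact: subset_closure].
  split => //; have [r r0 hr] := (open_md D).1 oD z Dz.
  (* The distance from [z'] to [z] and a radius [r / 50] around [z] fit together into the radius
     [r / 2 / 12] that [zero_order] gives at [z']. *)
  have r50 : 0 < r / 50 by lra.
  have [z' [Dz' [s s0 hs]] zz] := (closure_md Z z).1 clz _ r50.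
  have r20 : 0 < r / 2 by lra.
  have hz' : chol z' (r / 2) u.
    by move=> w wz; apply/hu/hr; have := md_tri z' w z; lra.
  have [h|[p [c [A [s' [c0 s'0 h]]]]]] := zero_order r20 hz'.
    exists (r / 50) => // w wz; apply: h; have := md_tri z w z'.
    by rewrite [md (z - z')]mdC; lra.
  have [q q0 hq] := isolated_zero c0 s'0 h.
  have m0 : 0 < Num.min s q by rewrite lt_min s0.
  pose w := z' + (Num.min s q / 2)%:C.
  have wz : md (w - z') = Num.min s q / 2.
    by rewrite /w addrAC subrr add0r md_real gtr0_norm// divr_gt0.
  have wlt : md (w - z') < Num.min s q by rewrite wz; lra.
  have wne : w != z'.
    by apply: contraTneq m0 => wz'; move: wz; rewrite wz' subrr md0; lra.
  move: wlt; rewrite lt_min => /andP[ws wq].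
  by have := hq w wq wne; rewrite hs// eqxx.
by move=> z; rewrite -ZE => -[_ [s s0 hs]]; apply: hs; rewrite subrr md0.
Qed.

Lemma ball_component V x (r : R) : 0 < r -> (forall z, md (z - x) < r -> V z) ->
  forall z, md (z - x) < r -> connected_component V x z.
Proof.
move=> r0 hV; apply: (@connected_component_max _ V [set z | md (z - x) < r]).
- by rewrite /= subrr md0.
- exact: hV.
- exact: ball_connected.
Qed.

Lemma open_component V x : open V -> open (connected_component V x).
Proof.
move=> /open_md oV; apply/open_md => z zC.
have Vz : V z by exact: connected_component_sub zC.
have [e e0 he] := oV z Vz; exists e => // w wz.
rewrite (same_connected_component zC).
exact: (ball_component e0 he).
Qed.

Lemma conformal_cases V f x : conformal V f -> V x ->
  (forall z, connected_component V x z -> exists d, cdiff f z d) \/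
  (forall z, connected_component V x z -> exists d, cdiff (fun z => conjc (f z)) z d).
Proof.
move=> cf Vx; have [_ [h|h]] := cf x Vx; [left|right] => z /h;
  by move/derivable_cdiff.
Qed.

Lemma code_finite (X Y : Type) (T : finType) (A : set X) (sl : X -> Y) (Phi : X -> T) :
  (forall f g : X, A f -> A g -> Phi f = Phi g -> sl f = sl g) -> finite_set (sl @` A).
Proof.
move=> h; have [->|/set0P[f0 Af0]] := eqVneq A set0.
  by rewrite image_set0; exact: finite_set0.
have /choice[rep hrep] : forall t, exists f : X,
    (exists g : X, A g /\ Phi g = t) -> A f /\ Phi f = t.
  move=> t; have [[g hg]|ng] := pselect (exists g : X, A g /\ Phi g = t); first by exists g.
  by exists f0.
apply: (@sub_finite_set _ _ ((fun t => sl (rep t)) @` [set: T])).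
  move=> _ [f Af <-]; exists (Phi f) => //.
  have [|Ar Pr] := hrep (Phi f); first by exists f.
  exact: h.
by apply: finite_image; exact: finite_finset.
Qed.

Lemma sigL_neq V (f g : R[i] -> R[i]) : sigL V f <> sigL V g ->
  exists2 z, V z & f z <> g z.
Proof.
move=> h; apply: contrapT => nz; apply: h; apply/funext => -[x xV].
rewrite /sigL /=; apply: contrapT => fg; apply: nz.
by exists x => //; exact: set_mem.
Qed.

End Components.

(** * Pigeonhole on the values of infinitely many maps *)

Section ClosePairs.
Context {R : realType}.
Variables (K V : set R[i]) (r0 rM M : R).
Hypothesis KV : K `<=` V.
Hypothesis compV : forall z, V z -> connected_component V z `&` K !=set0.
Hypotheses (r00 : 0 < r0) (thick : forall x, K x -> forall z, md (z - x) < r0 -> V z).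
Hypotheses (rM0 : 0 < rM) (rMr : rM <= r0) (M0 : 0 <= M).
Hypothesis bounded : forall f x z, self_map K V r0 f -> K x -> md (z - x) < rM ->
  md (f z) <= M.

Definition conf_maps : set (R[i] -> R[i]) :=
  [set f | [/\ f @` K = K, conformal V f & set_inj V f]].

Definition hol_type (x : R[i]) (f : R[i] -> R[i]) : Prop :=
  forall z, connected_component V x z -> exists d, cdiff f z d.

(** The maps differ on the component of [x] itself: being of the same type there, they coincide near
    no point of it, by the identity theorem. *)
Definition close_pair (x : R[i]) (e : R) := exists f g,
  [/\ conf_maps f, conf_maps g, hol_type x f <-> hol_type x g,
      exists2 z, connected_component V x z & f z <> g z &
      forall y, md (y - x) < rM / 4 -> md (f y - g y) < e].

Lemma conf_self_map f : conf_maps f -> self_map K V r0 f.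
Proof.
move=> [fK cf fi]; split => // x Kx.
have [h|h] := conformal_cases cf (KV Kx); [left|right] => z zx; apply: h;
  exact: (ball_component r00 (thick Kx)).
Qed.

Lemma ball_same_component x z : K x -> md (z - x) < r0 ->
  connected_component V x = connected_component V z.
Proof.
move=> Kx zx; apply: same_connected_component.
exact: (ball_component r00 (thick Kx)).
Qed.

(** A map is coded by its type on the components that [xs] meets and, at each net point, by the net
    values that are [e / 8]-close. Two distinct maps with the same code differ on some component,
    which meets [K] and hence is the component of some point of [xs]. *)
Lemma close_pair_exists (xs : seq R[i]) : (forall x, x \in xs -> K x) ->
  (forall y, K y -> exists2 x, x \in xs & md (y - x) < rM / 4) ->
  ~ finite_set (conformal_injective_maps K V) ->
  forall e : R, 0 < e -> exists2 x, x \in xs & close_pair x e.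
Proof.
move=> xsK xscov inf e e0.
(* A Lipschitz constant common to all the maps at the net points; the mesh [d] turns it into errors
   of at most [e / 4], so that the total is two of these and two of [e / 8]. *)
pose L : R := 12 * M / (rM / 2).
have L0 : 0 <= L by apply: divr_ge0; [exact: mulr_ge0|have := rM0; lra].
have L1 : 0 < 4 * (L + 1) by lra.
pose d := Num.min (rM / 12) (e / (4 * (L + 1))).
have d0 : 0 < d by rewrite lt_min !divr_gt0.
have d1 : d <= rM / 12 by rewrite ge_min lexx.
have d2 : L * d <= e / 4.
  have : d * (4 * (L + 1)) <= e by rewrite -ler_pdivlMr// ge_min lexx orbT.
  lra.
have /choice[net hnet] : forall x, exists s : seq R[i],
    (forall p, p \in s -> md (p - x) <= rM / 4) /\
    forall y, md (y - x) <= rM / 4 -> exists2 p, p \in s & md (y - p) < d.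
  move=> x; exact: (@compact_net _ _ (fun=> d) (@closed_ball_compact R x (rM / 4)) (fun _ _ => d0)).
have e80 : 0 < e / 8 by lra.
have [vs [_ vscov]] := @compact_net _ _ (fun=> e / 8) (@closed_ball_compact R 0 M)
  (fun _ _ => e80).
pose ps := flatten [seq net x | x <- xs].
pose Phi (f : R[i] -> R[i]) := ([ffun i : 'I_(size xs) => `[< hol_type (nth 0 xs i) f >]],
  [ffun ij : 'I_(size ps) * 'I_(size vs) =>
    md (f (nth 0 ps ij.1) - nth 0 vs ij.2) < e / 8]).
have [f [g [Af Ag Pfg fg]]] : exists f g, [/\ conf_maps f, conf_maps g, Phi f = Phi g &
    sigL V f <> sigL V g].
  apply: contrapT => nfg; apply: inf.
  apply: (@code_finite _ _ _ conf_maps (@sigL _ _ V) Phi) => f g Af Ag Pfg.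
  by apply: contrapT => fg; apply: nfg; exists f, g.
have [z Vz fgz] := sigL_neq fg.
have [k [kz Kk]] := compV Vz; have [x xxs kx] := xscov k Kk.
have Kx := xsK _ xxs.
have Cx : connected_component V x = connected_component V z.
  rewrite (ball_same_component Kx (_ : md (k - x) < r0)); last by have := rMr; lra.
  by rewrite (same_connected_component kz).
exists x => //; exists f, g; split => //.
- have xi : (index x xs < size xs)%N by rewrite index_mem.
  have /ffunP/(_ (Ordinal xi)) := congr1 fst Pfg.
  by rewrite !ffunE /= nth_index// => E; rewrite -(asboolE (hol_type x f)) E asboolE.
- by exists z => //; rewrite Cx; exact: connected_component_refl.
have lip h y p : conf_maps h -> md (p - x) <= rM / 4 -> md (y - p) < d ->
    md (h y - h p) <= e / 4.
  move=> Ah px yp; have sh := conf_self_map Ah; have [_ _ /(_ _ Kx) sx] := sh.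
  have rM2 : 0 < rM / 2 by have := rM0; lra.
  have sp : semihol p (rM / 2) h by apply: semihol_sub sx; have := rMr; have := rM0; lra.
  have hM w : md (w - p) < rM / 2 -> md (h w) <= M.
    move=> wp; apply: (bounded sh Kx); have := md_tri p w x; have := rM0; lra.
  have dr := d1; apply: (le_trans (semihol_lip rM2 sp hM _)); first lra.
  apply: le_trans d2; rewrite ler_wpM2l//; exact: ltW.
move=> y yx; have [p pn yp] := (hnet x).2 y (ltW yx).
have px := (hnet x).1 p pn.
have pps : p \in ps by apply/flattenP; exists (net x) => //; exact: map_f.
have [v vvs fv] : exists2 v, v \in vs & md (f p - v) < e / 8.
  apply: vscov; rewrite /= subr0; apply: (bounded (conf_self_map Af) Kx).
  by have := rM0; lra.
have gv : md (g p - v) < e / 8.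
  have pi : (index p ps < size ps)%N by rewrite index_mem.
  have vi : (index v vs < size vs)%N by rewrite index_mem.
  have /ffunP/(_ (Ordinal pi, Ordinal vi)) := congr1 snd Pfg.
  by rewrite !ffunE /= !nth_index// fv => <-.
have := lip f y p Af px yp; have := lip g y p Ag px yp.
have := md_tri (f p) (f y) (g y); have := md_tri v (f p) (g y).
have := md_tri (g p) v (g y); rewrite [md (v - g p)]mdC [md (g p - g y)]mdC.
lra.
Qed.

(** There are finitely many centres and closeness is monotone in [e], so one centre serves all
    [e]. *)
Lemma close_pair_point (xs : seq R[i]) :
  (forall e : R, 0 < e -> exists2 x, x \in xs & close_pair x e) ->
  exists2 x, x \in xs & forall e : R, 0 < e -> close_pair x e.
Proof.
move=> h; apply: contrapT => nx.
have /choice[E hE] : forall x, exists e : R, x \in xs -> 0 < e /\ ~ close_pair x e.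
  move=> x; have [xxs|] := boolP (x \in xs); last by exists 0.
  have /existsNP[e /not_implyP[e0 ne]] : ~ forall e : R, 0 < e -> close_pair x e.
    by move=> k; apply: nx; exists x.
  by exists e.
have [m m0 hm] := seq_min (fun x xxs => (hE x xxs).1).
have [x xxs [f [g [h1 h2 h3 h4 h5]]]] := h m m0; have [_] := hE x xxs; apply.
by exists f, g; split => // y /h5 /lt_le_trans; apply; exact: hm.
Qed.

End ClosePairs.

Theorem theorem2p4 (R : realType) (K V : set R[i])
  (cptK : compact K) (JK : J_like K) (nlK : non_laminar K)
  (noisoK : isolated K = set0)
  (openV : open V) (KV : K `<=` V)
  (compV : forall z, V z -> connected_component V z `&` K !=set0) :
  finite_set (conformal_injective_maps K V).
Proof.
apply: contrapT => inf; have clK : closed K.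
  by apply: compact_closed => //; exact: norm_hausdorff.
have perf := not_isolated_md noisoK.
have [r0 r00 thick] := compact_thickening cptK openV KV.
have [C C1 hC] := @koebe_semihol R.
(* If [K] were empty, [V] would be empty too, and all maps would agree on it. *)
have K0 : K !=set0.
  have [f [g fg]] : exists f g : R[i] -> R[i], sigL V f <> sigL V g.
    apply: contrapT => nfg; apply: inf.
    apply: (@code_finite _ _ unit _ _ (fun=> tt)) => f g _ _ _.
    by apply: contrapT => fg; apply: nfg; exists f, g.
  by have [z /compV[k [_ Kk]] _] := sigL_neq fg; exists k.
have [rM [M [/andP[rM0 rMr] M0 bnd]]] := self_map_bounded cptK noisoK r00 thick C1 hC K0.
have rM4 : 0 < rM / 4 by lra.
have [xs [xsK xscov]] := @compact_net _ K (fun=> rM / 4) cptK (fun _ _ => rM4).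
have [x xxs pairs] := close_pair_point
  (close_pair_exists KV compV r00 thick rM0 rMr M0 bnd xsK xscov inf).
have Kx := xsK _ xxs.
have rM8 : 0 < rM / 8 by lra.
(* Density of the attracting fixed points moves the centre from [x] to [b]; the disc of radius
   [rM / 8] around [b] stays in the disc of radius [rM / 4] around [x], on which the pairs are
   close. *)
have [b [Kb [D [H [symH attr]]]] bx] := (closure_md _ x).1 (JK x Kx) _ rM8.
have Cb : connected_component V x = connected_component V b.
  by apply: (ball_same_component r00 thick) => //; lra.
pose rb := rM / 8; have rb8 : 0 < rb / 8 by rewrite /rb; lra.
have rbr : rb <= r0 by rewrite /rb; lra.
have inVb z : md (z - b) < rb -> V z by move=> zb; apply: (thick b Kb); lra.
have inC z : md (z - b) < rb -> connected_component V x z.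
  by rewrite Cb; exact: (ball_component rM8 inVb).
apply: nlK; apply: (near_identity_laminar clK Kb symH attr (perf b Kb) rb8) => e e0.
pose s := Num.min e (rb / 8); have s0 : 0 < s by rewrite lt_min e0.
have se : s <= e by rewrite ge_min lexx.
have sb : s <= rb / 8 by rewrite ge_min lexx orbT.
(* Values within [c] of each other force [g^-1 f] to be within [s] of the identity, whatever the
   pair: [c] is fixed before the pair is drawn. *)
have [c c0 hc] := uniform_openness cptK noisoK r00 thick C1 hC Kb rM8 rbr s0.
have [f [g [Af Ag tfg [z1 z1C fgz1] fgc]]] := pairs c c0.
have sf := conf_self_map KV r00 thick Af; have sg := conf_self_map KV r00 thick Ag.
have types : (hol_type V x f /\ hol_type V x g) \/
    (hol_type V x (fun z => conjc (f z)) /\ hol_type V x (fun z => conjc (g z))).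
  have [_ cf _] := Af; have [_ cg _] := Ag.
  have [hf|nf] := pselect (hol_type V x f); first by left; split => //; exact/tfg.
  right; split; first by case: (conformal_cases cf (KV _ Kx)).
  by case: (conformal_cases cg (KV _ Kx)) => // hg; case: nf; exact/tfg.
have gi : cinj b rb g by exact: self_map_cinj sg inVb.
have [|z zb|h hh hz] := @transition_map _ f g b rb s rM8 sb _ gi.
- by case: types => -[hf hg]; [left|right]; split => z /inC; [exact: hf|exact: hg|
    exact: hf|exact: hg].
- apply: hc => //; apply: fgc; have := md_tri b z x; rewrite /rb in zb; lra.
exists h; split => //.
- by move=> z /hz[/ltW/le_trans + _]; apply.
(* If [h] were the identity near [b], then [f] and [g] would agree near [b], hence on the whole
   component, which contains [z1]. *)
- move=> [t t0 ht]; apply: fgz1.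
  have eqfg w : md (w - b) < Num.min t (rb / 8) -> f w = g w.
    by rewrite lt_min => /andP[wt /hz[_ <-]]; rewrite ht.
  have m0 : 0 < Num.min t (rb / 8) by rewrite lt_min t0.
  have bC : connected_component V x b by apply: inC; rewrite subrr md0.
  have oC := @open_component _ V x openV.
  have cC := @component_connected _ V x.
  case: types => -[hf hg].
    apply/eqP; rewrite -subr_eq0; apply/eqP.
    apply: (identity_theorem (u := fun z => f z - g z) oC cC _ bC m0) => // z.
      move=> zC; have [d1 hd1] := hf z zC; have [d2 hd2] := hg z zC.
      by exists (d1 - d2); exact: cdiffB.
    by move=> /eqfg ->; rewrite subrr.
  apply: (can_inj (@conjcK R)); apply/eqP; rewrite -subr_eq0; apply/eqP.
  apply: (identity_theorem (u := fun z => conjc (f z) - conjc (g z)) oC cC _ bC m0) => // z.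
    move=> zC; have [d1 hd1] := hf z zC; have [d2 hd2] := hg z zC.
    by exists (d1 - d2); exact: cdiffB.
  by move=> /eqfg ->; rewrite subrr.
- move=> z zb; have [hzz ghf] := hz z zb.
  rewrite (self_mapK sf (inVb z _) KV); last by lra.
  rewrite -ghf -(self_mapK sg (inVb (h z) _) KV)//.
  by have := md_tri z (h z) b; lra.
Qed.
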